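(* Let $\alpha > 0$ and $-1 < \beta < 0$. There exists a Borel probability measure $\mu$ on $\mathbb{R}$ such that the following hold: (i) The support of $\mu$ is contained in $[-1/2,1/2] \cap E(\alpha)$. (ii) For any $\epsilon > 0$ there is a constant $C_\epsilon > 0$ such that $\mu(I) \leq C_\epsilon |I|^{\frac{2+\beta}{2+\alpha}-\epsilon}$ for every interval $I \subseteq \mathbb{R}$. (iii) For any $\epsilon > 0$ there is a constant $C_\epsilon > 0$ such that $|\mathcal{F}(\mu)(\xi)| \leq C_\epsilon (1+|\xi|)^{-\frac{1}{2+\alpha}+\epsilon}$ for every $\xi \in \mathbb{R}$. (iv) There exists a sequence of nonnegative functions $\{f_k\}_{k \in \mathbb{N}}$ such that, for all $1 < q < \infty$ and $1 \le p < \infty$, $$\sup_{k \geq 1} \frac{\|\mathcal{F}(f_k \mu)\|_{L^p(\lambda)}}{\|f_k\|_{L^q(\mu)}} = \infty \qquad \text{whenever} \quad p < p_-(q) := \frac{q}{q-1}\left(1+\alpha-\beta\right).$$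
   Context: $E(\alpha)$ is the set of all $x \in \mathbb{R}$ such that $|x - r/q| \leq |q|^{-(2+\alpha)}$ for infinitely many pairs $(q,r) \in \mathbb{Z}\times\mathbb{Z}$ with $q \neq 0$. For a finite (complex) measure $\nu$ on $\mathbb{R}$, $\mathcal{F}(\nu)(\xi) = \int_{\mathbb{R}} e^{-2\pi i x \xi}\, d\nu(x)$. $\lambda$ is Lebesgue measure on $\mathbb{R}$, $|I|$ is the Lebesgue measure of the interval $I$, and $f_k\mu$ is the measure with density $f_k$ with respect to $\mu$.
   Formalization: In (ii), ε is restricted to 0 < ε ≤ (2+β)/(2+α); for larger ε the exponent is negative and the bound fails for every probability measure, as I = [-L,L] with L → ∞ shows. *)

(* Defs.v *)
From HB Require Import structures.
From mathcomp Require Import all_boot all_order all_algebra complex.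
From mathcomp Require Import all_classical all_reals all_analysis.
From mathcomp Require Import measurable_realfun.

Set Implicit Arguments.
Unset Strict Implicit.
Unset Printing Implicit Defensive.

Import Order.TTheory GRing.Theory Num.Theory.
Import numFieldNormedType.Exports.
Import ComplexField.

Local Open Scope classical_set_scope.
Local Open Scope ring_scope.

Section well_approximable.
Context {R : realType}.

Definition approx_pairs (alpha x : R) : set (int * int) :=
  [set qr | qr.1 != 0 /\
     `|x - qr.2%:~R / qr.1%:~R| <= `|qr.1%:~R : R| `^ (- (2 + alpha))].

(* (q, r) and (-q, -r), as well as non-reduced fractions, count as distinct
   pairs. *)
Definition well_approximable (alpha : R) : set R :=
  [set x | infinite_set (approx_pairs alpha x)].

End well_approximable.

(* The closed topological support. *)
Definition msupport {R : realType}
    (mu : {measure set (measurableTypeR R) -> \bar R}) : set R :=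
  [set x | forall U : set R, open U -> U x -> (0 < mu U)%E].

Section fourier.
Context {R : realType}.
Implicit Type nu : {measure set (measurableTypeR R) -> \bar R}.

Definition expi (t : R) : R[i] := (cos t +i* sin t)%C.

Definition cintegral nu (f : R -> R[i]) : R[i] :=
  (Rintegral nu setT (fun x => complex.Re (f x)) +i*
   Rintegral nu setT (fun x => complex.Im (f x)))%C.

(* Meaningful for finite nu only: Rintegral is 0 on an infinite integral. *)
Definition fourier nu (xi : R) : R[i] :=
  cintegral nu (fun x => expi (- (2 * pi * x * xi))).

(* The modulus as an element of R; `|z| would be a complex number. *)
Definition fourier_abs nu (xi : R) : R := Normc.normc (fourier nu xi).

End fourier.

(* The measure f mu of density f >= 0 with respect to mu; the proofs mf and f0
   are arguments so that it has a canonical measure structure. *)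
Section density.
Context d {T : measurableType d} {R : realType}.
Variables (mu : {measure set T -> \bar R}) (f : T -> R).
Hypotheses (mf : measurable_fun setT f) (f0 : forall x, 0 <= f x).

Definition mdensity (_ : measurable_fun setT f) (_ : forall x, 0 <= f x)
  (A : set T) : \bar R := (\int[mu]_(x in A) (f x)%:E)%E.

Let mdensity0 : mdensity mf f0 set0 = 0%E.
Proof. by rewrite /mdensity integral_set0. Qed.

Let mdensity_ge0 A : (0 <= mdensity mf f0 A)%E.
Proof. by apply: integral_ge0 => x _; rewrite lee_fin. Qed.

Let mdensity_sigma_additive : semi_sigma_additive (mdensity mf f0).
Proof.
apply: semi_sigma_additive_nng_induced; last by move=> x; rewrite lee_fin.
exact/measurable_EFinP.
Qed.

HB.instance Definition _ := isMeasure.Build d T R (mdensity mf f0)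
  mdensity0 mdensity_ge0 mdensity_sigma_additive.

End density.

(* Main.v *)
Require Import Defs.
From HB Require Import structures.
From mathcomp Require Import all_boot all_order all_algebra.
From mathcomp Require Import all_classical all_reals all_analysis.
From mathcomp Require Import measurable_realfun.
From mathcomp Require Import ring lra zify.
Set Implicit Arguments.
Unset Strict Implicit.
Unset Printing Implicit Defensive.
Import Order.TTheory GRing.Theory Num.Theory.
Import numFieldNormedType.Exports.
Local Open Scope classical_set_scope.
Local Open Scope ring_scope.

(* Fourier transforms are replaced by the real integrals of [cos (2 pi (x xi + p))], for all
   phases [p].  A density is made well approximable by multiplying it by the average, over
   about [M / log M] primes [q <= M], of the 1-periodic triangle waves of width
   [M ^ -(1 + alpha)] in the variable [q x].  The Fourier coefficients of this factor sit at
   multiples of the primes, and an integer [l] has at most [log l] prime divisors, so the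
   transform changes by at most a small multiple of [gauge], which is
   [|xi| ^ (- 1 / (2 + alpha))] up to logarithms; the distribution function changes little, and
   the Frostman exponent survives because it is smaller than [2 / (2 + alpha)].  Iterating with
   summable errors gives a Lebesgue-Stieltjes measure supported on well approximable numbers.

   This is applied to the combs of bumps of width [Q ^ -(2 + alpha)] at the fractions [r / Q] for
   [Q ^ (1 + beta) < r <= 2 Q ^ (1 + beta)], of total mass [2 ^ -j / Q], for a sparse sequence of
   integers [Q = Q_j].  The measure mu is the normalised sum of the resulting blocks, and [f_j]
   is the indicator of the interval of length about [Q ^ beta] carrying the [j]-th block.  Near
   each multiple [n Q] with [n <= Q ^ (1 + alpha) / 64], up to a distance [Q ^ (- beta) / 64],
   the transform of [f_j mu] is comparable to the mass of the block, which makes the quotient of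
   norms at least [2 ^ -j Q ^ theta] with
   [theta = (1 + alpha - beta) / p - (1 - 1 / q) > 0], up to a constant. *)

(** * Primes of size about [2 ^ m] *)

(** Why the exponents fit together. Put w = Q^-(2 + alpha). The transform of a comb comes back to
    the order of its full mass near multiples of Q up to frequencies about 1 / w, so this mass can
    be at most about w^(1 / (2 + alpha)) = 1 / Q. Spread over about Q^(1 + beta) teeth, it leaves
    Q^-(2 + beta) = w^((2 + beta) / (2 + alpha)) per tooth, which is the Frostman exponent. A tooth
    certifies the single denominator Q; the iteration must supply infinitely many others while
    moving the transform by at most a quarter of the mass k / Q. This is possible because the scale
    M is chosen after the density, whose Lipschitz constant and decay constant may be arbitrarily
    bad. The error is nevertheless compared with a fixed [gauge]: near frequency M^(2 + alpha) the
    bare power is 1 / M, whereas an average over M / log M primes has coefficients of size about log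
    M / M, so the logarithms in [gauge] are what makes the relative error small. The blocks
    accumulate at 0, which may then lie in the closed support; 0 is well approximable through the
    fractions 0 / q. *)

Section Primes.
Local Open Scope nat_scope.

(** With d = p^k, this bounds by one the contribution of d to the exponent of p in the central
    binomial coefficient, and makes it vanish for d > 2n. *)
Lemma leq_divn_double n d : 0 < d -> (n.*2 %/ d <= (n %/ d).*2 + (d <= n.*2)).
Proof.
move=> d0; case: (leqP d n.*2) => h; last by rewrite divn_small.
rewrite -ltnS addn1 ltn_divLR //.
have := ltn_mod n d; rewrite d0 => H.
have := divn_eq n d; nia.
Qed.

Lemma leq_sum_expn_leq p N M : prime p -> 0 < N ->
  \sum_(1 <= k < M.+1) (p ^ k <= N) <= trunc_log p N.
Proof.
move=> pp N0; have p1 := prime_gt1 pp.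
have H : forall k, (p ^ k <= N) = (k <= trunc_log p N).
  move=> k; apply/idP/idP => h; first exact: trunc_log_max.
  by apply: leq_trans (trunc_logP p1 N0); rewrite leq_exp2l.
elim: M => [|M IH]; first by rewrite big_geq.
rewrite big_nat_recr //=.
have: \sum_(1 <= k < M.+1) (p ^ k <= N) <= M.
  rewrite -[X in _ <= X](_ : \sum_(1 <= k < M.+1) 1 = M); last by rewrite sum_nat_const_nat muln1 subn1.
  apply: leq_sum => i _; exact: leq_b1.
rewrite H; case: leqP => h /= h2; lia.
Qed.

(** By Legendre's formula the exponent of p counts at most one unit for each k with p^k <= 2n, hence
    is at most the logarithm of 2n in base p. *)
Lemma expn_logn_bin p n : prime p -> 0 < n -> p ^ logn p 'C(n.*2, n) <= n.*2.
Proof.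
move=> pp n0; have p1 := prime_gt1 pp.
have n20 : 0 < n.*2 by rewrite double_gt0.
apply: leq_trans (trunc_logP p1 n20); rewrite leq_exp2l //.
have hb : 'C(n.*2, n) * (n`! * n`!) = (n.*2)`!.
  have := @bin_fact n.*2 n; rewrite (_ : n.*2 - n = n); last by lia.
  by apply; lia.
have := congr1 (logn p) hb.
rewrite !lognM ?muln_gt0 ?fact_gt0 ?bin_gt0 //; last by lia.
rewrite !logn_fact // => E.
have : \sum_(1 <= k < n.*2.+1) n.*2 %/ p ^ k <=
    \sum_(1 <= k < n.*2.+1) ((n %/ p ^ k).*2 + (p ^ k <= n.*2)).
  by apply: leq_sum => k _; apply: leq_divn_double; rewrite expn_gt0 prime_gt0.
rewrite big_split /=.
(* The terms with k > n vanish since p^k > n; this matches the range that [logn_fact] gives for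
   n. *)
have -> : \sum_(1 <= k < n.*2.+1) (n %/ p ^ k).*2 =
   (\sum_(1 <= k < n.+1) n %/ p ^ k).*2.
  rewrite -(big_endo double) ?double0 //; last by move=> x y; rewrite doubleD.
  congr double; rewrite (big_cat_nat (n := n.+1)) //=; last by lia.
  rewrite [X in _ + X]big1_seq ?addn0 // => k /andP[_].
  rewrite mem_index_iota => /andP[h _]; apply: divn_small.
  apply: leq_ltn_trans (ltn_expl k p1); lia.
have := leq_sum_expn_leq n.*2 pp n20; lia.
Qed.

Lemma leq_exp2_bin n : 2 ^ n <= 'C(n.*2, n).
Proof.
elim: n => [|n IH] //.
rewrite doubleS !binS expnS mul2n -addnn.
apply: leq_add.
  apply: leq_trans IH _; apply: leq_trans (leq_addl _ _).
  by [].
apply: leq_trans IH _; exact: leq_bin2l.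
Qed.

(** Chebyshev's argument: the central binomial coefficient is at least 2^n, and it is a product of
    prime powers each at most 2n, one for each prime up to 2n. *)
Lemma leq_expn_count_primes n : 0 < n ->
  2 ^ n <= n.*2 ^ count prime (iota 0 n.*2.+1).
Proof.
move=> n0; apply: leq_trans (leq_exp2_bin n) _.
have C0 : 0 < 'C(n.*2, n) by rewrite bin_gt0; lia.
rewrite -[X in X <= _](partnT C0) /partn.
have -> : \prod_(0 <= p < ('C(n.*2, n)).+1 | p \in predT) p ^ logn p 'C(n.*2, n) =
  \prod_(p <- iota 0 ('C(n.*2, n)).+1 | prime p && (p <= n.*2)) p ^ logn p 'C(n.*2, n).
  rewrite /index_iota subn0 [RHS]big_mkcond /=; apply: eq_bigr => p _.
  case: ifP => //; case: (boolP (prime p)) => [pp|npp] /=; last first.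
    by rewrite /logn (negbTE npp).
  move=> h; case: (posnP (logn p 'C(n.*2, n))) => [->//|l0].
  have := expn_logn_bin pp n0.
  have : p ^ 1 <= p ^ logn p 'C(n.*2, n) by rewrite leq_exp2l ?prime_gt1.
  rewrite expn1; lia.
apply: (@leq_trans (\prod_(p <- iota 0 ('C(n.*2, n)).+1 | prime p && (p <= n.*2)) n.*2)).
  elim/big_ind2: _ => // [a b c d h1 h2|p /andP[pp _]]; first exact: leq_mul.
  exact: expn_logn_bin.
rewrite big_const_seq iter_muln_1 leq_exp2l; last by lia.
rewrite -!size_filter; apply: uniq_leq_size; first by rewrite filter_uniq ?iota_uniq.
move=> p; rewrite !mem_filter !mem_iota => /andP[/andP[-> h] _] /=.
by rewrite add0n ltnS.
Qed.

(** Chebyshev's bound gives at least 2^m / (2m) primes up to 2^m. At most 2^m / (4m) of them are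
    below 2^m / (4m), so at least half of the guaranteed number lies in the window. *)
Lemma primes_window m : 1 < m -> exists Q : seq nat,
  [/\ uniq Q, {in Q, forall q, [/\ prime q, 2 ^ m <= 4 * m * q & q <= 2 ^ m]} &
      2 ^ m <= 4 * m * size Q].
Proof.
move=> m1; pose N := 2 ^ m.
exists [seq p <- iota 0 N.+1 | prime p && (N <= 4 * m * p)]; split.
- by rewrite filter_uniq ?iota_uniq.
- by move=> q; rewrite mem_filter mem_iota => /andP[/andP[-> ->] /andP[_]].
have h2 : 2 ^ m = (2 ^ m.-1).*2 by rewrite -mul2n -expnS prednK //; lia.
have := @leq_expn_count_primes (2 ^ m.-1) ltac:(by rewrite expn_gt0).
rewrite -h2 -expnM leq_exp2l // -/N => H.
set c := count prime _ in H.
have : c <= size [seq p <- iota 0 N.+1 | prime p && (N <= 4 * m * p)] +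
        size [seq p <- iota 0 N.+1 | prime p && (4 * m * p < N)].
  rewrite !size_filter /c; elim: (iota 0 N.+1) => //= x s.
  by case: prime; case: leqP => /=; lia.
set a := size _; set b := size _ => hc.
have hb : 4 * m * b <= N.
  have hN := divn_eq N (4 * m).
  have hb' : b <= N %/ (4 * m).
    rewrite /b -[X in _ <= X](size_iota 1); apply: uniq_leq_size.
      by rewrite filter_uniq ?iota_uniq.
    move=> p; rewrite mem_filter mem_iota => /andP[/andP[/prime_gt0 p0 hp] _].
    rewrite mem_iota p0 /= add1n ltnS leq_divRL; last by lia.
    by rewrite mulnC; apply: ltnW.
  nia.
rewrite -/N.
have : N.*2 <= 4 * m * c by rewrite /N {1}h2; nia.
nia.
Qed.

(** The product of the distinct primes of Q dividing l divides l, and each factor is at least 2. *)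
Lemma leq_exp2_size_primes_dvd (Q : seq nat) l : uniq Q -> {in Q, forall q, prime q} ->
  0 < l -> 2 ^ count (fun q => q %| l) Q <= l.
Proof.
move=> uQ pQ l0.
suff H : forall s : seq nat, uniq s -> {in s, forall q, prime q /\ q %| l} ->
   \prod_(q <- s) q %| l.
  rewrite -size_filter.
  have := H [seq q <- Q | q %| l] (filter_uniq _ uQ).
  set s := [seq q <- Q | q %| l] => Hs.
  have ps : {in s, forall q, prime q /\ q %| l}.
    by move=> q; rewrite mem_filter => /andP[h /pQ].
  apply: leq_trans (dvdn_leq l0 (Hs ps)).
  elim: s ps {Hs} => [|q s IH] ps; first by rewrite big_nil.
  rewrite big_cons expnS; apply: leq_mul.
    by apply: prime_gt1; case: (ps q (mem_head _ _)).
  by apply: IH => x xs; apply: ps; rewrite inE xs orbT.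
elim => [|q s IH] /=; first by rewrite big_nil dvd1n.
move=> /andP[qs us] ps; rewrite big_cons Gauss_dvd.
  case: (ps q (mem_head _ _)) => _ -> /=.
  by apply: IH => // x xs; apply: ps; rewrite inE xs orbT.
have ps' : {in s, forall x, prime x}.
  by move=> x xs; case: (ps x) => //; rewrite inE xs orbT.
have [pq _] := ps q (mem_head _ _).
elim: s qs ps' {IH us ps} => [|x s IH] qs ps; first by rewrite big_nil coprimen1.
move: qs; rewrite inE negb_or => /andP[qx qs].
rewrite big_cons coprimeMr IH // ?andbT.
  by rewrite prime_coprime // dvdn_prime2 //; apply: ps; rewrite mem_head.
by move=> y ys; apply: ps; rewrite inE ys orbT.
Qed.

End Primes.

(** * Gauges of polynomial decay *)

Section Gauge.
Context {R : realType}.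
Implicit Types x y t a : R.

(** The Japanese bracket, in a form equivalent to the square root of 1 + t^2. *)
Definition jap t : R := 1 + `|t|.

Lemma jap_ge1 t : 1 <= jap t.
Proof. by rewrite lerDl. Qed.

Lemma jap_gt0 t : 0 < jap t.
Proof. by apply: lt_le_trans (jap_ge1 t). Qed.

Lemma japN t : jap (- t) = jap t.
Proof. by rewrite /jap normrN. Qed.

(** Peetre's inequality: it allows a weight to be moved from one point to another at the cost of a
    weight of their difference. *)
Lemma jap_peetre x y : jap x <= jap y * jap (x - y).
Proof.
rewrite /jap; have := ler_normD y (x - y); rewrite [y + _]addrC subrK.
have := mulr_ge0 (normr_ge0 y) (normr_ge0 (x - y)); nra.
Qed.

Lemma powRD_gt0 x r s : 0 < x -> x `^ (r + s) = x `^ r * x `^ s.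
Proof. by move=> x0; rewrite powRD // lt0r_neq0 // implybT. Qed.

Lemma ln_le_powR a x : 0 < a -> 1 <= x -> ln x <= x `^ a / a.
Proof.
move=> a0 x1; have x0 : 0 < x by lra.
rewrite ler_pdivlMr // mulrC -ln_powR.
have := @le_ln1Dx R (x `^ a - 1); rewrite [1 + _]addrC subrK => h.
by apply: le_trans (h _) _; have := powR_gt0 a x0; lra.
Qed.

Definition lam t : R := 1 + ln (jap t).

Lemma lam_ge1 t : 1 <= lam t.
Proof. by rewrite lerDl ln_ge0 // jap_ge1. Qed.

Lemma lam_gt0 t : 0 < lam t.
Proof. by apply: lt_le_trans (lam_ge1 t). Qed.

Lemma lamN t : lam (- t) = lam t.
Proof. by rewrite /lam japN. Qed.

Lemma lam_peetre x y : lam x <= lam y * lam (x - y).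
Proof.
have h : ln (jap x) <= ln (jap y) + ln (jap (x - y)).
  rewrite -lnM ?posrE ?jap_gt0 // ler_ln ?posrE ?mulr_gt0 ?jap_gt0 //.
  exact: jap_peetre.
rewrite /lam; have := ln_ge0 (jap_ge1 y); have := ln_ge0 (jap_ge1 (x - y)); nra.
Qed.

Lemma lam_le_powR a t : 0 < a -> lam t <= (1 + a^-1) * jap t `^ a.
Proof.
move=> a0; rewrite mulrDl mul1r; apply: lerD.
  by rewrite -(powRr0 (jap t)) ler_powR ?jap_ge1 // ltW.
by rewrite mulrC; apply: ln_le_powR => //; exact: jap_ge1.
Qed.

(** The three logarithms are spent in [sum_wcoef_gauge_le]: one pays for the number of prime
    divisors of a frequency, the other two are exchanged for a factor m^-2, where 2^m bounds the
    primes. *)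
Definition gauge (tau : R) t : R := jap t `^ (- tau) * lam t ^+ 3.

Lemma gauge_gt0 tau t : 0 < gauge tau t.
Proof. by rewrite mulr_gt0 ?powR_gt0 ?jap_gt0 ?exprn_gt0 ?lam_gt0. Qed.

Lemma gaugeN tau t : gauge tau (- t) = gauge tau t.
Proof. by rewrite /gauge japN lamN. Qed.

Lemma jap_powRN_le_gauge tau t : jap t `^ (- tau) <= gauge tau t.
Proof. by rewrite ler_peMr ?powR_ge0 // exprn_ege1 // lam_ge1. Qed.

Lemma lam3_le_powR a : 0 < a -> exists2 C : R, 0 < C &
  forall t, lam t ^+ 3 <= C * jap t `^ a.
Proof.
move=> a0; exists ((1 + (a / 3)^-1) ^+ 3).
  by rewrite exprn_gt0 // addr_gt0 // invr_gt0; lra.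
move=> t; have -> : jap t `^ a = (jap t `^ (a / 3)) ^+ 3.
  by rewrite -powR_mulrn ?powR_ge0 // -powRrM; congr (_ `^ _); lra.
rewrite -exprMn; apply: lerXn2r; rewrite ?nnegrE.
- exact: ltW (lam_gt0 t).
- by rewrite mulr_ge0 ?powR_ge0 // addr_ge0 // invr_ge0; lra.
- by apply: lam_le_powR; lra.
Qed.

Lemma gauge_le_powR tau eps : 0 < eps -> exists2 C : R, 0 < C &
  forall t, gauge tau t <= C * jap t `^ (- tau + eps).
Proof.
move=> e0; have [C C0 h] := lam3_le_powR e0; exists C => // t.
rewrite powRD_gt0 ?jap_gt0 // mulrCA /gauge.
by apply: ler_wpM2l => //; exact: powR_ge0.
Qed.

(** Moving the power costs [jap] to the tau, and moving the logarithms costs any small power, taken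
    here as 1/2 - tau. The total is a square root, small enough to leave a summable function once
    multiplied by a quadratic decay. *)
Lemma gauge_peetre tau : 0 < tau -> tau < 1 / 2 -> exists2 C : R, 0 < C &
  forall x y, gauge tau x <= C * gauge tau y * Num.sqrt (jap (x - y)).
Proof.
move=> t0 t1; have [C C0 h] := @lam3_le_powR (1/2 - tau) ltac:(lra).
exists C => // x y.
have e1 : jap x `^ (- tau) <= jap y `^ (- tau) * jap (x - y) `^ tau.
  rewrite !powRN -ler_pdivrMl ?invr_gt0 ?powR_gt0 ?jap_gt0 // invrK.
  rewrite ler_pdivrMr ?powR_gt0 ?jap_gt0 // -powRM ?(ltW (jap_gt0 _)) //.
  apply: ge0_ler_powR; rewrite ?nnegrE ?mulr_ge0 ?(ltW (jap_gt0 _)) ?(ltW t0) //.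
  rewrite mulrC -(japN (x - y)) opprB; exact: jap_peetre.
have e2 : lam x ^+ 3 <= lam y ^+ 3 * (C * jap (x - y) `^ (1 / 2 - tau)).
  apply: (@le_trans _ _ ((lam y * lam (x - y)) ^+ 3)).
    apply: lerXn2r; rewrite ?nnegrE ?mulr_ge0 ?(ltW (lam_gt0 _)) //.
    exact: lam_peetre.
  by rewrite exprMn ler_wpM2l // exprn_ge0 // ltW ?lam_gt0.
rewrite -powR12_sqrt ?(ltW (jap_gt0 _)) //.
have -> : jap (x - y) `^ 2^-1 = jap (x - y) `^ tau * jap (x - y) `^ (1 / 2 - tau).
  by rewrite -powRD_gt0 ?jap_gt0 //; congr powR; lra.
have := ler_pM (powR_ge0 _ _) (exprn_ge0 3 (ltW (lam_gt0 x))) e1 e2.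
rewrite -/(gauge tau x) => /le_trans; apply.
by rewrite le_eqVlt; apply/orP; left; apply/eqP; rewrite /gauge; ring.
Qed.

(** The power -3/2 of [jap]: what is left of a quadratic decay after the square root lost in
    [gauge_peetre], and still summable over the integers. *)
Definition decay t : R := (Num.sqrt (jap t))^-1 ^+ 3.

Lemma decayN t : decay (- t) = decay t.
Proof. by rewrite /decay japN. Qed.

Lemma sqrt_jap_ge1 t : 1 <= Num.sqrt (jap t).
Proof. by rewrite -[leLHS]sqrtr1 ler_wsqrtr ?jap_ge1. Qed.

Lemma decay_ge0 t : 0 <= decay t.
Proof. by rewrite exprn_ge0 // invr_ge0 sqrtr_ge0. Qed.

Lemma sqrt_jap_sqr t : Num.sqrt (jap t) ^+ 2 = jap t.
Proof. by rewrite sqr_sqrtr // ltW ?jap_gt0. Qed.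

Lemma jap_inv2_decay t : Num.sqrt (jap t) * (jap t)^-1 ^+ 2 = decay t.
Proof.
rewrite /decay -{2}(sqrt_jap_sqr t).
have h : Num.sqrt (jap t) != 0 by have := sqrt_jap_ge1 t; lra.
by field.
Qed.

Lemma jap_inv2_le_decay t : (jap t)^-1 ^+ 2 <= decay t.
Proof.
rewrite -jap_inv2_decay ler_peMl ?sqrt_jap_ge1 // exprn_ge0 // invr_ge0.
by rewrite ltW ?jap_gt0.
Qed.

(* Bounded and increasing; its increments dominate [decay], so that sums of
   [decay] over unit-spaced points telescope. *)
Let step t : R := if 0 <= t then 1 - (Num.sqrt (jap t))^-1
                  else (Num.sqrt (jap t))^-1 - 1.

Let step_bound t : - 1 <= step t <= 1.
Proof.
have h := sqrt_jap_ge1 t; have := @invr_ge0 R (Num.sqrt (jap t)).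
have : (Num.sqrt (jap t))^-1 <= 1 by rewrite invf_le1; lra.
rewrite /step sqrtr_ge0; case: ifP; lra.
Qed.

Let decay_le_step t : decay t <= 8 * (step (t + 1) - step t).
Proof.
(* For consecutive points on one side of 0 the square roots satisfy b^2 = a^2 + 1, and 1/a - 1/b is
   of order a^-3. *)
have key a b : 1 <= a -> 1 <= b -> b ^+ 2 = a ^+ 2 + 1 ->
    a^-1 ^+ 3 <= 8 * (a^-1 - b^-1).
  move=> a1 b1 ab.
  rewrite -subr_ge0.
  have -> : 8 * (a^-1 - b^-1) - a^-1 ^+ 3 =
     (8 * a ^+ 2 * (b - a) - b) / (a ^+ 3 * b) by field; lra.
  apply: divr_ge0; last by rewrite mulr_ge0 ?exprn_ge0; lra.
  have : (b - a) * (b + a) = 1 by nra.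
  have : b <= 2 * a by nra.
  have : b > a by nra.
  nra.
have h1 := sqrt_jap_ge1 t; have h2 := sqrt_jap_ge1 (t + 1).
have s1 := sqrt_jap_sqr t; have s2 := sqrt_jap_sqr (t + 1).
have [t0|t0] := leP 0 t.
  have e1 : jap t = 1 + t by rewrite /jap ger0_norm.
  have e2 : jap (t + 1) = 1 + (t + 1) by rewrite /jap ger0_norm; lra.
  rewrite /step t0 addr_ge0 //.
  have := key _ _ h1 h2; rewrite s1 s2 /decay; lra.
have e1 : jap t = 1 - t by rewrite /jap ltr0_norm.
rewrite /step (lt_geF t0).
have [t1|t1] := leP 0 (t + 1).
  have e2 : jap (t + 1) = 1 + (t + 1) by rewrite /jap ger0_norm.
  rewrite /decay; set p := Num.sqrt (jap t) in h1 s1 *.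
  set q := Num.sqrt (jap (t + 1)) in h2 s2 *.
  have ip : p^-1 <= 1 by rewrite invf_le1; lra.
  have iq : q^-1 <= 1 by rewrite invf_le1; lra.
  have ip0 : 0 <= p^-1 by rewrite invr_ge0; lra.
  have : p^-1 ^+ 3 <= 1 by apply: exprn_ile1.
  (* The unit interval straddles 0, so p^2 + q^2 = 3 and p, q cannot both be below 6/5; the
     increment of [step] is then at least 1/6. *)
  suff : p^-1 <= 5 / 6 \/ q^-1 <= 5 / 6 by move=> []; lra.
  have [hp|hp] := leP (6 / 5) p.
    left; rewrite -[5 / 6]invrK lef_pV2 ?posrE; lra.
  right; rewrite -[5 / 6]invrK lef_pV2 ?posrE; nra.
have e2 : jap (t + 1) = 1 - (t + 1) by rewrite /jap ltr0_norm // lra.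
have := key _ _ h2 h1; rewrite s1 s2 => /(_ ltac:(lra)).
have : decay t <= (Num.sqrt (jap (t + 1)))^-1 ^+ 3.
  apply: lerXn2r; rewrite ?nnegrE ?invr_ge0 ?sqrtr_ge0 //.
  by rewrite lef_pV2 ?posrE; [apply: ler_wsqrtr; lra|lra|lra].
lra.
Qed.

Lemma sum_decay_le N x : \sum_(i < N) decay (x - i%:R) <= 16.
Proof.
apply: (@le_trans _ _ (8 * (step (N%:R - x) - step (- x)))); last first.
  have := step_bound (N%:R - x); have := step_bound (- x); lra.
elim: N => [|N IH]; first by rewrite big_ord0 add0r subrr mulr0.
rewrite big_ord_recr /=; have := decay_le_step (N%:R - x).
have -> : N%:R - x + 1 = N.+1%:R - x by rewrite -natr1; ring.
by rewrite -(decayN (x - _)) opprB; lra.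
Qed.

End Gauge.

(** * Cosines and the Fejer kernel *)

Section Cosine.
Context {R : realType}.
Implicit Types x y z t u : R.

Definition cs t : R := cos (2 * pi * t).

Lemma cs0 : cs 0 = 1.
Proof. by rewrite /cs mulr0 cos0. Qed.

Lemma csN t : cs (- t) = cs t.
Proof. by rewrite /cs mulrN cosN. Qed.

Lemma norm_cs t : `|cs t| <= 1.
Proof. exact: cos_max. Qed.

Lemma csM x y : 2 * (cs x * cs y) = cs (x + y) + cs (x - y).
Proof. rewrite /cs (_ : 2 * pi * (x + y) = 2 * pi * x + 2 * pi * y); last by ring.
rewrite (_ : 2 * pi * (x - y) = 2 * pi * x - 2 * pi * y); last by ring.
by rewrite cosD cosB; ring. Qed.

Lemma csDn t (n : nat) : cs (t + n%:R) = cs t.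
Proof.
rewrite /cs -(periodicn (@cosD2pi R) n (2 * pi * t)); congr cos.
by rewrite -[pi *+ 2 *+ n]mulr_natr -[pi *+ 2]mulr_natr; ring.
Qed.

Lemma csDz t (n : int) : cs (t + n%:~R) = cs t.
Proof.
case: n => n; first exact: csDn.
by rewrite NegzE mulrNz -(csDn _ n.+1) -addrA addNr addr0.
Qed.

Lemma lipschitz_cos x y : `|cos x - cos y| <= `|x - y|.
Proof.
wlog : x y / x <= y.
  by move=> h; case/orP: (le_total x y) => /h //; rewrite distrC (distrC x).
move=> xy; have [c _ h] := @MVT_segment R cos (fun z => - sin z) x y xy
  (fun z _ => is_derive_cos z) (continuous_subspaceT (@continuous_cos R)).
rewrite distrC h normrM (distrC x) normrN ler_piMl //; exact: sin_max.
Qed.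

Lemma lipschitz_cs x y : `|cs x - cs y| <= 8 * `|x - y|.
Proof.
apply: le_trans (lipschitz_cos _ _) _.
rewrite -mulrBr normrM ler_wpM2r // ger0_norm ?mulr_ge0 ?pi_ge0 //.
by have := @pihalf_lt2 R; lra.
Qed.

(** A weak Jordan inequality. The mean value theorem gives sin z >= z cos z, which suffices when cos
    z >= 1/2; otherwise sin z exceeds 1/2 while z/4 does not. *)
Lemma quarter_le_sin z : 0 <= z <= pi / 2 -> z / 4 <= sin z.
Proof.
move=> /andP[z0 z1]; have p2 := @pihalf_lt2 R; have p0 := @pi_gt0 R.
have [c /[!in_itv]/= /andP[c0 cz] h] := @MVT_segment R sin cos 0 z z0
  (fun z _ => is_derive_sin z) (continuous_subspaceT (@continuous_sin R)).
have cc : cos z <= cos c.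
  have [->|cz'] := eqVneq c z; first by [].
  have : c < z by rewrite lt_neqAle cz' cz.
  move=> ?; apply: ltW; rewrite ltr_cos // in_itv /=; lra.
have sz0 : 0 <= sin z by apply: sin_ge0_pi; lra.
have cz0 : 0 <= cos z by apply: cos_ge0_pihalf; lra.
have := cos2Dsin2 z; move: h; rewrite sin0 !subr0 => h sc.
have [hc|hc] := leP (1 / 2) (cos z); first by nra.
by nra.
Qed.

Lemma sqr_le_1Bcs u : `|u| <= 1 / 2 -> u ^+ 2 <= 2 - 2 * cs u.
Proof.
move=> hu; have e : cs u = 1 - 2 * sin (pi * `|u|) ^+ 2.
  rewrite /cs -cos_norm normrM ger0_norm ?mulr_ge0 ?pi_ge0 //.
  have -> : 2 * pi * `|u| = (pi * `|u|) *+ 2 by ring.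
  by rewrite cos_mulr2n cos2sin2; ring.
have p2 := @pi_ge2 R; have n0 := normr_ge0 u.
have := @quarter_le_sin (pi * `|u|) ltac:(nra).
rewrite e -real_normK ?num_real // => h.
have h2 : `|u| / 2 <= sin (pi * `|u|) by nra.
by nra.
Qed.

Definition dirichlet n t : R := 1 + 2 * \sum_(i < n) cs (i.+1%:R * t).

(* Unnormalised: [n] times the Fejer kernel. *)
Definition fejer n t : R := \sum_(j < n) dirichlet j t.

Lemma dirichletS n t : dirichlet n.+1 t = dirichlet n t + 2 * cs (n.+1%:R * t).
Proof. by rewrite /dirichlet big_ord_recr /= mulrDr addrA. Qed.

Lemma dirichletE n t : dirichlet n t * (2 - 2 * cs t) =
  2 * cs (n%:R * t) - 2 * cs (n.+1%:R * t).
Proof.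
elim: n => [|n IH]; first by rewrite /dirichlet big_ord0 !mul0r cs0 mul1r; ring.
rewrite dirichletS mulrDl IH.
have := csM (n.+1%:R * t) t.
have -> : n.+1%:R * t + t = n.+2%:R * t by rewrite -[in RHS]natr1; ring.
have -> : n.+1%:R * t - t = n%:R * t by rewrite -[in LHS]natr1; ring.
lra.
Qed.

Lemma fejerS n t : fejer n.+1 t = fejer n t + dirichlet n t.
Proof. by rewrite /fejer big_ord_recr. Qed.

Lemma fejerE n t : fejer n t * (2 - 2 * cs t) = 2 - 2 * cs (n%:R * t).
Proof.
elim: n => [|n IH]; first by rewrite /fejer big_ord0 !mul0r cs0; ring.
by rewrite fejerS mulrDl IH dirichletE; ring.
Qed.

Lemma norm_dirichlet n t : `|dirichlet n t| <= n%:R * 2 + 1.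
Proof.
elim: n => [|n IH]; first by rewrite /dirichlet big_ord0 mulr0 addr0 normr1 mul0r add0r.
rewrite dirichletS -natr1; apply: le_trans (ler_normD _ _) _.
by have := norm_cs (n.+1%:R * t); rewrite normrM ger0_norm //; lra.
Qed.

Lemma norm_fejer n t : `|fejer n t| <= n%:R ^+ 2.
Proof.
elim: n => [|n IH]; first by rewrite /fejer big_ord0 normr0 expr0n.
rewrite fejerS; apply: le_trans (ler_normD _ _) _.
have := norm_dirichlet n t; rewrite -[n.+1%:R]natr1; nra.
Qed.

Lemma dirichlet_cs1 n t : cs t = 1 -> dirichlet n t = n%:R * 2 + 1.
Proof.
move=> h; have hc m : cs (m%:R * t) = 1.
  elim: m => [|m IH]; first by rewrite mul0r cs0.
  by have := dirichletE m t; rewrite h IH; lra.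
elim: n => [|n IH]; first by rewrite /dirichlet big_ord0 mulr0 addr0 mul0r add0r.
by rewrite dirichletS IH hc -natr1; ring.
Qed.

(** [fejerE] determines the sign only where 2 - 2 cs t is nonzero; at the remaining points every
    Dirichlet kernel is positive. *)
Lemma fejer_ge0 n t : 0 <= fejer n t.
Proof.
have [h|h] := eqVneq (cs t) 1.
  by apply: sumr_ge0 => i _; rewrite dirichlet_cs1 // addr_ge0 // mulr_ge0.
have h1 : cs t < 1 by rewrite lt_neqAle h cos_le1.
have := fejerE n t; have : cs (n%:R * t) <= 1 by exact: cos_le1.
move=> h2 e; have : 0 <= fejer n t * (2 - 2 * cs t) by lra.
by rewrite pmulr_lge0 //; lra.
Qed.

Lemma fejer0 n : fejer n 0 = n%:R ^+ 2.
Proof.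
elim: n => [|n IH]; first by rewrite /fejer big_ord0 expr0n.
by rewrite fejerS IH dirichlet_cs1 ?cs0 // -natr1; ring.
Qed.

(* [l - i.+1] is truncated, so the coefficients vanish for [i >= l]. *)
Lemma fejer_coef l T t : (l <= T.+1)%N ->
  fejer l t = l%:R + 2 * \sum_(i < T) (l - i.+1)%:R * cs (i.+1%:R * t).
Proof.
elim: l => [|l IH] lT.
  rewrite /fejer big_ord0 big1 ?mulr0 ?addr0 // => i _.
  by rewrite sub0n mul0r.
rewrite fejerS IH 1?ltnW // /dirichlet.
have -> : \sum_(i < T) (l.+1 - i.+1)%:R * cs (i.+1%:R * t) =
   \sum_(i < T) (l - i.+1)%:R * cs (i.+1%:R * t) + \sum_(i < l) cs (i.+1%:R * t).
  rewrite (big_ord_widen T (fun i => cs (i.+1%:R * t))) // [X in _ + X]big_mkcond /=.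
  rewrite -big_split /=; apply: eq_bigr => i _.
  case: ltnP => h; last by rewrite addr0; congr (_%:R * _); lia.
  by rewrite -[X in _ + X]mul1r -mulrDl natr1; congr (_%:R * _); lia.
by rewrite -natr1; ring.
Qed.

(** A geometric sum in real form: multiplication by sin (pi u) makes it telescope, and the two ends
    agree because they differ by n full periods. The bounds on n keep this factor nonzero. *)
Lemma sum_cs_equidistributed (L n : nat) x : (0 < n < L)%N ->
  \sum_(j < L) cs (n%:R * (x - j%:R / L%:R)) = 0.
Proof.
move=> /andP[n0 nL]; have L0 : (L%:R : R) != 0 by rewrite pnatr_eq0; lia.
pose u : R := n%:R / L%:R.
pose F (j : nat) : R := sin (2 * pi * (n%:R * x + u / 2 - j%:R * u)).
have hs : sin (pi * u) != 0.
  rewrite gt_eqF // sin_gt0_pi // mulr_gt0 ?pi_gt0 ?divr_gt0 ?ltr0n //=; last by lia.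
  by rewrite gtr_pMr ?pi_gt0 // ltr_pdivrMr ?ltr0n ?mul1r ?ltr_nat //; lia.
apply: (mulfI hs); rewrite mulr0 mulr_sumr.
have H m : \sum_(j < m) sin (pi * u) * cs (n%:R * (x - j%:R / L%:R)) = (F 0%N - F m) / 2.
  elim: m => [|m IH]; first by rewrite big_ord0 subrr mul0r.
  rewrite big_ord_recr /= IH.
  suff : 2 * (sin (pi * u) * cs (n%:R * (x - m%:R / L%:R))) = F m - F m.+1 by lra.
  rewrite /F /cs.
  have -> : 2 * pi * (n%:R * x + u / 2 - m%:R * u) =
     2 * pi * (n%:R * (x - m%:R / L%:R)) + pi * u by rewrite /u; field.
  have -> : 2 * pi * (n%:R * x + u / 2 - m.+1%:R * u) =
     2 * pi * (n%:R * (x - m%:R / L%:R)) - pi * u by rewrite /u -natr1; field.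
  by rewrite sinD sinB; ring.
rewrite H; apply/eqP; rewrite mulf_eq0 subr_eq0; apply/orP; left; apply/eqP.
rewrite /F mul0r subr0 -(periodicn (@sinD2pi R) n (2 * pi * (_ - _))); congr sin.
by rewrite -mulr_natr /u; field.
Qed.

End Cosine.

(** * Periodic triangle waves *)

Section TriangleWave.
Context {R : realType}.
Implicit Types x y z t u : R.

Definition distZ x : R := `|x - (Num.floor (x + 1 / 2))%:~R|.

Lemma distZ_ge0 x : 0 <= distZ x.
Proof. exact: normr_ge0. Qed.

Lemma distZ_half x : distZ x <= 1 / 2.
Proof.
have /andP[h1] := real_floor_itv (num_real (x + 1 / 2)).
rewrite intrD /distZ ler_norml => h2; lra.
Qed.

Lemma distZ_le x (n : int) : distZ x <= `|x - n%:~R|.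
Proof.
have h := distZ_half x; rewrite /distZ in h *; set m := Num.floor _ in h *.
have [->//|mn] := eqVneq m n.
have : (1 : R) <= `|m%:~R - n%:~R|.
  by rewrite -intrB -intr_norm -[1]/(1%:~R) ler_int; lia.
have := ler_normD (m%:~R - x) (x - n%:~R); rewrite addrA subrK (distrC _ x); lra.
Qed.

Lemma distZ_ex x : exists n : int, distZ x = `|x - n%:~R|.
Proof. by eexists. Qed.

Lemma distZ_triangle x y : `|distZ x - distZ y| <= distZ (x - y).
Proof.
have H a b : distZ a <= distZ b + distZ (a - b).
  have [n ->] := distZ_ex b; have [m ->] := distZ_ex (a - b).
  apply: le_trans (distZ_le a (n + m)) _; rewrite intrD.
  apply: le_trans (ler_normD _ _); rewrite le_eqVlt; apply/orP; left.
  by apply/eqP; congr (`|_|); ring.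
have HN a : distZ (- a) <= distZ a.
  have [n ->] := distZ_ex a; apply: le_trans (distZ_le _ (- n)) _.
  by rewrite mulrNz -opprD normrN.
rewrite ler_norml; have := H x y; have := H y x; have := HN (x - y).
rewrite opprB; lra.
Qed.

Lemma sqr_distZ_le x : distZ x ^+ 2 <= 2 - 2 * cs x.
Proof.
have h := distZ_half x.
rewrite /distZ in h *; set n := Num.floor _ in h *.
rewrite real_normK ?num_real // -(csDz x (- n)) mulrNz.
exact: sqr_le_1Bcs.
Qed.

Variable k : nat.
Hypothesis k2 : (2 <= k)%N.

Let k2R : (2 : R) <= k%:R.
Proof. by rewrite ler_nat. Qed.

(* 1-periodic, of mean 1, supported within 1/k of the integers. *)
Definition wave x : R := k%:R * Num.max 0 (1 - k%:R * distZ x).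

Lemma wave_ge0 x : 0 <= wave x.
Proof. by rewrite mulr_ge0 // le_max lexx. Qed.

Lemma wave_le x : wave x <= k%:R.
Proof.
rewrite -[leRHS]mulr1 ler_wpM2l // ge_max ler01 /=.
by have := distZ_ge0 x; have := k2R; nra.
Qed.

Lemma wave_supp x : wave x != 0 -> k%:R * distZ x < 1.
Proof.
apply: contraNT; rewrite -leNgt => h.
by rewrite /wave max_l ?mulr0 //; lra.
Qed.

Lemma wave_lip_distZ x y : `|wave x - wave y| <= k%:R ^+ 2 * distZ (x - y).
Proof.
have h := distZ_triangle x y.
rewrite -mulrBr normrM ger0_norm // expr2 -mulrA ler_wpM2l //.
apply: (@le_trans _ _ (`|k%:R * distZ x - k%:R * distZ y|)).
  set a := k%:R * distZ x; set b := k%:R * distZ y.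
  move: (ler_norm (a - b)) (ler_norm (b - a)); rewrite (distrC b).
  by rewrite ler_norml /Num.max; case: (ltrP 0 (1 - a)); case: (ltrP 0 (1 - b)); lra.
by rewrite -mulrBr normrM ger0_norm // ler_wpM2l.
Qed.

Lemma wave_lip x y : `|wave x - wave y| <= k%:R ^+ 2 * `|x - y|.
Proof.
apply: le_trans (wave_lip_distZ _ _) _; rewrite ler_wpM2l ?exprn_ge0 //.
by rewrite -[X in `|X|](subr0 (x - y)); exact: (distZ_le _ 0).
Qed.

(** * Trigonometric approximation of the wave from equidistant samples *)

Section Sampling.
Variable l : nat.
Hypothesis l0 : (0 < l)%N.
(** With this number of sample points the half-width 1/k of a tooth is exactly 2l steps, so the
    sampled triangle has the heights 2l - j of Fejer coefficients. The parameter l controls the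
    accuracy. *)
Let L := (2 * k * l)%N.
Let N := (k * l)%N.

Let L0 : (L%:R : R) != 0. Proof. by rewrite pnatr_eq0 /L; lia. Qed.
Let N0 : (N%:R : R) != 0. Proof. by rewrite pnatr_eq0 /N; lia. Qed.
Let kR0 : (k%:R : R) != 0. Proof. by rewrite pnatr_eq0; lia. Qed.
Let lR0 : (l%:R : R) != 0. Proof. by rewrite pnatr_eq0; lia. Qed.
Let LE : L%:R = 2 * k%:R * l%:R :> R. Proof. by rewrite /L !natrM. Qed.
Let NE : N%:R = k%:R * l%:R :> R. Proof. by rewrite /N !natrM. Qed.

(* Both subtractions are truncated. *)
Let wave_sample (j : nat) : (j < L)%N ->
  wave (j%:R / L%:R) = (2 * l%:R)^-1 * k%:R * ((2 * l - j)%:R + (2 * l - (L - j))%:R).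
Proof.
move=> jL.
have Lp : (0 : R) < L%:R by rewrite ltr0n; lia.
have lp : (0 : R) < l%:R by rewrite ltr0n; lia.
have hd : distZ (j%:R / L%:R) = (minn j (L - j))%:R / L%:R.
  apply/eqP; rewrite eq_le; apply/andP; split.
    rewrite /minn; case: ltnP => h.
      by apply: le_trans (distZ_le _ 0) _; rewrite subr0 ger0_norm // divr_ge0.
    apply: le_trans (distZ_le _ 1) _.
    rewrite distrC ger0_norm.
      by rewrite natrB 1?ltnW // mulrBl divff.
    by rewrite subr_ge0 ler_pdivrMr // mul1r ler_nat ltnW.
  have [n ->] := distZ_ex (j%:R / L%:R).
  have [n0|n0] : (n <= 0) \/ (1 <= n) by lia.
    rewrite ger0_norm; last first.
      rewrite subr_ge0 (@le_trans _ _ 0) ?divr_ge0 //.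
      by rewrite -[0]/(0%:~R) ler_int.
    apply: (@le_trans _ _ (j%:R / L%:R)).
      by rewrite ler_wpM2r ?invr_ge0 // ler_nat geq_minl.
    have : (n%:~R : R) <= 0 by rewrite -[0]/(0%:~R) ler_int.
    by lra.
  have n1 : (1 : R) <= n%:~R by rewrite -[1]/(1%:~R) ler_int.
  have jL1 : (j%:R / L%:R : R) <= 1.
    by rewrite ler_pdivrMr // mul1r ler_nat ltnW.
  rewrite distrC ger0_norm; last by lra.
  apply: (@le_trans _ _ (1 - j%:R / L%:R)); last by lra.
  rewrite -[X in X - _](divff L0) -mulrBl -natrB 1?ltnW //.
  by rewrite ler_wpM2r ?invr_ge0 // ler_nat geq_minr.
rewrite /wave hd [_^-1 * k%:R]mulrC -[RHS]mulrA; congr (_ * _).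
have -> : k%:R * ((minn j (L - j))%:R / L%:R) = (minn j (L - j))%:R / (2 * l%:R) :> R.
  by rewrite LE; field; rewrite lR0 kR0.
have [h1|h1] := leqP (2 * l) (minn j (L - j)).
  rewrite max_l; last first.
    rewrite subr_le0 ler_pdivlMr ?mulr_gt0 // mul1r -(natrM _ 2%N) ler_nat //.
  rewrite (_ : (2 * l - j)%N = 0%N); last by lia.
  by rewrite (_ : (2 * l - (L - j))%N = 0%N) ?addr0 ?mulr0 //; lia.
rewrite max_r; last first.
  by rewrite subr_ge0 ler_pdivrMr ?mulr_gt0 // mul1r -(natrM _ 2%N) ler_nat ltnW.
rewrite -natrD (_ : (_ + _)%N = (2 * l - minn j (L - j))%N); last first.
  have h4 : (4 * l <= L)%N by rewrite /L; nia.
  by move: h1 jL h4; generalize L => M; lia.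
by rewrite natrB 1?ltnW // natrM; field.
Qed.

Definition wave_coef (n : nat) : R :=
  L%:R^-1 * \sum_(j < L) wave (j%:R / L%:R) * cs (n%:R * (j%:R / L%:R)).

(** The two slopes of the sampled triangle add up to the coefficient formula [fejer_coef], so a
    discrete Fourier coefficient is a value of a Fejer kernel; its sign and size follow without any
    integral. *)
Let wave_coefE n : wave_coef n =
  (4 * l%:R ^+ 2)^-1 * fejer (2 * l) (n%:R / L%:R).
Proof.
rewrite /wave_coef.
under eq_bigr => j _ do rewrite wave_sample // mulrDr mulrDl.
rewrite big_split /=.
have LS : L = (L.-1).+1 by rewrite prednK // /L; lia.
rewrite (fejer_coef (T := L)); last by rewrite /L; nia.
set S := \sum_(i < L) (2 * l - i.+1)%:R * _.
have -> : \sum_(i < L) (2 * l%:R)^-1 * k%:R * (2 * l - i)%:R *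
    cs (n%:R * (i%:R / L%:R)) = (2 * l%:R)^-1 * k%:R * ((2 * l)%:R + S).
  under eq_bigr => i _ do rewrite -mulrA.
  rewrite -mulr_sumr; congr (_ * _); rewrite /S LS big_ord_recl big_ord_recr /=.
  rewrite -LS mul0r mulr0 cs0 mulr1 subn0; congr (_ + _).
  rewrite (_ : (2 * l - L)%N = 0%N) ?mul0r ?addr0; last by rewrite /L; nia.
  by apply: eq_bigr => i _; rewrite /bump /= add1n; congr (_ * cs _); field.
have -> : \sum_(i < L) (2 * l%:R)^-1 * k%:R * (2 * l - (L - i))%:R *
    cs (n%:R * (i%:R / L%:R)) = (2 * l%:R)^-1 * k%:R * S.
  under eq_bigr => i _ do rewrite -mulrA.
  rewrite -mulr_sumr; congr (_ * _); rewrite /S (reindex_inj rev_ord_inj) /=.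
  apply: eq_bigr => i _; rewrite subKn ?ltn_ord //; congr (_ * _).
  rewrite -[LHS]csN -[LHS](csDn _ n); congr cs.
  by rewrite natrB ?ltn_ord //; field.
by rewrite natrM LE; field; rewrite lR0 kR0.
Qed.

Let wave_coef_ge0 n : 0 <= wave_coef n.
Proof.
by rewrite wave_coefE mulr_ge0 ?fejer_ge0 // invr_ge0 mulr_ge0 ?exprn_ge0.
Qed.

Let wave_coef_le1 n : wave_coef n <= 1.
Proof.
rewrite wave_coefE ler_pdivrMl ?mulr_gt0 ?exprn_gt0 ?ltr0n // mulr1.
apply: le_trans (ler_norm _) _; apply: le_trans (norm_fejer _ _) _.
by rewrite natrM exprMn; lra.
Qed.

Let wave_coef0 : wave_coef 0 = 1.
Proof. by rewrite wave_coefE mul0r fejer0 natrM; field. Qed.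

(** In [fejerE] the right-hand side is at most 4, and for n <= N the argument n / L is at most 1/2,
    where [sqr_le_1Bcs] bounds the factor 2 - 2 cs from below. *)
Let wave_coef_le n : (0 < n <= N)%N -> wave_coef n <= 4 * k%:R ^+ 2 / n%:R ^+ 2.
Proof.
move=> /andP[n0 nN].
have lp : (0 : R) < l%:R by rewrite ltr0n.
have np : (0 : R) < n%:R by rewrite ltr0n.
have kp : (0 : R) < k%:R by rewrite ltr0n; lia.
have u0 : 0 <= (n%:R / L%:R : R) by rewrite divr_ge0.
have u1 : (n%:R / L%:R : R) <= 1 / 2.
  rewrite ler_pdivrMr; last by rewrite ltr0n /L; nia.
  rewrite LE; have : (n%:R <= N%:R :> R) by rewrite ler_nat.
  by rewrite NE; lra.
have h1 := @sqr_le_1Bcs R (n%:R / L%:R) ltac:(by rewrite ger0_norm).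
have h2 := fejerE (2 * l) (n%:R / L%:R : R).
have h3 := cos_geN1 (2 * pi * ((2 * l)%:R * (n%:R / L%:R : R))).
have h4 := fejer_ge0 (2 * l) (n%:R / L%:R : R).
have h5 : fejer (2 * l) (n%:R / L%:R) * (n%:R / L%:R) ^+ 2 <= 4 :> R.
  apply: (@le_trans _ _ (fejer (2 * l) (n%:R / L%:R) * (2 - 2 * cs (n%:R / L%:R)))).
    exact: ler_wpM2l.
  by rewrite h2 /cs; lra.
rewrite wave_coefE ler_pdivlMr ?exprn_gt0 // -mulrA ler_pdivrMl; last first.
  by rewrite mulr_gt0 ?exprn_gt0.
move: h5; rewrite LE.
set f := fejer _ _ => h5.
have := ler_wpM2r (sqr_ge0 (2 * k%:R * l%:R)) h5.
have -> : f * (n%:R / (2 * k%:R * l%:R)) ^+ 2 * (2 * k%:R * l%:R) ^+ 2 = f * n%:R ^+ 2.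
  by field; rewrite lR0 kR0.
by lra.
Qed.

Let kern t : R := N%:R^-1 * fejer N t.

(** The kernel has frequencies at most N < L, so equidistant sampling integrates it exactly. *)
Let sum_kern x : L%:R^-1 * \sum_(j < L) kern (x - j%:R / L%:R) = 1.
Proof.
rewrite /kern; under eq_bigr => j _ do rewrite (fejer_coef (T := N)) //.
rewrite -mulr_sumr big_split /= sumr_const card_ord -mulr_sumr exchange_big /=.
rewrite [X in _ + 2 * X]big1 => [|i _]; last first.
  rewrite -mulr_sumr sum_cs_equidistributed ?mulr0 //=.
  by have := ltn_ord i; rewrite /L /N; lia.
by rewrite mulr0 addr0 -mulr_natr; field; rewrite L0 N0.
Qed.

(** A Fejer mean with the discrete coefficients in place of Fourier coefficients; the factors (N -
    i.+1) / N are the Fejer weights. *)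
Definition wave_poly x : R :=
  1 + \sum_(i < N) (2 * (N - i.+1)%:R / N%:R * wave_coef i.+1) * cs (i.+1%:R * x).

Lemma distZN x : distZ (- x) = distZ x.
Proof.
have H y : distZ (- y) <= distZ y.
  have [n ->] := distZ_ex y; apply: le_trans (distZ_le _ (- n)) _.
  by rewrite mulrNz -opprD normrN.
by apply/eqP; rewrite eq_le H -{1}(opprK x) H.
Qed.

Let samples x : R := L%:R^-1 * \sum_(j < L) wave (j%:R / L%:R) * kern (x - j%:R / L%:R).

(** The samples are averaged against a positive kernel of total weight 1, so the error is the
    Lipschitz constant times the first moment of the kernel. That moment is bounded through distZ t
    <= d + (distZ t)^2 / d, and [fejerE] controls the second moment. *)
Let samples_approx d x : 0 < d ->
  `|wave x - samples x| <= k%:R ^+ 2 * (d + 4 / (N%:R * d)).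
Proof.
move=> d0; have Np : (0 : R) < N%:R by rewrite lt0r N0 ler0n.
have Lp : (0 : R) < L%:R by rewrite lt0r L0 ler0n.
have k0 t : 0 <= kern t by rewrite mulr_ge0 ?fejer_ge0 ?invr_ge0.
have kd t : distZ t * kern t <= d * kern t + 4 / (N%:R * d).
  have h1 : distZ t ^+ 2 * kern t <= 4 / N%:R.
    apply: (@le_trans _ _ ((2 - 2 * cs t) * kern t)).
      by rewrite ler_wpM2r // sqr_distZ_le.
    rewrite /kern mulrCA [_ * fejer _ _]mulrC fejerE mulrC ler_wpM2r ?invr_ge0 //.
    by have := cos_geN1 (2 * pi * (N%:R * t)); rewrite /cs; lra.
  have -> : 4 / (N%:R * d) = 4 / N%:R / d by field; rewrite N0 gt_eqF.
  have h2 : distZ t ^+ 2 * kern t / d <= 4 / N%:R / d.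
    by rewrite ler_wpM2r // invr_ge0 ltW.
  apply: le_trans (lerD (lexx (d * kern t)) h2).
  have -> : distZ t ^+ 2 * kern t / d = distZ t ^+ 2 / d * kern t by ring.
  rewrite -mulrDl ler_wpM2r //.
  rewrite -subr_ge0.
  have -> : d + distZ t ^+ 2 / d - distZ t = ((d - distZ t / 2) ^+ 2 + 3 / 4 * distZ t ^+ 2) / d.
    by field; rewrite gt_eqF.
  by rewrite divr_ge0 ?(ltW d0) // addr_ge0 ?sqr_ge0 // mulr_ge0 ?sqr_ge0.
have -> : wave x = wave x * (L%:R^-1 * \sum_(j < L) kern (x - j%:R / L%:R)).
  by rewrite sum_kern mulr1.
rewrite /samples mulrCA -mulrBr mulr_sumr -sumrB.
rewrite normrM ger0_norm ?invr_ge0 // mulrC ler_pdivrMr //.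
apply: le_trans (ler_norm_sum _ _ _) _.
apply: (@le_trans _ _ (\sum_(j < L) k%:R ^+ 2 *
    (d * kern (x - j%:R / L%:R) + 4 / (N%:R * d)))).
  apply: ler_sum => j _; rewrite -mulrBl normrM (ger0_norm (k0 _)).
  apply: (@le_trans _ _ (k%:R ^+ 2 * (distZ (x - j%:R / L%:R) * kern (x - j%:R / L%:R)))).
    by rewrite mulrA ler_wpM2r // wave_lip_distZ.
  by rewrite ler_wpM2l ?exprn_ge0.
rewrite -mulr_sumr big_split /= -mulr_sumr sumr_const card_ord -mulr_natr.
have := sum_kern x; set S := \sum_(j < L) _ => hS.
have -> : S = L%:R by apply: (mulfI (invr_neq0 L0)); rewrite hS mulVf.
by rewrite le_eqVlt; apply/orP; left; apply/eqP; ring.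
Qed.

(** Averaging over x and -x cancels the odd part of the kernel expansion and leaves cosines only. *)
Let wave_polyE x : wave_poly x = (samples x + samples (- x)) / 2.
Proof.
have K a : (kern (x - a) + kern (- x - a)) / 2 =
    1 + \sum_(i < N) 2 * (N - i.+1)%:R / N%:R * cs (i.+1%:R * a) * cs (i.+1%:R * x).
  rewrite /kern !(fejer_coef (T := N)) //.
  set S1 := \sum_(i < N) _; set S2 := \sum_(i < N) _; set S3 := \sum_(i < N) _.
  suff -> : S3 = (S1 + S2) / N%:R by field.
  rewrite -big_split mulr_suml; apply: eq_bigr => i _ /=.
  have := csM (i.+1%:R * x) (i.+1%:R * a).
  have -> : i.+1%:R * x - i.+1%:R * a = i.+1%:R * (x - a) by ring.
  have -> : cs (i.+1%:R * x + i.+1%:R * a) = cs (i.+1%:R * (- x - a)).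
    by rewrite -csN; congr cs; ring.
  move=> e; rewrite -mulrDr [cs (_ * (x - a)) + _]addrC -e; field.
  by rewrite N0.
transitivity (L%:R^-1 * \sum_(j < L) (wave (j%:R / L%:R) * (1 +
   \sum_(i < N) 2 * (N - i.+1)%:R / N%:R * cs (i.+1%:R * (j%:R / L%:R)) *
     cs (i.+1%:R * x)))); last first.
  rewrite /samples -mulrDr -mulrA -big_split mulr_suml; congr (_ * _).
  by apply: eq_bigr => j _; rewrite -K /=; ring.
under eq_bigr => j _ do rewrite mulrDr mulr1.
rewrite big_split /= mulrDr; congr (_ + _).
  rewrite -[LHS]wave_coef0 /wave_coef; congr (_ * _); apply: eq_bigr => j _.
  by rewrite mul0r cs0 mulr1.
under [in RHS]eq_bigr => j _ do rewrite mulr_sumr.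
rewrite exchange_big /= mulr_sumr; apply: eq_bigr => i _.
rewrite /wave_coef !mulr_sumr mulr_suml;  apply: eq_bigr => j _; ring.
Qed.

Let waveN x : wave (- x) = wave x.
Proof. by rewrite /wave distZN. Qed.

Let wave_poly_approx d x : 0 < d ->
  `|wave x - wave_poly x| <= k%:R ^+ 2 * (d + 4 / (N%:R * d)).
Proof.
move=> d0; rewrite wave_polyE.
have := samples_approx x d0; have := samples_approx (- x) d0; rewrite waveN.
by rewrite !ler_norml; lra.
Qed.

Lemma wave_poly_le d x : 0 < d ->
  `|wave x - wave_poly x| <= k%:R ^+ 2 * (d + 4 / (l%:R * d)).
Proof.
move=> d0; apply: le_trans (wave_poly_approx x d0) _.
rewrite ler_wpM2l ?exprn_ge0 // lerD2l ler_wpM2l // lef_pV2 ?posrE ?mulr_gt0 ?ltr0n //.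
  by rewrite ler_wpM2r ?(ltW d0) // ler_nat /N; nia.
by rewrite /N; lia.
Qed.

Lemma wave_poly_coef_bound (i : nat) : (i < N)%N ->
  0 <= 2 * (N - i.+1)%:R / N%:R * wave_coef i.+1 <=
    Num.min 2 (8 * k%:R ^+ 2 / i.+1%:R ^+ 2).
Proof.
move=> iN; have c0 := wave_coef_ge0 i.+1; have c1 := wave_coef_le1 i.+1.
have c2 := @wave_coef_le i.+1 iN.
have r0 : 0 <= (N - i.+1)%:R / N%:R :> R by rewrite divr_ge0.
have r1 : (N - i.+1)%:R / N%:R <= 1 :> R.
  by rewrite ler_pdivrMr ?lt0r ?N0 ?ler0n // mul1r ler_nat leq_subr.
rewrite -(mulrA 2) le_min; apply/and3P; split; [by nra | by nra | ].
have -> : 8 * k%:R ^+ 2 / i.+1%:R ^+ 2 = 2 * (4 * k%:R ^+ 2 / i.+1%:R ^+ 2) :> R by ring.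
move: c2; set v := 4 * _ / _; nra.
Qed.

End Sampling.

(** Plays the role of the Fourier series of the wave: the degree depends on the accuracy, but the
    coefficient bounds do not, so sums over frequencies can be estimated uniformly in the degree. *)
Lemma wave_trig_approx (eta : R) : 0 < eta -> exists (N : nat) (b : nat -> R),
  (forall i, (i < N)%N -> 0 <= b i <= Num.min 2 (8 * k%:R ^+ 2 / i.+1%:R ^+ 2)) /\
  (forall x, `|wave x - (1 + \sum_(i < N) b i * cs (i.+1%:R * x))| <= eta).
Proof.
move=> e0; have kp : (0 : R) < k%:R by have := k2R; lra.
have kp2 : (0 : R) < k%:R ^+ 2 by rewrite exprn_gt0.
(* The term with d uses half of the error; the choice of l makes the other term at most the other
   half. *)
pose d := eta / (2 * k%:R ^+ 2).
have d0 : 0 < d by rewrite divr_gt0 // mulr_gt0.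
pose l := (Num.truncn (8 * k%:R ^+ 2 / (eta * d))).+1.
have hl : 8 * k%:R ^+ 2 / (eta * d) < l%:R by rewrite -truncn_lt_nat // ?divr_ge0 ?mulr_ge0 // ltW.
exists (k * l)%N, (fun i => 2 * (k * l - i.+1)%:R / (k * l)%:R * wave_coef l i.+1); split.
  by move=> i iN; apply: wave_poly_coef_bound.
move=> x; apply: le_trans (@wave_poly_le l _ d x d0) _ => //.
have -> : eta = k%:R ^+ 2 * (d + eta / (2 * k%:R ^+ 2)) by rewrite /d; field; lra.
rewrite ler_wpM2l ?exprn_ge0 // lerD2l.
have lp : (0 : R) < l%:R by rewrite ltr0n.
rewrite ler_pdivrMr; last exact: mulr_gt0.
rewrite ltr_pdivrMr in hl; last exact: mulr_gt0.
rewrite mulrAC ler_pdivlMr; last by rewrite mulr_gt0.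
lra.
Qed.

End TriangleWave.

(** * Real Fourier transforms of densities *)

Section Integration.
Context {R : realType}.
Notation mu := (@lebesgue_measure R).
Implicit Types (f g : R -> R) (a b c x : R).

Definition lint (D : set R) f : R := \int[mu]_(x in D) f x.

(* The window [-1, 2] leaves room for bumps overlapping the ends of [0, 1]. *)
Definition test_fun f := continuous f /\ forall x, f x != 0 -> -1 <= x <= 2.

Lemma test_fun_integrable (D : set R) f : measurable D -> test_fun f ->
  mu.-integrable D (EFin \o f).
Proof.
move=> mD [cf sf].
apply: (@integrableS _ _ _ mu setT) => //.
have -> : EFin \o f = EFin \o (f \_ `[-1, 2]).
  apply/funext => x /=; congr EFin; rewrite patchE; case: ifPn => //.
  rewrite notin_setE /= in_itv /= => h; apply/eqP; apply/negPn.
  by apply/negP => /sf.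
rewrite -restrict_EFin -integrable_mkcond //.
  apply: continuous_compact_integrable; first exact: segment_compact.
  exact: continuous_subspaceT.
Qed.

Lemma test_funMc f g : test_fun f -> continuous g -> test_fun (fun x => f x * g x).
Proof.
move=> [cf sf] cg; split; first by move=> x; apply: cvgM; [exact: cf|exact: cg].
by move=> x h; apply: sf; apply: contraNneq h => ->; rewrite mul0r.
Qed.

Lemma test_funD f g : test_fun f -> test_fun g -> test_fun (fun x => f x + g x).
Proof.
move=> [cf sf] [cg sg]; split; first by move=> x; apply: cvgD; [exact: cf|exact: cg].
move=> x h; have [f0|/sf//] := eqVneq (f x) 0.
by apply: sg; apply: contraNneq h => ->; rewrite f0 addr0.
Qed.

Lemma test_funZ k f : test_fun f -> test_fun (fun x => k * f x).
Proof.
move=> [cf sf]; split; first by move=> x; apply: cvgM; [exact: cvg_cst|exact: cf].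
by move=> x h; apply: sf; apply: contraNneq h => ->; rewrite mulr0.
Qed.

Lemma test_fun0 : test_fun (fun=> 0).
Proof. by split => [x|x]; [exact: cvg_cst | rewrite eqxx]. Qed.

Lemma test_fun_norm f : test_fun f -> test_fun (fun x => `|f x|).
Proof.
move=> [cf sf]; split; first by move=> x; apply: cvg_norm; exact: cf.
by move=> x; rewrite normr_eq0; exact: sf.
Qed.

Lemma test_fun_sum (N : nat) (F : nat -> R -> R) : (forall i, (i < N)%N -> test_fun (F i)) ->
  test_fun (fun x => \sum_(i < N) F i x).
Proof.
elim: N => [|N IH] h.
  have -> : (fun x => \sum_(i < 0) F i x) = (fun=> 0).
    by apply/funext => x; rewrite big_ord0.
  exact: test_fun0.
have -> : (fun x => \sum_(i < N.+1) F i x) = (fun x => \sum_(i < N) F i x + F N x).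
  by apply/funext => x; rewrite big_ord_recr.
by apply: test_funD; [apply: IH => i iN; apply: h; rewrite ltnW | exact: h].
Qed.

Lemma lintD (D : set R) f g : measurable D -> test_fun f -> test_fun g ->
  lint D (fun x => f x + g x) = lint D f + lint D g.
Proof. by move=> mD tf tg; apply: RintegralD => //; exact: test_fun_integrable. Qed.

Lemma lintZ (D : set R) k f : measurable D -> test_fun f ->
  lint D (fun x => k * f x) = k * lint D f.
Proof. by move=> mD tf; apply: RintegralZl => //; exact: test_fun_integrable. Qed.

Lemma lintB (D : set R) f g : measurable D -> test_fun f -> test_fun g ->
  lint D (fun x => f x - g x) = lint D f - lint D g.
Proof. by move=> mD tf tg; apply: RintegralB => //; exact: test_fun_integrable. Qed.

Lemma lint_sum (D : set R) (N : nat) (F : nat -> R -> R) : measurable D ->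
  (forall i, (i < N)%N -> test_fun (F i)) ->
  lint D (fun x => \sum_(i < N) F i x) = \sum_(i < N) lint D (F i).
Proof.
move=> mD; elim: N => [|N IH] h.
  rewrite big_ord0 -[RHS](mul0r (lint D (fun=> 0))) -lintZ //; last exact: test_fun0.
  by congr lint; apply/funext => x; rewrite big_ord0 mul0r.
have hN i : (i < N)%N -> test_fun (F i) by move=> iN; apply: h; rewrite ltnW.
rewrite big_ord_recr /= -IH // -lintD //; [|exact: test_fun_sum|exact: h].
by congr lint; apply/funext => x; rewrite big_ord_recr.
Qed.

Lemma le_lint (D : set R) f g : measurable D -> test_fun f -> test_fun g ->
  (forall x, D x -> f x <= g x) -> lint D f <= lint D g.
Proof. by move=> mD tf tg h; rewrite /lint le_Rintegral //; exact: test_fun_integrable. Qed.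

Lemma lint_ge0 (D : set R) f : (forall x, D x -> 0 <= f x) -> 0 <= lint D f.
Proof. by move=> h; rewrite /lint Rintegral_ge0. Qed.

Lemma eq_lint (D : set R) f g : (forall x, D x -> f x = g x) -> lint D f = lint D g.
Proof. by move=> h; apply: eq_Rintegral => x /set_mem; exact: h. Qed.

Lemma norm_lint (D : set R) f : measurable D -> test_fun f ->
  `|lint D f| <= lint D (fun x => `|f x|).
Proof. by move=> mD tf; apply: le_normr_Rintegral => //; exact: test_fun_integrable. Qed.

Lemma le_norm_lint (D : set R) f g : measurable D -> test_fun f -> test_fun g ->
  (forall x, D x -> `|f x| <= g x) -> `|lint D f| <= lint D g.
Proof.
move=> mD tf tg h; apply: le_trans (norm_lint mD tf) _.
by apply: le_lint => //; exact: test_fun_norm.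
Qed.

Lemma lint_setT (D : set R) f : (forall x, ~ D x -> f x = 0) ->
  lint setT f = lint D f.
Proof.
move=> h; rewrite /lint [RHS]Rintegral_mkcond; congr Rintegral; apply/funext => x.
by rewrite patchE; case: ifPn => //; rewrite notin_setE => /h.
Qed.

Lemma lint_le_setT (D : set R) f : measurable D -> test_fun f ->
  (forall x, 0 <= f x) -> lint D f <= lint setT f.
Proof.
move=> mD tf f0.
have iT := test_fun_integrable measurableT tf.
rewrite -[setT](setUv D) /lint Rintegral_setU ?setUv //; last first.
- by apply/disj_setPCl.
- exact: measurableC.
by rewrite lerDl Rintegral_ge0.
Qed.

Lemma lint_itvU a b c f : a <= b -> b <= c -> test_fun f ->
  lint `]a, c] f = lint `]a, b] f + lint `]b, c] f.
Proof.
move=> ab bc tf; rewrite /lint.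
have := @Rintegral_itvB R f (BRight a) (BRight c) b.
move=> <- //; first by rewrite addrC subrK.
by apply: test_fun_integrable => //; exact: measurable_itv.
Qed.

Lemma lint_itv_le a b f (K : R) : a <= b -> test_fun f ->
  (forall x, a < x <= b -> f x <= K) -> lint `]a, b] f <= K * (b - a).
Proof.
move=> ab tf h.
have -> : K * (b - a) = \int[mu]_(x in `]a, b]) K.
  rewrite Rintegral_cst //; congr (_ * _).
  apply: etrans (congr1 fine (esym (lebesgue_measure_itv `]a, b]%R))).
  by rewrite /= lte_fin; case: ltgtP ab => // ->; rewrite subrr.
rewrite /lint le_Rintegral //.
- by apply: test_fun_integrable => //; exact: measurable_itv.
- apply: measurable_bounded_integrable => //.
  + have e := lebesgue_measure_itv `]a, b]%R; rewrite [ltLHS]e.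
    by rewrite /=; case: ifP; rewrite ltry.
  + exact: bounded_cst.
Qed.

Lemma lint_FTC a b f (F : R -> R) : a <= b -> continuous f ->
  (forall x, is_derive x 1 F (f x)) -> lint `]a, b] f = F b - F a.
Proof.
rewrite le_eqVlt => /predU1P[->|ab] cf dF.
  by rewrite set_itvoc0 /lint Rintegral_set0 subrr.
have cF : continuous F.
  move=> x; apply: differentiable_continuous; apply/derivable1_diffP.
  by have [] := dF x.
rewrite /lint Rintegral_itv_obnd_cbnd; last first.
  apply: (@integrableS _ _ _ mu `[a, b]) => //; first exact: subset_itv_oc_cc.
  apply: continuous_compact_integrable; first exact: segment_compact.
  exact: continuous_subspaceT.
rewrite /Rintegral (@continuous_FTC2 _ f F) //.
- exact: continuous_subspaceT.
- split.
  + by move=> x _; have [] := dF x.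
  + by apply: cvg_at_right_filter; exact: cF.
  + by apply: cvg_at_left_filter; exact: cF.
- by move=> x _; rewrite derive1E; have [_ ->] := dF x.
Qed.

End Integration.

(** * Transforms of products with cosines and of triangular bumps *)

Section Transform.
Context {R : realType}.
Implicit Types (f g : R -> R) (a b c x w : R).

(* Real form of the Fourier transform; the phases [p] and [p + 1/4] recover
   the real and imaginary parts. *)
Definition tr f (xi p : R) : R := lint setT (fun x => f x * cs (x * xi + p)).

Lemma continuous_cs_affine (xi p : R) : continuous (fun x : R => cs (x * xi + p)).
Proof.
move=> x; rewrite /cs; apply: continuous_comp; last exact: continuous_cos.
apply: cvgM; first exact: cvg_cst.
by apply: cvgD; [apply: cvgM; [exact: cvg_id|exact: cvg_cst]|exact: cvg_cst].
Qed.

Lemma test_fun_cs f (xi p : R) : test_fun f -> test_fun (fun x => f x * cs (x * xi + p)).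
Proof. by move=> tf; apply: test_funMc => //; exact: continuous_cs_affine. Qed.

Lemma trD f g (xi p : R) : test_fun f -> test_fun g ->
  tr (fun x => f x + g x) xi p = tr f xi p + tr g xi p.
Proof.
move=> tf tg; rewrite /tr -lintD //; try exact: test_fun_cs.
by apply: eq_lint => x _; rewrite mulrDl.
Qed.

Lemma trB f g (xi p : R) : test_fun f -> test_fun g ->
  tr (fun x => f x - g x) xi p = tr f xi p - tr g xi p.
Proof.
move=> tf tg; rewrite /tr -lintB //; try exact: test_fun_cs.
by apply: eq_lint => x _; rewrite mulrBl.
Qed.

Lemma trZ f (k xi p : R) : test_fun f -> tr (fun x => k * f x) xi p = k * tr f xi p.
Proof.
move=> tf; rewrite /tr -lintZ //; try exact: test_fun_cs.
by apply: eq_lint => x _; rewrite mulrA.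
Qed.

Lemma tr_sum (N : nat) (F : nat -> R -> R) (xi p : R) :
  (forall i, (i < N)%N -> test_fun (F i)) ->
  tr (fun x => \sum_(i < N) F i x) xi p = \sum_(i < N) tr (F i) xi p.
Proof.
move=> h; rewrite /tr -(lint_sum (F := fun i x => F i x * cs (x * xi + p))) //.
  by apply: eq_lint => x _; rewrite mulr_suml.
by move=> i iN; apply: test_fun_cs; exact: h.
Qed.

Lemma norm_tr_le f g (xi p : R) : test_fun f -> test_fun g ->
  (forall x, `|f x| <= g x) -> `|tr f xi p| <= lint setT g.
Proof.
move=> tf tg h; apply: le_norm_lint => //; first exact: test_fun_cs.
move=> x _; rewrite normrM; apply: le_trans (h x).
by rewrite ler_piMr // norm_cs.
Qed.

Lemma tr_mul_cs f (m xi p : R) : test_fun f ->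
  tr (fun x => f x * cs (m * x)) xi p = (tr f (xi + m) p + tr f (xi - m) p) / 2.
Proof.
move=> tf; rewrite /tr -lintD //; try exact: test_fun_cs.
rewrite mulrC -lintZ //; last by apply: test_funD; exact: test_fun_cs.
apply: eq_lint => x _; have := csM (x * xi + p) (m * x).
have -> : x * xi + p + m * x = x * (xi + m) + p by ring.
have -> : x * xi + p - m * x = x * (xi - m) + p by ring.
move=> e; rewrite -mulrDr -e; lra.
Qed.

Lemma tr_mul_trig_poly f (N : nat) (b : nat -> R) (q xi p : R) : test_fun f ->
  tr (fun x => f x * (1 + \sum_(i < N) b i * cs (i.+1%:R * (q * x)))) xi p =
  tr f xi p + \sum_(i < N) b i / 2 *
    (tr f (xi + i.+1%:R * q) p + tr f (xi - i.+1%:R * q) p).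
Proof.
move=> tf.
have cs_affineE m : (fun x : R => cs (x * m + 0)) = (fun x => cs (m * x)).
  by apply/funext => y; rewrite addr0 mulrC.
have h i : test_fun (fun x => b i * (f x * cs (i.+1%:R * q * x))).
  apply/test_funZ/test_funMc => // x.
  by have := @continuous_cs_affine (i.+1%:R * q) 0 x; rewrite cs_affineE.
transitivity (tr (fun x => f x + \sum_(i < N) b i * (f x * cs (i.+1%:R * q * x))) xi p).
  congr tr; apply/funext => x; rewrite mulrDr mulr1 mulr_sumr; congr (_ + _).
  by apply: eq_bigr => i _; rewrite mulrCA [_ * (q * x)]mulrA.
rewrite trD //; last first.
  by apply: (test_fun_sum (F := fun i x => b i * (f x * cs (i.+1%:R * q * x)))).
rewrite (tr_sum (F := fun i x => b i * (f x * cs (i.+1%:R * q * x)))) //.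
congr (_ + _); apply: eq_bigr => i _; rewrite trZ ?tr_mul_cs //; first lra.
apply: test_funMc => // x.
by have := @continuous_cs_affine (i.+1%:R * q) 0 x; rewrite cs_affineE.
Qed.

Definition bump a w x : R := w^-1 * Num.max 0 (1 - `|x - a| / w).

Lemma bump_ge0 a w x : 0 < w -> 0 <= bump a w x.
Proof. by move=> w0; rewrite mulr_ge0 ?invr_ge0 ?(ltW w0) // le_max lexx. Qed.

Lemma bump_le a w x : 0 < w -> bump a w x <= w^-1.
Proof.
move=> w0; rewrite -[leRHS]mulr1 ler_wpM2l ?invr_ge0 ?(ltW w0) // ge_max ler01 /=.
by rewrite gerBl divr_ge0 // ltW.
Qed.

Lemma bump_supp a w x : 0 < w -> bump a w x != 0 -> `|x - a| < w.
Proof.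
move=> w0; apply: contraNT; rewrite -leNgt => h.
by rewrite /bump max_l ?mulr0 // subr_le0 ler_pdivlMr // mul1r.
Qed.

Lemma lip_continuous f (K : R) : (forall x y, `|f x - f y| <= K * `|x - y|) -> continuous f.
Proof.
move=> h x; apply/cvgrPdist_le => e e0; near=> y.
apply: le_trans (h x y) _.
apply: (@le_trans _ _ ((1 + `|K|) * `|x - y|)).
  by rewrite ler_wpM2r //; have := ler_norm K; lra.
rewrite -ler_pdivlMl; last by rewrite ltr_pwDl.
near: y; apply: cvgr_dist_le; first exact: cvg_id.
by rewrite mulr_gt0 // invr_gt0 ltr_pwDl.
Unshelve. all: by end_near. Qed.

Lemma bump_lip a w x y : 0 < w -> `|bump a w x - bump a w y| <= w^-1 ^+ 2 * `|x - y|.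
Proof.
move=> w0; have i0 : 0 < w^-1 by rewrite invr_gt0.
rewrite -mulrBr normrM (ger0_norm (ltW i0)) expr2 -mulrA ler_wpM2l ?(ltW i0) //.
have h : `| `|x - a| - `|y - a| | <= `|x - y|.
  by apply: le_trans (ler_dist_dist _ _) _; rewrite opprB addrA subrK.
apply: (@le_trans _ _ (w^-1 * `| `|x - a| - `|y - a| |)); last first.
  by rewrite ler_wpM2l // ltW.
rewrite -[X in _ <= X * _](ger0_norm (ltW i0)) -normrM mulrBr [w^-1 * `|x - a|]mulrC
  [w^-1 * `|y - a|]mulrC.
set u := `|x - a| / w; set v := `|y - a| / w.
move: (ler_norm (u - v)) (ler_norm (v - u)); rewrite (distrC v).
by rewrite ler_norml /Num.max; case: (ltrP 0 (1 - u)); case: (ltrP 0 (1 - v)); lra.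
Qed.

Lemma test_fun_bump a w : 0 < w -> w <= 1 -> 0 <= a <= 1 -> test_fun (bump a w).
Proof.
move=> w0 w1 a01; split; first by apply: lip_continuous => x y; exact: bump_lip.
by move=> x /(bump_supp w0); rewrite ltr_norml; lra.
Qed.

(* [F 1] and [F (- 1)] are antiderivatives to the left and to the right of the peak. *)
Let lint_bump_split a w (f : R -> R) (F : R -> R -> R) : 0 < w -> w <= 1 -> 0 <= a <= 1 ->
  continuous f ->
  (forall e x, is_derive x 1 (F e) ((1 + e * ((x - a) / w)) * f x)) ->
  lint setT (fun x => bump a w x * f x) =
    w^-1 * (F 1 a - F 1 (a - w) + (F (-1) (a + w) - F (-1) a)).
Proof.
move=> w0 w1 a01 cf dF.
have tb := test_fun_bump w0 w1 a01.
have cl (e : R) : continuous (fun x : R => (1 + e * ((x - a) / w)) * f x).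
  move=> x; apply: cvgM; last exact: cf.
  apply: cvgD; first exact: cvg_cst.
  apply: cvgM; first exact: cvg_cst.
  by apply: cvgM; [apply: cvgB; [exact: cvg_id|exact: cvg_cst]|exact: cvg_cst].
have tf : test_fun (fun x => bump a w x * f x) by exact: test_funMc.
rewrite (lint_setT (D := `]a - w, a + w])); last first.
  move=> x; rewrite /= in_itv /= => h; have [->|/(bump_supp w0)] := eqVneq (bump a w x) 0.
    by rewrite mul0r.
  by rewrite ltr_norml => /andP[h1 h2]; exfalso; apply: h; apply/andP; split; lra.
rewrite (@lint_itvU _ (a - w) a (a + w)) ?lerDl ?gerBl ?(ltW w0) // mulrDr.
have eb (e x : R) : `|x - a| = - e * (x - a) -> `|x - a| <= w ->
    bump a w x * f x = w^-1 * ((1 + e * ((x - a) / w)) * f x).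
  move=> h1 h2; rewrite /bump max_r; first by rewrite h1; field; lra.
  by rewrite subr_ge0 ler_pdivrMr // mul1r.
have clw (e : R) : continuous (fun x : R => w^-1 * ((1 + e * ((x - a) / w)) * f x)).
  by move=> x; apply: cvgM; [exact: cvg_cst|exact: cl].
congr (_ + _).
  transitivity (lint `]a - w, a] (fun x => w^-1 * ((1 + 1 * ((x - a) / w)) * f x))).
    apply: eq_lint => x; rewrite /= in_itv /= => /andP[h1 h2].
    by apply: eb; rewrite ler0_norm; lra.
  have hd x : is_derive x 1 (fun x => w^-1 * F 1 x) (w^-1 * ((1 + 1 * ((x - a) / w)) * f x)).
    by apply: is_deriveZ; exact: dF.
  have hab : a - w <= a by lra.
  by rewrite (lint_FTC hab (clw 1) hd) mulrBr.
transitivity (lint `]a, a + w] (fun x => w^-1 * ((1 + (-1) * ((x - a) / w)) * f x))).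
  apply: eq_lint => x; rewrite /= in_itv /= => /andP[h1 h2].
  by apply: eb; rewrite ger0_norm; lra.
have hd x : is_derive x 1 (fun x => w^-1 * F (-1) x) (w^-1 * ((1 + (-1) * ((x - a) / w)) * f x)).
  by apply: is_deriveZ; exact: dF.
have hab : a <= a + w by lra.
by rewrite (lint_FTC hab (clw _) hd) mulrBr.
Qed.

Let dD (f g : R -> R) x df dg : is_derive x 1 f df -> is_derive x 1 g dg ->
  is_derive x 1 (fun y => f y + g y) (df + dg).
Proof. by move=> ? ?; exact: is_deriveD. Qed.

Let dM (f g : R -> R) x df dg : is_derive x 1 f df -> is_derive x 1 g dg ->
  is_derive x 1 (fun y => f y * g y) (f x * dg + g x * df).
Proof. by move=> ? ?; exact: is_deriveM. Qed.

Let dlin (m c x : R) : is_derive x 1 (fun y => m * y + c) m.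
Proof.
have h := dD (dM (is_derive_cst m x 1) (is_derive_id x 1)) (is_derive_cst c x 1).
suff e : m = m * 1 + id x * 0 + 0 by rewrite [X in is_derive _ _ _ X]e; exact: h.
by rewrite mulr0 mulr1 !addr0.
Qed.

Let dsin (m c x : R) : is_derive x 1 (fun y => sin (m * y + c)) (cos (m * x + c) * m).
Proof. exact: is_derive1_comp (is_derive_sin _) (dlin m c x). Qed.

Let dcos (m c x : R) : is_derive x 1 (fun y => cos (m * y + c)) (- sin (m * x + c) * m).
Proof. exact: is_derive1_comp (is_derive_cos _) (dlin m c x). Qed.

Let deq (f g : R -> R) x df dg : f =1 g -> df = dg -> is_derive x 1 f df -> is_derive x 1 g dg.
Proof. by move=> /funext -> ->. Qed.

Lemma lint_bump a w : 0 < w -> w <= 1 -> 0 <= a <= 1 -> lint setT (bump a w) = 1.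
Proof.
move=> w0 w1 a01.
transitivity (lint setT (fun x => bump a w x * cst 1 x)).
  by apply: eq_lint => x _; rewrite mulr1.
have dsq (e x : R) : is_derive x 1 (fun x : R => e / (2 * w) * ((x - a) * (x - a)) + x)
    ((1 + e * ((x - a) / w)) * 1).
  have h0 : is_derive x 1 (fun y : R => y - a) 1.
    by apply: deq (dlin 1 (- a) x) => // y; rewrite mul1r.
  have := dD (dM (is_derive_cst (e / (2 * w)) x 1) (dM h0 h0)) (is_derive_id x 1).
  by apply: deq => // ; rewrite /=; field; lra.
have c1 : continuous (cst 1 : R -> R) by move=> x; exact: cvg_cst.
by rewrite (lint_bump_split w0 w1 a01 c1 dsq); field; lra.
Qed.

Lemma tr_bump_le1 a w (xi p : R) : 0 < w -> w <= 1 -> 0 <= a <= 1 ->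
  `|tr (bump a w) xi p| <= 1.
Proof.
move=> w0 w1 a01; rewrite -(lint_bump w0 w1 a01).
have tb := test_fun_bump w0 w1 a01.
by apply: norm_tr_le => // x; rewrite ger0_norm // bump_ge0.
Qed.

(** Two integrations by parts turn the transform into a second difference of the cosine divided by
    (2 pi w xi)^2; the difference is at most 4 and (2 pi)^2 absorbs it. *)
Lemma tr_bump_le a w (xi p : R) : 0 < w -> w <= 1 -> 0 <= a <= 1 -> xi != 0 ->
  `|tr (bump a w) xi p| <= (w * xi)^-1 ^+ 2.
Proof.
move=> w0 w1 a01 xi0.
pose m : R := 2 * pi * xi; pose c : R := 2 * pi * p.
have p2 := @pi_ge2 R.
have m0 : m != 0 by rewrite !mulf_neq0 // gt_eqF //; lra.
have csE x : cs (x * xi + p) = cos (m * x + c) by rewrite /cs /m /c; congr cos; ring.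
(* The antiderivative obtained by integrating the linear slope by parts against the cosine. *)
pose F e (x : R) := (e / w * x + (1 - e * a / w)) * (m^-1 * sin (m * x + c)) +
   e * (w * m ^+ 2)^-1 * cos (m * x + c).
have dF e x : is_derive x 1 (F e) ((1 + e * ((x - a) / w)) * cs (x * xi + p)).
  rewrite csE.
  have := dD (dM (dlin (e / w) (1 - e * a / w) x) (dM (is_derive_cst m^-1 x 1) (dsin m c x)))
     (dM (is_derive_cst (e * (w * m ^+ 2)^-1) x 1) (dcos m c x)).
  apply: deq => //; rewrite /=; field; rewrite m0 /=; lra.
rewrite /tr (lint_bump_split w0 w1 a01 (@continuous_cs_affine xi p) dF).
have -> : w^-1 * (F 1 a - F 1 (a - w) + (F (-1) (a + w) - F (-1) a)) =
   (w * xi)^-1 ^+ 2 * ((2 * cos (m * a + c) - cos (m * (a - w) + c) - cos (m * (a + w) + c))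
     / (2 * pi) ^+ 2).
  rewrite /F; set u := sin _; set v := sin _; set z := sin _.
  set u' := cos _; set v' := cos _; set z' := cos _.
  have pn : pi != 0 :> R by rewrite gt_eqF // pi_gt0.
  have wn : w != 0 by rewrite gt_eqF.
  rewrite /m; move: pn; generalize (@pi R) => P pn; field.
  by rewrite pn wn xi0.
rewrite normrM ger0_norm ?exprn_even_ge0 // ler_piMr ?exprn_even_ge0 //.
rewrite normrM normfV ler_pdivrMr ?normr_gt0 ?expf_neq0 ?gt_eqF ?mulr_gt0 ?pi_gt0 //.
rewrite mul1r (ger0_norm (exprn_even_ge0 _ _)) //.
have h1 := cos_max (m * a + c); have h2 := cos_max (m * (a - w) + c).
have h3 := cos_max (m * (a + w) + c); move: h1 h2 h3; rewrite !ler_norml; nra.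
Qed.

End Transform.

(** * Sums of shifted weights over multiples of primes *)

Section Sums.
Context {R : realType}.
Implicit Types (x t xi tau C : R).

(** The coefficient bound of [wave_trig_approx], halved because a product with a cosine splits
    equally between the two shifts of the frequency. *)
Definition wcoef (k i : nat) : R := Num.min 2 (8 * k%:R ^+ 2 / i.+1%:R ^+ 2) / 2.

Lemma sum_multiples_le (f : nat -> R) (q N : nat) : (0 < q)%N ->
  (forall l, 0 <= f l) ->
  \sum_(i < N) f (i.+1 * q)%N <= \sum_(l < (N * q).+1) f l.
Proof.
move=> q0 f0; elim: N => [|N IH]; first by rewrite big_ord0 sumr_ge0.
rewrite big_ord_recr [leRHS]big_ord_recr /= lerD2r; apply: le_trans IH _.
have h : ((N * q).+1 <= N.+1 * q)%N by rewrite mulSn; lia.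
rewrite (big_ord_widen _ f h) [leRHS](bigID (fun l : 'I__ => (l < (N * q).+1)%N)) /=.
by rewrite lerDl sumr_ge0.
Qed.

Lemma jap_nat_le (n : nat) : (0 < n)%N -> jap (n%:R : R) <= 2 * n%:R.
Proof.
move=> n0; rewrite /jap ger0_norm //.
have : (1 : R) <= n%:R by rewrite ler1n.
by lra.
Qed.

(** The constant may depend on k and q: the lemma is there to keep the decay quadratic so that a
    step can be repeated. Either n q is comparable to xi and the coefficient n^-2 is small, or xi -
    n q is comparable to xi. *)
Lemma sum_wcoef_jap_le (k q : nat) : (0 < q)%N -> exists2 C : R, 0 < C & forall xi (N : nat),
  \sum_(i < N) wcoef k i * ((jap (xi + i.+1%:R * q%:R))^-1 ^+ 2 +
     (jap (xi - i.+1%:R * q%:R))^-1 ^+ 2) <= C * (jap xi)^-1 ^+ 2.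
Proof.
move=> q0; pose K : R := 4 * k%:R ^+ 2.
have K0 : 0 <= K by rewrite mulr_ge0 ?exprn_ge0.
have main xi (N : nat) : \sum_(i < N) wcoef k i * (jap (xi - i.+1%:R * q%:R))^-1 ^+ 2 <=
    K * (128 * q%:R ^+ 2 + 128) * (jap xi)^-1 ^+ 2.
  have jx := jap_gt0 xi.
  apply: (@le_trans _ _ (\sum_(i < N) (K * (jap xi)^-1 ^+ 2 *
     (8 * q%:R ^+ 2 * decay (xi - i.+1%:R * q%:R) + 8 * decay (0 - i.+1%:R))))).
    apply: ler_sum => i _; set n : R := i.+1%:R.
    have n1 : 1 <= n by rewrite /n ler1n.
    have q1 : (1 : R) <= q%:R by rewrite ler1n.
    have h1 : wcoef k i <= K / n ^+ 2.
      rewrite /wcoef ler_pdivrMr // ge_min; apply/orP; right.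
      by rewrite le_eqVlt; apply/orP; left; apply/eqP; rewrite /K /n; ring.
    have jn := jap_gt0 (xi - n * q%:R).
    (* Both cases are treated at once: this inequality exchanges n^-2 times a shifted square for one
       fixed square times a sum of two summable terms. *)
    have h2 : jap xi ^+ 2 <= 8 * n ^+ 2 * q%:R ^+ 2 + 2 * jap (xi - n * q%:R) ^+ 2.
      have : jap xi <= jap (n * q%:R) + jap (xi - n * q%:R).
        rewrite /jap; have := ler_normD (n * q%:R) (xi - n * q%:R).
        by rewrite [n * _ + _]addrC subrK; lra.
      have : jap (n * q%:R) <= 2 * (n * q%:R).
        by rewrite /n -natrM; apply: jap_nat_le; rewrite muln_gt0.
      move=> a1 a2; have a3 : jap xi <= 2 * (n * q%:R) + jap (xi - n * q%:R) by lra.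
      have : jap xi ^+ 2 <= (2 * (n * q%:R) + jap (xi - n * q%:R)) ^+ 2.
        by apply: lerXn2r => //; rewrite nnegrE ?addr_ge0 ?mulr_ge0 //; lra.
      have := sqr_ge0 (2 * (n * q%:R) - jap (xi - n * q%:R)); rewrite !expr2; lra.
    have h3 : n^-1 ^+ 2 <= 4 * decay (0 - n).
      apply: (@le_trans _ _ (4 * (jap (0 - n))^-1 ^+ 2)); last first.
        by rewrite ler_wpM2l // jap_inv2_le_decay.
      rewrite sub0r japN /n; have := @jap_nat_le i.+1 isT; rewrite -/n => hn.
      have -> : 4 * (jap n)^-1 ^+ 2 = ((jap n / 2)^-1) ^+ 2.
        by field; rewrite gt_eqF // jap_gt0.
      apply: lerXn2r; rewrite ?nnegrE ?invr_ge0 //; try by have := jap_gt0 n; lra.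
      rewrite lef_pV2 ?posrE; have := jap_gt0 n; lra.
    apply: (@le_trans _ _ (K / n ^+ 2 * (jap (xi - n * q%:R))^-1 ^+ 2)).
      by rewrite ler_wpM2r // exprn_ge0 // invr_ge0 ltW.
    rewrite -[X in X <= _]mulrA -[X in _ <= X]mulrA ler_wpM2l // !exprVn.
    rewrite ler_pdivlMl ?exprn_gt0 //.
    apply: (@le_trans _ _ (8 * q%:R ^+ 2 * (jap (xi - n * q%:R))^-1 ^+ 2 + 2 * n^-1 ^+ 2)).
      rewrite -subr_ge0.
      have -> : 8 * q%:R ^+ 2 * (jap (xi - n * q%:R))^-1 ^+ 2 + 2 * n^-1 ^+ 2 -
        jap xi ^+ 2 * ((n ^+ 2)^-1 * (jap (xi - n * q%:R) ^+ 2)^-1) =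
        (8 * n ^+ 2 * q%:R ^+ 2 + 2 * jap (xi - n * q%:R) ^+ 2 - jap xi ^+ 2) *
         (n^-1 * (jap (xi - n * q%:R))^-1) ^+ 2.
        by field; rewrite !gt_eqF //; lra.
      by rewrite mulr_ge0 ?sqr_ge0 // subr_ge0.
    apply: lerD; last first.
      rewrite (_ : 8 * decay _ = 2 * (4 * decay (0 - n))); last by ring.
      by rewrite ler_wpM2l.
    by rewrite ler_wpM2l ?mulr_ge0 ?exprn_ge0 // jap_inv2_le_decay.
  rewrite -mulr_sumr big_split /= -!mulr_sumr.
  have e1 : \sum_(i < N) decay (xi - i.+1%:R * q%:R) <= 16.
    under eq_bigr => i _ do rewrite -natrM.
    apply: le_trans (sum_decay_le (N * q).+1 xi).
    apply: (@sum_multiples_le (fun l => decay (xi - l%:R))) => // l.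
    exact: decay_ge0.
  have e2 : \sum_(i < N) decay (0 - i.+1%:R : R) <= 16.
    apply: le_trans (sum_decay_le (N * 1).+1 0).
    have := @sum_multiples_le (fun l => decay (0 - l%:R)) 1 N isT (fun l => decay_ge0 _).
    by under eq_bigr => i _ do rewrite muln1.
  rewrite mulrAC ler_wpM2r ?exprn_ge0 ?invr_ge0 ?(ltW jx) // ler_wpM2l //.
  have := sqr_ge0 (q%:R : R); nra.
exists (2 * (K * (128 * q%:R ^+ 2 + 128)) + 1).
  by have := sqr_ge0 (q%:R : R); nra.
move=> xi N; under eq_bigr => i _ do rewrite mulrDr.
rewrite big_split /=.
have h1 := main xi N; have h2 := main (- xi) N; rewrite japN in h2.
have e : \sum_(i < N) wcoef k i * (jap (xi + i.+1%:R * q%:R))^-1 ^+ 2 =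
   \sum_(i < N) wcoef k i * (jap (- xi - i.+1%:R * q%:R))^-1 ^+ 2.
  by apply: eq_bigr => i _; rewrite -opprD japN.
have h3 : 0 <= (jap xi)^-1 ^+ 2 by rewrite exprn_ge0 // invr_ge0 ltW // jap_gt0.
by rewrite e; lra.
Qed.

(** With v = 2k/n, n = i.+1, the coefficient is at most the minimum of 1 and v^2, which lies below
    v^tau for every tau between 0 and 1. *)
Lemma wcoef_le_powR k i tau : (0 < k)%N -> 0 < tau <= 1 ->
  wcoef k i <= (2 * k%:R / i.+1%:R) `^ tau.
Proof.
move=> k0 /andP[t0 t1]; set v := 2 * k%:R / _.
have v0 : 0 < v by rewrite divr_gt0 ?mulr_gt0 ?ltr0n.
have [h|h] := leP 1 v.
  apply: (@le_trans _ _ 1); first by rewrite ler_pdivrMr // mul1r ge_min lexx.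
  by rewrite -(powRr0 v) ler_powR // ltW.
apply: (@le_trans _ _ (v ^+ 2)).
  rewrite ler_pdivrMr // ge_min; apply/orP; right.
  by rewrite le_eqVlt; apply/orP; left; apply/eqP; rewrite /v; field; rewrite nat1r pnatr_eq0.
rewrite -powR_mulrn ?(ltW v0) // ger_powR ?v0 ?(ltW h) //; lra.
Qed.

Lemma ln2_bounds : 1 / 2 <= ln (2 : R) <= 1.
Proof.
apply/andP; split; last by have := @le_ln1Dx R 1; rewrite (_ : 1 + 1 = 2) //; apply; lra.
have := @le_ln1Dx R (- (1 / 2)); rewrite (_ : 1 - 1 / 2 = 2^-1 :> R); last by lra.
by rewrite lnV ?posrE // => h; have := h ltac:(lra); lra.
Qed.

(** A frequency above 2^m / (4m) has logarithm at least m ln 2 - ln (4m). For m >= 16 the correction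
    is controlled by the tangent of the logarithm at 16. *)
Lemma lam_lower (m l : nat) : (16 <= m)%N -> (2 ^ m <= 4 * m * l)%N -> m%:R / 8 <= lam (l%:R : R).
Proof.
move=> m16 hl; have /andP[l1 l2] := ln2_bounds.
have mR : (16 : R) <= m%:R by rewrite (ler_nat _ 16).
have jl : 0 < jap (l%:R : R) := jap_gt0 _.
have h : (2 : R) ^+ m <= 4 * m%:R * jap (l%:R : R).
  rewrite -natrX; apply: (@le_trans _ _ (4 * m * l)%:R); first by rewrite ler_nat.
  by rewrite !natrM ler_wpM2l ?mulr_ge0 // /jap ger0_norm // lerDr.
have : ln ((2 : R) ^+ m) <= ln (4 * m%:R * jap (l%:R : R)).
  by rewrite ler_ln ?posrE ?exprn_gt0 ?mulr_gt0 //; lra.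
rewrite lnXn // lnM ?posrE ?mulr_gt0 //; last by lra.
have : ln (4 * m%:R : R) <= m%:R / 4 + 4 * ln 2 - 1.
  have -> : 4 * m%:R = 2 ^+ 4 * (1 + (m%:R / 4 - 1)) :> R by field.
  rewrite lnM ?posrE //; try by lra.
  rewrite lnXn // -mulr_natl.
  have := @le_ln1Dx R (m%:R / 4 - 1); lra.
by rewrite -[ln 2 *+ m]mulr_natl /lam; nra.
Qed.

Lemma count_dvd_le_lam (Q : seq nat) l : uniq Q -> {in Q, forall q, prime q} -> (0 < l)%N ->
  (count (fun q => q %| l)%N Q)%:R <= 2 * lam (l%:R : R).
Proof.
move=> uQ pQ l0; have := leq_exp2_size_primes_dvd uQ pQ l0.
set c := count _ _ => h; have /andP[l1 l2] := ln2_bounds.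
have : (2 : R) ^+ c <= jap (l%:R : R).
  by rewrite -natrX; apply: (@le_trans _ _ l%:R); rewrite ?ler_nat // /jap ger0_norm // lerDr.
rewrite -ler_ln ?posrE ?exprn_gt0 ?jap_gt0 // lnXn // -[ln 2 *+ c]mulr_natl /lam => h2.
have : (0 : R) <= c%:R by [].
by nra.
Qed.

(** Interpolating the coefficients at tau turns them into M (n q)^-tau with M = 2^m, up to a
    constant, hence into a function of the frequency l = n q alone. The double sum then runs over l,
    with multiplicity the number of primes of Q dividing l, and [gauge_peetre] moves the weight from
    l to xi. The normalisation by [size Q] costs a factor m, the two spare logarithms gain m^-2, and
    1 / m remains. *)
Lemma sum_wcoef_gauge_le tau C : 0 < tau -> tau < 1 / 2 -> 0 < C ->
  exists2 C' : R, 0 < C' & forall (m k : nat) (Q : seq nat) xi (N : nat),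
  (16 <= m)%N -> (0 < k)%N -> k%:R <= C * ((2 ^ m)%:R `^ (tau^-1 - 1)) -> uniq Q ->
  {in Q, forall q, [/\ prime q, (2 ^ m <= 4 * m * q)%N & (q <= 2 ^ m)%N]} ->
  (2 ^ m <= 4 * m * size Q)%N ->
  (size Q)%:R^-1 * (\sum_(q <- Q) \sum_(i < N) wcoef k i *
    ((jap (xi + i.+1%:R * q%:R))^-1 ^+ 2 + (jap (xi - i.+1%:R * q%:R))^-1 ^+ 2)) <=
  C' / m%:R * gauge tau xi.
Proof.
move=> t0 t1 C0; have [P P0 peetre] := gauge_peetre t0 t1.
pose B : R := 2 * (2 * C) `^ tau.
have B0 : 0 < B by rewrite mulr_gt0 // powR_gt0 // mulr_gt0.
exists (B * 4 * 128 * P * 32); first by do ?apply: mulr_gt0 => //.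
move=> m k Q xi N m16 k0 hk uQ hQ hs.
pose M : R := (2 ^ m)%:R.
have M1 : 1 <= M by rewrite ler1n expn_gt0.
have mR : (16 : R) <= m%:R by rewrite (ler_nat _ 16).
pose D (x : R) := (jap x)^-1 ^+ 2.
have D0 x : 0 <= D x by rewrite exprn_ge0 // invr_ge0 ltW // jap_gt0.
(* All multiples of the primes of Q satisfy the condition on l, so the cut loses nothing, and it
   makes [lam_lower] applicable. *)
pose f (l : nat) : R := if (2 ^ m <= 4 * m * l)%N then
  jap (l%:R : R) `^ (- tau) * (D (xi + l%:R) + D (xi - l%:R)) else 0.
have f0 l : 0 <= f l.
  by rewrite /f; case: ifP => // _; rewrite mulr_ge0 ?powR_ge0 // addr_ge0.
(* The size of k is such that (2k)^tau q^tau is at most a constant times M. *)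
have step1 q i : q \in Q -> wcoef k i * (D (xi + i.+1%:R * q%:R) + D (xi - i.+1%:R * q%:R)) <=
    B * M * f (i.+1 * q)%N.
  move=> /hQ[pq q1 q2]; have q0 := prime_gt0 pq.
  have -> : f (i.+1 * q)%N = jap ((i.+1 * q)%:R : R) `^ (- tau) *
     (D (xi + (i.+1 * q)%:R) + D (xi - (i.+1 * q)%:R)).
    by rewrite /f ifT //; apply: leq_trans q1 _; rewrite leq_mul2l leq_pmull ?orbT.
  rewrite natrM mulrA ler_wpM2r ?addr_ge0 //.
  apply: le_trans (wcoef_le_powR i k0 (tau := tau) _) _; first by lra.
  set n : R := i.+1%:R; have n1 : 1 <= n by rewrite ler1n.
  have qR : (1 : R) <= q%:R by rewrite ler1n.
  have qM : q%:R <= M by rewrite ler_nat.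
  have nq0 : 0 < n * q%:R by rewrite mulr_gt0; lra.
  have jnq : 0 < jap (n * q%:R) := jap_gt0 _.
  have k0R : (0 : R) < k%:R by rewrite ltr0n.
  have e1 : (2 * k%:R / n) `^ tau <= (2 * C * M `^ tau^-1 / (n * q%:R)) `^ tau.
    apply: ge0_ler_powR; rewrite ?nnegrE ?(ltW t0) //.
    - by rewrite divr_ge0 ?mulr_ge0 //; lra.
    - by rewrite divr_ge0 ?mulr_ge0 ?powR_ge0 //; lra.
    rewrite ler_pdivrMr; last by lra.
    have -> : 2 * C * M `^ tau^-1 / (n * q%:R) * n = 2 * C * M `^ tau^-1 / q%:R.
      by field; rewrite !gt_eqF //; lra.
    rewrite ler_pdivlMr; last by lra.
    have eM : M `^ tau^-1 = M `^ (tau^-1 - 1) * M.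
      by rewrite -{3}[M]powRr1 ?(le_trans _ M1) // -powRD_gt0 ?subrK //; lra.
    rewrite eM -!mulrA ler_wpM2l // mulrA; apply: ler_pM => //; lra.
  apply: le_trans e1 _.
  rewrite powRM ?invr_ge0 ?(ltW nq0) //; last by rewrite !mulr_ge0 ?powR_ge0 //; lra.
  rewrite powRM ?powR_ge0 //; last by rewrite mulr_ge0 //; lra.
  rewrite -powRrM mulVf ?gt_eqF // powRr1; last by lra.
  have -> : B * M * jap (n * q%:R) `^ (- tau) =
    (2 * C) `^ tau * M * (2 * jap (n * q%:R) `^ (- tau)) by rewrite /B; ring.
  rewrite ler_wpM2l ?mulr_ge0 ?powR_ge0 //.
  have -> : (n * q%:R)^-1 = 2 * (2 * (n * q%:R))^-1 by field; rewrite !gt_eqF //; lra.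
  rewrite powRM // ?invr_ge0; last by lra.
  apply: ler_pM; rewrite ?powR_ge0 //.
    rewrite -[leRHS]powRr1 // ler_powR //; lra.
  rewrite powRN -powR_inv1; last by lra.
  rewrite -powRrM mulN1r powRN lef_pV2 ?posrE ?powR_gt0 //; last by lra.
  apply: ge0_ler_powR; rewrite ?nnegrE ?(ltW t0) ?(ltW jnq) //; first by lra.
  by rewrite /n -natrM; apply: jap_nat_le; rewrite muln_gt0.
have step2 q : q \in Q -> \sum_(i < N) f (i.+1 * q)%N <=
    \sum_(l < (N * 2 ^ m).+1) (q %| l)%:R * f l.
  move=> /hQ[pq q1 q2]; have q0 := prime_gt0 pq.
  have h : forall l, 0 <= (q %| l)%:R * f l by move=> l; rewrite mulr_ge0.
  have := @sum_multiples_le (fun l => (q %| l)%:R * f l) q N q0 h.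
  under eq_bigr => i _ do rewrite dvdn_mull // mul1r.
  move=> /le_trans; apply.
  rewrite (@big_ord_widen _ _ _ _ (N * 2 ^ m).+1 (fun l => (q %| l)%:R * f l)); last by rewrite ltnS leq_mul2l q2 orbT.
  rewrite [leRHS](bigID (fun l : 'I__ => (l < (N * q).+1)%N)) /=.
  by rewrite lerDl sumr_ge0.
(* The divisor count is at most 2 lam l; since lam l >= m / 8, it is also at most 128 (lam l)^3 /
   m^2, which supplies the cube in [gauge]. *)
have step3 l : (\sum_(q <- Q) (q %| l)%:R) * f l <=
    128 / m%:R ^+ 2 * (P * gauge tau xi * (decay (- xi - l%:R) + decay (xi - l%:R))).
  rewrite /f; case: ifPn => hl; last first.
    rewrite mulr0 mulr_ge0 ?divr_ge0 ?exprn_ge0 //.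
    by rewrite mulr_ge0 ?addr_ge0 ?decay_ge0 // mulr_ge0 ?(ltW P0) ?(ltW (gauge_gt0 _ _)).
  have l0 : (0 < l)%N by rewrite lt0n; apply: contraL hl => /eqP ->; rewrite muln0 -ltnNge expn_gt0.
  have -> : \sum_(q <- Q) (q %| l)%:R = (count (fun q => q %| l)%N Q)%:R :> R.
    elim: (Q) => [|q s IH]; first by rewrite big_nil.
    by rewrite big_cons IH /= natrD.
  have c1 := @count_dvd_le_lam Q l uQ (fun q h => let: And3 pq _ _ := hQ q h in pq) l0.
  have c2 := lam_lower m16 hl.
  have g1 e : gauge tau (l%:R : R) * D (e * xi - l%:R) <=
      P * gauge tau (e * xi) * decay (e * xi - l%:R).
    rewrite -jap_inv2_decay [leRHS]mulrA; apply: ler_wpM2r; first exact: D0.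
    by rewrite -[jap (e * xi - _)]japN opprB; exact: peetre.
  have g2 := g1 1; have g3 := g1 (-1).
  rewrite mul1r in g2; rewrite mulN1r gaugeN in g3.
  have eD : D (xi + l%:R) = D (- xi - l%:R) by rewrite /D -opprD japN.
  rewrite eD mulrA.
  have c3 : (count (fun q => q %| l)%N Q)%:R * jap (l%:R : R) `^ (- tau) <=
     128 / m%:R ^+ 2 * gauge tau (l%:R : R).
    have h0 : 0 <= jap (l%:R : R) `^ (- tau) := powR_ge0 _ _.
    have -> : 128 / m%:R ^+ 2 * gauge tau (l%:R : R) =
      (128 / m%:R ^+ 2 * lam (l%:R : R) ^+ 3) * jap (l%:R : R) `^ (- tau).
      by rewrite /gauge; ring.
    rewrite ler_wpM2r //; apply: le_trans c1 _.
    rewrite mulrAC ler_pdivlMr ?exprn_gt0 //; last by lra.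
    have l1 := lam_ge1 (l%:R : R).
    have : (m%:R / 8) ^+ 2 <= lam (l%:R : R) ^+ 2.
      by apply: lerXn2r => //; rewrite nnegrE; lra.
    rewrite [_ ^+ 3]exprS; nra.
  apply: le_trans (ler_wpM2r (addr_ge0 (D0 _) (D0 _)) c3) _.
  rewrite -[leLHS]mulrA; apply: ler_wpM2l; first by rewrite divr_ge0 ?exprn_ge0.
  by rewrite !(mulrDr _ (_ (- xi - _))); apply: lerD.
have BM0 : 0 <= B * M by rewrite mulr_ge0 ?(ltW B0) //; lra.
apply: (@le_trans _ _ ((size Q)%:R^-1 * (B * M * (\sum_(l < (N * 2 ^ m).+1)
   128 / m%:R ^+ 2 * (P * gauge tau xi * (decay (- xi - l%:R) + decay (xi - l%:R))))))).
  rewrite ler_wpM2l ?invr_ge0 //.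
  apply: (@le_trans _ _ (\sum_(q <- Q) B * M * \sum_(l < (N * 2 ^ m).+1) (q %| l)%:R * f l)).
    rewrite !big_seq; apply: ler_sum => q qQ.
    apply: (@le_trans _ _ (\sum_(i < N) B * M * f (i.+1 * q)%N)).
      by apply: ler_sum => i _; exact: step1.
    by rewrite -[leLHS]mulr_sumr; apply: ler_wpM2l => //; exact: step2.
  rewrite -[leLHS]mulr_sumr; apply: ler_wpM2l => //.
  rewrite exchange_big /=; apply: ler_sum => l _; rewrite -mulr_suml; exact: step3.
rewrite -!mulr_sumr big_split /=.
have d1 := sum_decay_le (N * 2 ^ m).+1 xi; have d2 := sum_decay_le (N * 2 ^ m).+1 (- xi).
set S := _ + _; have S32 : S <= 32 by rewrite /S; lra.
have sQ : (0 : R) < (size Q)%:R.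
  rewrite ltr0n lt0n; apply: contraL hs => /eqP ->.
  by rewrite muln0 -ltnNge expn_gt0.
(* The window contains about M / m primes, so dividing the bound by their number costs a factor
   4m. *)
have sM : (size Q)%:R^-1 * M <= 4 * m%:R.
  by rewrite mulrC ler_pdivrMr // /M -!natrM ler_nat.
have g0 := gauge_gt0 tau xi.
apply: (@le_trans _ _ (B * (4 * m%:R) * (128 / m%:R ^+ 2 * (P * gauge tau xi * 32)))).
  rewrite [leLHS](_ : _ = B * ((size Q)%:R^-1 * M) *
     (128 / m%:R ^+ 2 * (P * gauge tau xi * S))); last by ring.
  apply: ler_pM.
  - by apply: mulr_ge0; [exact: ltW | apply: mulr_ge0; [rewrite invr_ge0 | lra]].
  - apply: mulr_ge0; first by rewrite divr_ge0 ?exprn_ge0.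
    apply: mulr_ge0; first by apply: mulr_ge0; exact: ltW.
    by apply: addr_ge0; apply: sumr_ge0 => i _; exact: decay_ge0.
  - by apply: ler_wpM2l => //; exact: ltW.
  - apply: ler_wpM2l; first by rewrite divr_ge0 ?exprn_ge0.
    by apply: ler_wpM2l => //; apply: mulr_ge0; exact: ltW.
rewrite le_eqVlt; apply/orP; left; apply/eqP; field; lra.
Qed.

End Sums.

(** * Averages of waves over primes *)

Section Average.
Context {R : realType}.
Implicit Types (f g rho : R -> R) (x xi p : R) (Q : seq nat).

Definition avgw Q (k : nat) (x : R) : R :=
  (size Q)%:R^-1 * \sum_(q <- Q) wave k (q%:R * x).

Lemma avgw_ge0 Q k x : 0 <= avgw Q k x.
Proof. by rewrite mulr_ge0 ?invr_ge0 // sumr_ge0 // => i _; exact: wave_ge0. Qed.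

Lemma avgw_lip Q k : (2 <= k)%N -> exists2 K : R, 0 <= K &
  forall x y, `|avgw Q k x - avgw Q k y| <= K * `|x - y|.
Proof.
move=> k2; exists ((size Q)%:R^-1 * \sum_(q <- Q) k%:R ^+ 2 * q%:R).
  by rewrite mulr_ge0 ?invr_ge0 // sumr_ge0.
move=> x y; rewrite /avgw -mulrBr -sumrB normrM ger0_norm ?invr_ge0 // -mulrA.
rewrite ler_wpM2l ?invr_ge0 // mulr_suml; apply: le_trans (ler_norm_sum _ _ _) _.
apply: ler_sum => q _; apply: le_trans (wave_lip _ _ _) _.
by rewrite -mulrBr normrM (ger0_norm (ler0n R q)) mulrA.
Qed.

Lemma avgw_le Q k x : (2 <= k)%N -> avgw Q k x <= k%:R.
Proof.
move=> k2; have [->|Q0] := eqVneq Q [::]; first by rewrite /avgw big_nil mulr0.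
rewrite /avgw ler_pdivrMl; last by rewrite ltr0n lt0n size_eq0.
apply: (@le_trans _ _ (\sum_(q <- Q) k%:R)).
  by apply: ler_sum => q _; exact: wave_le.
by rewrite big_const_seq count_predT iter_addr_0 mulr_natl.
Qed.

Lemma test_fun_sum_seq Q (F : nat -> R -> R) : (forall q, test_fun (F q)) ->
  test_fun (fun x => \sum_(q <- Q) F q x).
Proof.
move=> h; elim: Q => [|q Q IH].
  have -> : (fun x => \sum_(q <- [::]) F q x) = (fun=> 0).
    by apply/funext => x; rewrite big_nil.
  exact: test_fun0.
have -> : (fun x => \sum_(i <- q :: Q) F i x) = (fun x => F q x + \sum_(i <- Q) F i x).
  by apply/funext => x; rewrite big_cons.
exact: test_funD.
Qed.

Lemma tr_sum_seq Q (F : nat -> R -> R) xi p : (forall q, test_fun (F q)) ->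
  tr (fun x => \sum_(q <- Q) F q x) xi p = \sum_(q <- Q) tr (F q) xi p.
Proof.
move=> h; elim: Q => [|q Q IH].
  rewrite big_nil -[RHS](mul0r (tr (fun=> 0) xi p)) -trZ; last exact: test_fun0.
  by congr tr; apply/funext => x; rewrite big_nil mul0r.
rewrite big_cons -IH -trD //; last exact: test_fun_sum_seq.
by congr tr; apply/funext => x; rewrite big_cons.
Qed.

Lemma continuous_trig_poly (N : nat) (b : nat -> R) (q : R) :
  continuous (fun x : R => 1 + \sum_(i < N) b i * cs (i.+1%:R * (q * x))).
Proof.
move=> x; apply: cvgD; first exact: cvg_cst.
elim: N => [|N IH].
  under eq_fun do rewrite big_ord0; rewrite big_ord0; exact: cvg_cst.
under eq_fun do rewrite big_ord_recr /=; rewrite big_ord_recr /=.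
apply: cvgD; first exact: IH.
apply: cvgM; first exact: cvg_cst.
have := @continuous_cs_affine R (N.+1%:R * q) 0 x.
rewrite /continuous_at addr0 [x * _]mulrC -mulrA.
by under [X in X @ _ --> _ -> _]eq_fun => y do rewrite addr0 [y * _]mulrC -mulrA.
Qed.

(** The constant term 1 of each approximating polynomial reproduces [tr rho], and the other terms
    shift it by multiples of the primes. The bound B is required for every degree N because the
    degree grows as the approximation error e tends to 0. *)
Lemma tr_avgw_sub_le rho Q k xi p (B : R) (D : R -> R) : test_fun rho ->
  (forall x, 0 <= rho x) -> Q != [::] -> (2 <= k)%N ->
  (forall t p, `|tr rho t p| <= D t) ->
  (forall N, (size Q)%:R^-1 * (\sum_(q <- Q) \sum_(i < N) wcoef k i *
     (D (xi + i.+1%:R * q%:R) + D (xi - i.+1%:R * q%:R))) <= B) ->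
  `|tr (fun x => rho x * avgw Q k x) xi p - tr rho xi p| <= B.
Proof.
move=> tr0 r0 Q0 k2 hD hB.
have sQ : (0 : R) < (size Q)%:R by rewrite ltr0n lt0n size_eq0.
have m0 : 0 <= lint setT rho by apply: lint_ge0.
have [K K0 hK] := avgw_lip Q k2.
have ca : continuous (avgw Q k : R -> R) by apply: lip_continuous hK.
apply/ler_addgt0Pr => e e0.
(* Integrated against [rho], this pointwise accuracy gives an error at most e; the added 1 covers a
   density of mass zero. *)
have [N [b [hb happ]]] := @wave_trig_approx R k k2 (e / (1 + lint setT rho))
   ltac:(apply: divr_gt0; lra).
pose T (q : nat) x : R := 1 + \sum_(i < N) b i * cs (i.+1%:R * (q%:R * x)).
have cT q : continuous (T q) by exact: continuous_trig_poly.
have tT q : test_fun (fun x => rho x * T q x) by apply: test_funMc.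
pose G x := (size Q)%:R^-1 * \sum_(q <- Q) rho x * T q x.
have tG : test_fun G by apply: test_funZ; exact: test_fun_sum_seq.
have tA : test_fun (fun x => rho x * avgw Q k x) by apply: test_funMc.
have eG : tr G xi p = tr rho xi p + (size Q)%:R^-1 * \sum_(q <- Q) \sum_(i < N)
     b i / 2 * (tr rho (xi + i.+1%:R * q%:R) p + tr rho (xi - i.+1%:R * q%:R) p).
  rewrite /G trZ; last exact: test_fun_sum_seq.
  rewrite (@tr_sum_seq Q (fun q x => rho x * T q x)) //.
  under eq_bigr => q _ do rewrite (@tr_mul_trig_poly _ rho N b) //.
  rewrite big_split /= big_const_seq count_predT iter_addr_0 mulrDr -[tr rho xi p *+ _]mulr_natr.
  by rewrite mulrCA mulVf ?mulr1 // gt_eqF.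
have h1 : `|tr (fun x => rho x * avgw Q k x) xi p - tr G xi p| <= e.
  rewrite -trB //.
  have -> : e = e / (1 + lint setT rho) * (1 + lint setT rho) by field; lra.
  apply: (@le_trans _ _ (e / (1 + lint setT rho) * lint setT rho)); last first.
    by rewrite ler_wpM2l ?divr_ge0 //; lra.
  rewrite -lintZ //; apply: norm_tr_le.
  - by apply: test_funD => //; rewrite /= -[X in test_fun X]/(fun x => - G x);
      under [X in test_fun X]eq_fun do rewrite -mulN1r; exact: test_funZ.
  - exact: test_funZ.
  move=> x; have -> : G x = rho x * ((size Q)%:R^-1 * \sum_(q <- Q) T q x).
    by rewrite /G -mulr_sumr mulrCA.
  rewrite -mulrBr normrM (ger0_norm (r0 x)) mulrC.
  rewrite ler_wpM2r // /avgw -mulrBr -sumrB normrM ger0_norm ?invr_ge0 //.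
  rewrite ler_pdivrMl //; apply: le_trans (ler_norm_sum _ _ _) _.
  apply: (@le_trans _ _ (\sum_(q <- Q) e / (1 + lint setT rho))).
    by apply: ler_sum => q _; exact: happ.
  by rewrite big_const_seq count_predT iter_addr_0 mulr_natl.
have h2 : `|tr G xi p - tr rho xi p| <= B.
  apply: le_trans (hB N); rewrite eG addrC addKr normrM ger0_norm ?invr_ge0 //.
  rewrite ler_wpM2l ?invr_ge0 //; apply: le_trans (ler_norm_sum _ _ _) _.
  apply: ler_sum => q _; apply: le_trans (ler_norm_sum _ _ _) _.
  apply: ler_sum => i _; have /andP[b0 b1] := hb i (ltn_ord i).
  rewrite normrM ger0_norm ?divr_ge0 //; apply: ler_pM; rewrite ?divr_ge0 //.
    by rewrite /wcoef ler_wpM2r ?invr_ge0.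
  by apply: le_trans (ler_normD _ _) _; apply: lerD.
rewrite -(subrK (tr G xi p) (tr (fun x => rho x * avgw Q k x) xi p)) -addrA.
by apply: le_trans (ler_normD _ _) _; rewrite [leRHS]addrC; apply: lerD.
Qed.

End Average.

(** * Distribution function of a density times one wave *)

Section Intervals.
Context {R : realType}.
Implicit Types (f g rho : R -> R) (a b c x : R) (Q : seq nat) (k q n : nat).

Lemma distZ_near x (n : int) : `|x - n%:~R| <= 1 / 2 -> distZ x = `|x - n%:~R|.
Proof.
move=> h; apply/eqP; rewrite eq_le distZ_le /=; have [m ->] := distZ_ex x.
have [->//|mn] := eqVneq m n.
have : (1 : R) <= `|m%:~R - n%:~R|.
  by rewrite -intrB -intr_norm -[1]/(1%:~R) ler_int; lia.
have := ler_normD (m%:~R - x) (x - n%:~R); rewrite addrA subrK (distrC _ x); lra.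
Qed.

Lemma bump_wave k q (n : int) x : (2 <= k)%N -> (0 < q)%N ->
  distZ (q%:R * x) = `|q%:R * x - n%:~R| ->
  wave k (q%:R * x) = q%:R^-1 * bump (n%:~R / q%:R) (k%:R * q%:R)^-1 x.
Proof.
move=> k2 q0 h; have q0R : (q%:R : R) != 0 by rewrite pnatr_eq0 -lt0n.
have k0R : (k%:R : R) != 0 by rewrite pnatr_eq0 -lt0n; apply: leq_trans k2.
rewrite /wave /bump h invrK.
have -> : x - n%:~R / q%:R = (q%:R * x - n%:~R) / q%:R by field.
rewrite [q%:R^-1 * _]mulrA -[k%:R * q%:R]mulrC mulKf //.
rewrite normrM normfV (ger0_norm (ler0n _ _)); congr (_ * Num.max 0 (1 - _)).
by field.
Qed.

Lemma lint_itv_ge a b f (K : R) : a <= b -> test_fun f ->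
  (forall x, a < x <= b -> K <= f x) -> K * (b - a) <= lint `]a, b] f.
Proof.
move=> ab tf h.
have := @lint_itv_le R a b (fun x => - 1 * f x) (- K) ab (test_funZ _ tf).
rewrite lintZ //.
by move=> h2; have := h2 (fun x hx => ltac:(rewrite mulN1r lerN2; exact: h)); lra.
Qed.

Lemma lint_bump_itv_le a b c w : 0 < w -> w <= 1 -> 0 <= c <= 1 -> a <= b ->
  lint `]a, b] (bump c w) <= Num.min 1 (w^-1 * (b - a)).
Proof.
move=> w0 w1 c01 ab; have tb := test_fun_bump w0 w1 c01.
rewrite le_min; apply/andP; split.
  rewrite -(lint_bump w0 w1 c01); apply: lint_le_setT => //.
  by move=> x; exact: bump_ge0.
by apply: lint_itv_le => // x _; exact: bump_le.
Qed.

(** Projection onto the unit interval: for functions supported in it, arbitrary endpoints can be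
    replaced by clamped ones. *)
Definition clamp x : R := if x <= 0 then 0 else if x <= 1 then x else 1.

Lemma clamp_le a b : a <= b -> clamp a <= clamp b.
Proof.
by rewrite /clamp; case: (leP a 0); case: (leP a 1); case: (leP b 0); case: (leP b 1); lra.
Qed.

Lemma clamp_itv a : 0 <= clamp a <= 1.
Proof. by rewrite /clamp; case: (leP a 0); case: (leP a 1); lra. Qed.

Lemma clampB a b : a <= b -> clamp b - clamp a <= b - a.
Proof.
by rewrite /clamp; case: (leP a 0); case: (leP a 1); case: (leP b 0); case: (leP b 1); lra.
Qed.

Lemma lint_clamp f a b : (forall x, f x != 0 -> 0 < x <= 1) ->
  lint `]a, b] f = lint `]clamp a, clamp b] f.
Proof.
move=> sf; rewrite /lint Rintegral_mkcond [RHS]Rintegral_mkcond; congr Rintegral.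
apply/funext => x; rewrite !patchE; have [->|/sf hx] := eqVneq (f x) 0.
  by do 2 case: ifP.
suff -> : (x \in `]a, b]%classic) = (x \in `]clamp a, clamp b]%classic) by [].
apply/idP/idP; rewrite !inE /= !in_itv /= /clamp;
  case: (leP a 0); case: (leP a 1); case: (leP b 0); case: (leP b 1); lra.
Qed.

Section WaveCdf.
Variables (rho : R -> R) (B K : R) (k q : nat).
Hypotheses (tr0 : test_fun rho) (r0 : forall x, 0 <= rho x) (rB : forall x, rho x <= B)
  (rK : forall x y, `|rho x - rho y| <= K * `|x - y|)
  (k2 : (2 <= k)%N) (q0 : (0 < q)%N).

Let rw x := rho x * wave k (q%:R * x).
Let qp : (0 : R) < q%:R. Proof. by rewrite ltr0n. Qed.
Let q1 : (1 : R) <= q%:R. Proof. by rewrite ler1n. Qed.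
Let k2R : (2 : R) <= k%:R. Proof. by rewrite ler_nat. Qed.
Let kp : (0 : R) < k%:R. Proof. by rewrite ltr0n; apply: leq_trans k2. Qed.
Let qn : (q%:R : R) != 0. Proof. by rewrite gt_eqF. Qed.
Let B0 : 0 <= B. Proof. exact: le_trans (r0 0) (rB 0). Qed.
Let K0 : 0 <= K.
Proof. by have := le_trans (normr_ge0 _) (rK 1 0); rewrite subr0 normr1 mulr1. Qed.

Lemma test_fun_wave : test_fun rw.
Proof.
apply: test_funMc => //; apply: (@lip_continuous _ _ (k%:R ^+ 2 * q%:R)) => x y.
apply: le_trans (wave_lip _ _ _) _.
by rewrite -mulrBr normrM (ger0_norm (ltW qp)) mulrA.
Qed.

(** The cells are cut midway between consecutive fractions of denominator q, so each contains
    exactly one tooth, at n / q; those with n <= q cover the unit interval. *)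
Let cell (n : nat) : R := (n%:R - 1 / 2) / q%:R.
Let w : R := (k%:R * q%:R)^-1.
Let w0 : 0 < w. Proof. by rewrite invr_gt0 mulr_gt0. Qed.
Let wq : w <= q%:R^-1 / 2.
Proof.
by rewrite /w invfM mulrC ler_pM2l ?invr_gt0 // lef_pV2 ?posrE.
Qed.
Let iq1 : q%:R^-1 <= 1 :> R. Proof. by rewrite invf_le1. Qed.

Let w_le1 : w <= 1. Proof. by have := wq; have := iq1; lra. Qed.

Let cellS n : cell n.+1 = cell n + q%:R^-1.
Proof. by rewrite /cell -[n.+1%:R]natr1; field. Qed.

Let wave_on_cell n x : cell n < x <= cell n.+1 ->
  wave k (q%:R * x) = q%:R^-1 * bump (n%:R / q%:R) w x.
Proof.
rewrite /cell => /andP[]; rewrite ltr_pdivrMr // ler_pdivlMr // -[n.+1%:R]natr1 => h1 h2.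
rewrite (@bump_wave _ _ n) //; apply: distZ_near.
by rewrite ler_norml; apply/andP; split; rewrite /=; lra.
Qed.

Let node01 n : (n <= q)%N -> 0 <= (n%:R / q%:R : R) <= 1.
Proof.
by move=> nq; rewrite divr_ge0 //= ler_pdivrMr // mul1r ler_nat.
Qed.

Let cell_dist n x : cell n <= x <= cell n.+1 -> `|x - n%:R / q%:R| <= q%:R^-1 / 2.
Proof.
rewrite /cell -[n.+1%:R]natr1 => /andP[h1 h2]; rewrite ler_norml; apply/andP; split.
  by move: h1; rewrite mulrBl; lra.
by move: h2; rewrite mulrBl mulrDl; lra.
Qed.

(** No comparison is attempted on an incomplete cell: both integrals lie between 0 and B / q. *)
Let cell_piece n a b : (n <= q)%N -> cell n <= a -> a <= b -> b <= cell n.+1 ->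
  `|lint `]a, b] rw - lint `]a, b] rho| <= B / q%:R.
Proof.
move=> nq h1 ab h2.
have w1 := w_le1.
have tb := test_fun_bump w0 w1 (node01 nq).
have mI : measurable (`]a, b]%classic : set R) by exact: measurable_itv.
have e1 : lint `]a, b] rw <= B / q%:R.
  apply: (@le_trans _ _ (lint `]a, b] (fun x => B / q%:R * bump (n%:R / q%:R) w x))).
    apply: le_lint => //; [exact: test_fun_wave | exact: test_funZ |].
    move=> x; rewrite /= in_itv /= => /andP[ax xb].
    rewrite /rw (@wave_on_cell n); last lra.
    by rewrite mulrA ler_wpM2r ?bump_ge0 // ler_wpM2r ?invr_ge0 // ltW.
  rewrite lintZ // -[leRHS]mulr1 ler_wpM2l ?divr_ge0 ?(ltW qp) //.
  by have := lint_bump_itv_le w0 w1 (node01 nq) ab; rewrite le_min => /andP[].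
have e2 : lint `]a, b] rho <= B / q%:R.
  apply: le_trans (@lint_itv_le _ a b rho B ab tr0 (fun x _ => rB x)) _.
  by rewrite ler_wpM2l //; move: h2; rewrite cellS; lra.
have e3 : 0 <= lint `]a, b] rw.
  by apply: lint_ge0 => x _; rewrite mulr_ge0 // wave_ge0.
have e4 : 0 <= lint `]a, b] rho by apply: lint_ge0.
by rewrite ler_norml; lra.
Qed.

(** On a complete cell both integrals are rho (n / q) / q up to the oscillation of [rho]. The error
    is of order q^-2, which survives summation over about q cells. *)
Let cell_full n : (n <= q)%N ->
  `|lint `]cell n, cell n.+1] rw - lint `]cell n, cell n.+1] rho| <= K / q%:R ^+ 2.
Proof.
move=> nq; have w1 := w_le1.
have cc := node01 nq; set c := n%:R / q%:R in cc.
have tb := test_fun_bump w0 w1 cc.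
have ab : cell n <= cell n.+1 by rewrite cellS lerDl invr_ge0 ltW.
have mI : measurable (`]cell n, cell n.+1]%classic : set R) by exact: measurable_itv.
pose d : R := q%:R^-1 / 2; have d0 : 0 <= d by rewrite divr_ge0 ?invr_ge0 // ltW.
have near x : `|x - c| <= d -> `|rho x - rho c| <= K * d.
  by move=> h; apply: le_trans (rK _ _) _; rewrite ler_wpM2l.
have trb : test_fun (fun x => bump c w x * rho x) by apply: test_funMc => //; case: tr0.
have e1 : `|lint `]cell n, cell n.+1] rw - q%:R^-1 * rho c| <= q%:R^-1 * (K * d).
  have -> : lint `]cell n, cell n.+1] rw =
      q%:R^-1 * lint setT (fun x => bump c w x * rho x).
    rewrite (lint_setT (D := `]cell n, cell n.+1])); last first.
      move=> x; rewrite /= in_itv /= => h; have [->|/(bump_supp w0)] := eqVneq (bump c w x) 0.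
        by rewrite mul0r.
      rewrite ltr_norml => /andP[h1 h2]; exfalso; apply: h; rewrite cellS.
      have ec : cell n = c - d by rewrite /cell /c /d; field.
      have wd : w <= d := wq.
      have ed : q%:R^-1 = d + d by rewrite /d; field.
      by rewrite ec ed; clearbody d c w; apply/andP; split; lra.
    rewrite -lintZ //; apply: eq_lint => x; rewrite /= in_itv /= => hx.
    by rewrite /rw (wave_on_cell hx) -/c; ring.
  rewrite -mulrBr normrM ger0_norm ?invr_ge0 ?(ltW qp) // ler_wpM2l ?invr_ge0 ?(ltW qp) //.
  have -> : rho c = lint setT (fun x => rho c * bump c w x).
    by rewrite lintZ // lint_bump // mulr1.
  rewrite -lintB //; last exact: test_funZ.
  have -> : K * d = lint setT (fun x => K * d * bump c w x).
    by rewrite lintZ // lint_bump // mulr1.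
  apply: le_norm_lint => //; [|exact: test_funZ|].
    apply: test_funD => //; under [X in test_fun X]eq_fun do rewrite -mulN1r mulrA.
    exact: test_funZ.
  move=> x _; have [->|h] := eqVneq (bump c w x) 0.
    by rewrite mul0r !mulr0 subrr normr0.
  rewrite [rho c * _]mulrC -mulrBr normrM (ger0_norm (bump_ge0 _ _ w0)) mulrC.
  rewrite ler_wpM2r ?bump_ge0 // near //; exact: le_trans (ltW (bump_supp w0 h)) wq.
have e2 : `|lint `]cell n, cell n.+1] rho - q%:R^-1 * rho c| <= q%:R^-1 * (K * d).
  have hx x : cell n < x <= cell n.+1 -> rho c - K * d <= rho x <= rho c + K * d.
    move=> /andP[h1 h2]; have := near x (cell_dist _).
    by rewrite ler_norml => h; have := h ltac:(by rewrite (ltW h1)); lra.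
  have u1 := @lint_itv_le _ _ _ rho (rho c + K * d) ab tr0 (fun x h => let: conj _ r := andP (hx x h) in r).
  have u2 := @lint_itv_ge _ _ rho (rho c - K * d) ab tr0 (fun x h => let: conj l _ := andP (hx x h) in l).
  have ec : cell n.+1 - cell n = q%:R^-1 by rewrite cellS addrC addKr.
  rewrite ec in u1 u2.
  by rewrite ler_norml; lra.
have -> : K / q%:R ^+ 2 = q%:R^-1 * (K * d) + q%:R^-1 * (K * d) by rewrite /d; field.
by move: e1 e2; rewrite !ler_norml; lra.
Qed.

Let cell_le m n : (m <= n)%N -> cell m <= cell n.
Proof. by move=> mn; rewrite ler_wpM2r ?invr_ge0 ?(ltW qp) // lerB // ler_nat. Qed.

Let cdf_cells n : (n <= q.+1)%N ->
  `|lint `]cell 0, cell n] rw - lint `]cell 0, cell n] rho| <= n%:R * (K / q%:R ^+ 2).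
Proof.
elim: n => [|n IH] nq; first by rewrite set_itvoc0 /lint !Rintegral_set0 subrr normr0 mul0r.
have h1 := IH (ltnW nq); have h2 := cell_full nq.
rewrite !(@lint_itvU _ (cell 0) (cell n) (cell n.+1)) ?cell_le //; last exact: test_fun_wave.
by rewrite -[n.+1%:R]natr1; move: h1 h2; rewrite !ler_norml; lra.
Qed.

Let cdf_unit x : 0 <= x <= 1 ->
  `|lint `]cell 0, x] rw - lint `]cell 0, x] rho| <= (K + B) / q%:R.
Proof.
move=> /andP[x0 x1]; pose n := Num.truncn (q%:R * x + 1 / 2).
have hx0 : 0 <= q%:R * x + 1 / 2 by rewrite addr_ge0 // mulr_ge0 // ltW.
have /andP[n1 n2] := truncn_itv hx0; rewrite -/n in n1 n2.
have nq : (n <= q)%N.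
  rewrite -ltnS -(ltr_nat R); apply: le_lt_trans n1 _.
  by rewrite -[q.+1%:R]natr1; have : q%:R * x <= q%:R; [rewrite ler_piMr // ltW | lra].
have cx : cell n <= x by rewrite /cell ler_pdivrMr //; lra.
have xc : x <= cell n.+1 by rewrite /cell ler_pdivlMr //; lra.
have h1 := cdf_cells (leqW nq); have h2 := cell_piece nq (lexx _) cx xc.
rewrite !(@lint_itvU _ (cell 0) (cell n) x) ?cell_le //; last exact: test_fun_wave.
have h3 : n%:R * (K / q%:R ^+ 2) <= K / q%:R.
  have -> : K / q%:R = q%:R * (K / q%:R ^+ 2) by field.
  by rewrite ler_wpM2r ?divr_ge0 ?exprn_ge0 ?(ltW qp) // ler_nat.
rewrite mulrDl; move: h1 h2; rewrite !ler_norml; lra.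
Qed.

(** Complete cells contribute K / q in total and one incomplete cell B / q; the factor 2 comes from
    the two endpoints. *)
Lemma cdf_wave_le a b : (forall x, rho x != 0 -> 0 < x <= 1) -> a <= b ->
  `|lint `]a, b] rw - lint `]a, b] rho| <= 2 * (K + B) / q%:R.
Proof.
move=> sr ab; have sw x : rw x != 0 -> 0 < x <= 1.
  by move=> h; apply: sr; apply: contraNneq h => h; rewrite /rw h mul0r.
rewrite (lint_clamp _ _ sr) (lint_clamp _ _ sw).
have ca := clamp_itv a; have cb := clamp_itv b; have cab := clamp_le ab.
have c0 : cell 0 <= clamp a.
  by apply: le_trans (_ : 0 <= _); [rewrite /cell ler_pdivrMr //; lra | lra].
have h1 := cdf_unit ca; have h2 := cdf_unit cb; move: h2.
rewrite !(@lint_itvU _ (cell 0) (clamp a) (clamp b)) //; last exact: test_fun_wave.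
by rewrite -mulrA; move: h1; rewrite !ler_norml; lra.
Qed.

End WaveCdf.
End Intervals.

(** * Prime averages on intervals *)

Section AverageIntervals.
Context {R : realType}.
Implicit Types (f g rho : R -> R) (a b c x y M : R) (Q : seq nat) (k q n : nat).

Lemma lint_sum_seq (D : set R) Q (F : nat -> R -> R) : measurable D ->
  (forall q, test_fun (F q)) ->
  lint D (fun x => \sum_(q <- Q) F q x) = \sum_(q <- Q) lint D (F q).
Proof.
move=> mD h; elim: Q => [|q Q IH].
  rewrite big_nil -[RHS](mul0r (lint D (fun=> 0))) -lintZ //; last exact: test_fun0.
  by congr lint; apply/funext => x; rewrite big_nil mul0r.
rewrite big_cons -IH -lintD //; last exact: test_fun_sum_seq.
by congr lint; apply/funext => x; rewrite big_cons.
Qed.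

Lemma cdf_avgw_le rho B K k Q y a b : test_fun rho -> (forall x, 0 <= rho x) ->
  (forall x, rho x <= B) -> (forall x y, `|rho x - rho y| <= K * `|x - y|) ->
  (forall x, rho x != 0 -> 0 < x <= 1) -> (2 <= k)%N -> Q != [::] -> 0 < y ->
  {in Q, forall q, y <= q%:R} -> a <= b ->
  `|lint `]a, b] (fun x => rho x * avgw Q k x) - lint `]a, b] rho| <= 2 * (K + B) / y.
Proof.
move=> tr0 r0 rB rK sr k2 Q0 y0 yQ ab.
have mI : measurable (`]a, b]%classic : set R) by exact: measurable_itv.
have sQ : (0 : R) < (size Q)%:R by rewrite ltr0n lt0n size_eq0.
have KB : 0 <= K + B.
  apply: addr_ge0; last exact: le_trans (r0 0) (rB 0).
  by have := le_trans (normr_ge0 _) (rK 1 0); rewrite subr0 normr1 mulr1.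
pose F q x := rho x * wave k (q%:R * x).
have tF q : test_fun (F q).
  apply: test_funMc => //; apply: (@lip_continuous _ _ (k%:R ^+ 2 * q%:R)) => u v.
  apply: le_trans (wave_lip _ _ _) _.
  by rewrite -mulrBr normrM (ger0_norm (ler0n _ _)) mulrA.
have -> : lint `]a, b] (fun x => rho x * avgw Q k x) =
    (size Q)%:R^-1 * \sum_(q <- Q) lint `]a, b] (F q).
  rewrite -lint_sum_seq // -lintZ //; last exact: test_fun_sum_seq.
  by apply: eq_lint => x _; rewrite /avgw mulrCA mulr_sumr.
have -> : lint `]a, b] rho = (size Q)%:R^-1 * \sum_(q <- Q) lint `]a, b] rho.
  by rewrite big_const_seq count_predT iter_addr_0 -[lint _ _ *+ _]mulr_natl mulKf // gt_eqF.
rewrite -mulrBr -sumrB normrM ger0_norm ?invr_ge0 // ler_pdivrMl //.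
apply: le_trans (ler_norm_sum _ _ _) _.
apply: (@le_trans _ _ (\sum_(q <- Q) 2 * (K + B) / y)); last first.
  by rewrite big_const_seq count_predT iter_addr_0 [leRHS]mulr_natl.
rewrite !big_seq; apply: ler_sum => q qQ; have yq := yQ q qQ.
have q0 : (0 < q)%N by rewrite -(ltr0n R); lra.
apply: le_trans (cdf_wave_le tr0 r0 rB rK k2 q0 sr ab) _.
rewrite ler_wpM2l ?mulr_ge0 // lef_pV2 ?posrE //; lra.
Qed.

(** Two different fractions with denominators at most M are at least M^-2 apart. If they are equal,
    0 < n < q makes the first one reduced with prime denominator, which forces the denominators to
    agree. *)
Lemma prime_frac_separated q q0 (n n0 : int) M : prime q -> prime q0 ->
  q%:R <= M -> q0%:R <= M -> 0 < n -> n < q%:Z ->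
  `|n%:~R / q%:R - n0%:~R / q0%:R| < (M ^+ 2)^-1 -> q = q0 /\ n = n0.
Proof.
move=> pq pq0 qM qM0 np nq hd.
have qp : (0 : R) < q%:R by rewrite ltr0n prime_gt0.
have q0p : (0 : R) < q0%:R by rewrite ltr0n prime_gt0.
have M2 : 0 < M ^+ 2 by rewrite exprn_gt0 //; lra.
have hi : (n * q0%:Z = n0 * q%:Z).
  apply/eqP/negPn/negP => ne.
  have h1 : (1 : R) <= `|n%:~R * q0%:R - n0%:~R * q%:R|.
    have -> : n%:~R * q0%:R - n0%:~R * q%:R = (n * q0%:Z - n0 * q%:Z)%:~R :> R.
      by rewrite intrB !intrM.
    by rewrite -intr_norm -[1]/(1%:~R) ler_int -gtz0_ge1 normr_gt0 subr_eq0.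
  have h2 : n%:~R * q0%:R - n0%:~R * q%:R =
      (n%:~R / q%:R - n0%:~R / q0%:R) * (q%:R * q0%:R) :> R.
    by field; rewrite !gt_eqF.
  have h3 : q%:R * q0%:R <= M ^+ 2 by rewrite expr2; apply: ler_pM.
  have qq : (0 : R) < q%:R * q0%:R by rewrite mulr_gt0.
  move: h1; rewrite h2 normrM (gtr0_norm qq) => h1.
  have h4 : (M ^+ 2)^-1 * (q%:R * q0%:R) <= 1 by rewrite ler_pdivrMl ?mulr1.
  have : `|n%:~R / q%:R - n0%:~R / q0%:R| * (q%:R * q0%:R) <
     (M ^+ 2)^-1 * (q%:R * q0%:R) by rewrite ltr_pM2r.
  by move: h1 h4; clear; lra.
have eqq : q = q0.
  apply/eqP/negPn/negP => ne.
  have : (q %| `|n| * q0)%N.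
    have := congr1 absz hi; rewrite !abszM !absz_nat => ->; exact: dvdn_mull.
  rewrite Gauss_dvdl; last by rewrite prime_coprime // dvdn_prime2.
  by move=> /dvdn_leq; lia.
split=> //; apply: (@mulIf _ (q0%:Z)); first by have := prime_gt0 pq0; lia.
by rewrite hi eqq.
Qed.

(* A short interval meets at most one bump of the average. *)
Lemma lint_avgw_short rho B k Q y M a b a0 : test_fun rho -> (forall x, 0 <= rho x) ->
  (forall x, rho x <= B) -> (forall x, rho x != 0 -> a0 <= x <= 1 / 2) ->
  (2 <= k)%N -> uniq Q -> 0 < y -> 0 < a0 -> 1 <= M ->
  {in Q, forall q, [/\ prime q, y <= q%:R & q%:R <= M]} -> y <= (size Q)%:R ->
  2 / (k%:R * y) <= (2 * M ^+ 2)^-1 -> 1 / (k%:R * y) < a0 ->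
  a <= b -> b - a <= (2 * M ^+ 2)^-1 ->
  lint `]a, b] (fun x => rho x * avgw Q k x) <= B / y * Num.min y^-1 (k%:R * (b - a)).
Proof.
move=> tr0 r0 rB sr k2 uQ y0 a00 M1 hQ ysQ sep ka0 ab lab.
have B0 : 0 <= B := le_trans (r0 0) (rB 0).
have k0 : (0 : R) < k%:R by rewrite ltr0n; apply: leq_trans k2.
have sQ : (0 : R) < (size Q)%:R by lra.
have mI : measurable (`]a, b]%classic : set R) by exact: measurable_itv.
have [K _ hK] := @avgw_lip R Q k k2.
have ca : continuous (avgw Q k : R -> R) by apply: lip_continuous hK.
have tA : test_fun (fun x => rho x * avgw Q k x) by apply: test_funMc.
have rhs0 : 0 <= B / y * Num.min y^-1 (k%:R * (b - a)).
  rewrite mulr_ge0 ?divr_ge0 ?(ltW y0) // le_min invr_ge0 (ltW y0) /=.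
  by rewrite mulr_ge0 ?(ltW k0) // subr_ge0.
have [hz|[x0 [x0ab nz]]] : (forall x, a < x <= b -> rho x * avgw Q k x = 0) \/
    exists x, a < x <= b /\ rho x * avgw Q k x != 0.
- have [[x h]|h] := pselect (exists x, a < x <= b /\ rho x * avgw Q k x != 0).
    by right; exists x.
  left => x hx; apply/eqP; apply/negPn/negP => h2; apply: h; by exists x.
- rewrite (eq_lint (g := fun x => 0 * rho x)); last first.
    by move=> x; rewrite /= in_itv /= mul0r => /hz.
  by rewrite lintZ // mul0r.
(* The support of [rho] stays away from 0 and 1 by more than the radius of a tooth, so the numerator
   n lies strictly between 0 and q, as [prime_frac_separated] requires. *)
have wit x : rho x != 0 -> forall q, q \in Q -> wave k (q%:R * x) != 0 ->
    exists n : int, [/\ distZ (q%:R * x) = `|q%:R * x - n%:~R|,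
      `|x - n%:~R / q%:R| < 1 / (k%:R * y), 0 < n & n < q%:Z].
  move=> rx q qQ wx; have [pq yq qM] := hQ q qQ.
  have qp : (0 : R) < q%:R by lra.
  have [n hn] := distZ_ex (q%:R * x); exists n.
  have h1 : `|x - n%:~R / q%:R| < 1 / (k%:R * y).
    have -> : x - n%:~R / q%:R = (q%:R * x - n%:~R) / q%:R by field; rewrite gt_eqF.
    rewrite normrM normfV (ger0_norm (ltW qp)) -hn ltr_pdivrMr //.
    have := wave_supp wx; rewrite -ltr_pdivlMl // => h; apply: lt_le_trans h _.
    rewrite mulr1 mul1r invfM -mulrA ler_peMr ?invr_ge0 ?(ltW k0) //.
    by rewrite mulrC ler_pdivlMr // mul1r.
  have /andP[xa xb] := sr x rx.
  have h2 : 1 / (k%:R * y) < 1 / 2.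
    have : (2 * M ^+ 2)^-1 <= 1 / 2.
      have M2 : 1 <= M ^+ 2 by rewrite exprn_ege1.
      by rewrite div1r lef_pV2 ?posrE; move: M2; clear; lra.
    have : 2 / (k%:R * y) = 2 * (1 / (k%:R * y)) by field; rewrite !gt_eqF.
    have : 0 < 1 / (k%:R * y) by rewrite divr_gt0 ?mulr_gt0.
    lra.
  move: h1; rewrite ltr_norml => /andP[l1 l2]; split=> //.
  - by rewrite l1.
  - rewrite -(ltr_int R); have : 0 < n%:~R / q%:R :> R by lra.
    by rewrite pmulr_lgt0 // invr_gt0.
  - rewrite -(ltr_int R); have : n%:~R / q%:R < 1 :> R by lra.
    by rewrite ltr_pdivrMr // mul1r.
have [rx0 ax0] : rho x0 != 0 /\ avgw Q k x0 != 0.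
  by move: nz; rewrite mulf_eq0 negb_or => /andP.
have [q0 q0Q w0] : exists2 q, q \in Q & wave k (q%:R * x0) != 0.
  have /hasP[q qQ h] : has (fun q => wave k (q%:R * x0) != 0) Q.
    apply: contraT => /hasPn h; move: ax0; rewrite /avgw big_seq big1 ?mulr0 ?eqxx //.
    by move=> q /h /negPn/eqP.
  by exists q.
have [n0 [dn0 cn0 n0p n0q]] := wit x0 rx0 q0 q0Q w0.
have [pq0 yq0 qM0] := hQ q0 q0Q.
have q0p : (0 : R) < q0%:R by lra.
(* Two centres met by the interval differ by less than its length plus twice the tooth radius; each
   of these is at most half of the separation M^-2. *)
have uniq_frac x q (n : int) : a < x <= b -> q \in Q -> 0 < n -> n < q%:Z ->
    `|x - n%:~R / q%:R| < 1 / (k%:R * y) -> q = q0 /\ n = n0.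
  move=> xab qQ np nq cn; have [pq yq qM] := hQ q qQ.
  have qp : (0 : R) < q%:R by rewrite ltr0n prime_gt0.
  have hxx : `|x - x0| <= (2 * M ^+ 2)^-1.
    by move: xab x0ab lab; rewrite ler_norml; clear; lra.
  have hd : `|n%:~R / q%:R - n0%:~R / q0%:R| < (M ^+ 2)^-1 :> R.
    have e2 : (M ^+ 2)^-1 = (2 * M ^+ 2)^-1 + (2 * M ^+ 2)^-1.
      by field; rewrite gt_eqF //; apply: lt_le_trans M1.
    have e3 : 2 / (k%:R * y) = 1 / (k%:R * y) + 1 / (k%:R * y) by field; rewrite !gt_eqF.
    move: cn cn0 hxx sep; rewrite !ltr_norml !ler_norml e2 e3; clear; lra.
  exact: (prime_frac_separated pq pq0 qM qM0 np nq hd).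
have kq1 : (k%:R * q0%:R)^-1 <= 1 :> R.
  rewrite invf_le1 ?mulr_gt0 //.
  have : (1 : R) <= k%:R by rewrite ler1n; apply: leq_trans k2.
  have : (1 : R) <= q0%:R by rewrite ler1n prime_gt0.
  by clear; nra.
have kq0 : 0 < (k%:R * q0%:R)^-1 :> R by rewrite invr_gt0 mulr_gt0.
have c01 : 0 <= (n0%:~R / q0%:R : R) <= 1.
  rewrite divr_ge0 ?(ltW q0p) ?ler0z ?(ltW n0p) //= ler_pdivrMr // mul1r.
  by rewrite -[q0%:R]/(q0%:Z%:~R) ler_int ltW.
have tb := test_fun_bump kq0 kq1 c01.
apply: (@le_trans _ _ (lint `]a, b] (fun x => B / (size Q)%:R / q0%:R *
    bump (n0%:~R / q0%:R) (k%:R * q0%:R)^-1 x))).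
  apply: le_lint => //; first exact: test_funZ.
  move=> x; rewrite /= in_itv /= => xab.
  have [->|rx] := eqVneq (rho x) 0.
    by rewrite mul0r mulr_ge0 ?bump_ge0 ?divr_ge0 // ltW.
  have -> : avgw Q k x = (size Q)%:R^-1 * wave k (q0%:R * x).
    rewrite /avgw (bigD1_seq q0) //= big_seq_cond big1 ?addr0 //.
    move=> q /andP[qQ qq0]; apply/eqP/negPn/negP => wx.
    have [n [_ cn np nq]] := wit x rx q qQ wx.
    by have [e _] := uniq_frac x q n xab qQ np nq cn; rewrite e eqxx in qq0.
  have [->|wx] := eqVneq (wave k (q0%:R * x)) 0.
    by rewrite !mulr0 mulr_ge0 ?bump_ge0 ?divr_ge0 // ltW.
  have [n [dn cn np nq]] := wit x rx q0 q0Q wx.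
  have [_ en] := uniq_frac x q0 n xab q0Q np nq cn.
  rewrite (bump_wave k2 (prime_gt0 pq0) dn) en.
  have := bump_ge0 (n0%:~R / q0%:R) x kq0; move: (bump _ _ x) => v v0; rewrite !mulrA.
  apply: ler_wpM2r => //.
  apply: ler_wpM2r; first by rewrite invr_ge0 ltW.
  by apply: ler_wpM2r => //; rewrite invr_ge0 ltW.
rewrite lintZ //.
have h := lint_bump_itv_le kq0 kq1 c01 ab; rewrite invrK in h.
have hB : B / (size Q)%:R <= B / y by rewrite ler_wpM2l // lef_pV2 ?posrE.
apply: (@le_trans _ _ (B / (size Q)%:R * Num.min y^-1 (k%:R * (b - a)))); last first.
  rewrite ler_wpM2r // le_min invr_ge0 (ltW y0) /=.
  by rewrite mulr_ge0 ?(ltW k0) // subr_ge0.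
rewrite -[leLHS]mulrA; apply: ler_wpM2l; first by rewrite divr_ge0 ?(ltW sQ).
rewrite ler_pdivrMl //.
move: h; rewrite le_min => /andP[h1 h2].
have [hm|hm] := leP y^-1 (k%:R * (b - a)).
  by apply: le_trans h1 _; rewrite -ler_pdivrMr ?invr_gt0 // invrK mul1r.
by apply: le_trans h2 _; rewrite mulrCA mulrA.
Qed.

Lemma lint_split f a b h (c : R) : test_fun f -> (forall x, 0 <= f x) -> 0 < h ->
  (forall a, lint `]a, a + h] f <= c) -> a <= b ->
  lint `]a, b] f <= ((b - a) / h + 1) * c.
Proof.
move=> tf f0 h0 hc ab.
have c0 : 0 <= c by apply: le_trans (hc a); apply: lint_ge0.
have step n : lint `]a, a + n%:R * h] f <= n%:R * c.
  elim: n => [|n IH]; first by rewrite !mul0r addr0 set_itvoc0 /lint Rintegral_set0.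
  rewrite (@lint_itvU _ _ (a + n%:R * h)) //.
  - by rewrite -[n.+1%:R]natr1 !mulrDl !mul1r addrA; apply: lerD.
  - by rewrite lerDl mulr_ge0 // ltW.
  - by rewrite lerD2l ler_wpM2r ?(ltW h0) // ler_nat.
have ba : 0 <= (b - a) / h by rewrite divr_ge0 ?subr_ge0 // ltW.
have /andP[n1 n2] := truncn_itv ba; set n := Num.truncn _ in n1 n2.
have bn : b <= a + n.+1%:R * h.
  by rewrite -lerBlDl -ler_pdivrMr // ltW.
apply: le_trans (_ : _ <= lint `]a, a + n.+1%:R * h] f) _.
  rewrite (@lint_itvU _ a b (a + n.+1%:R * h)) // lerDl.
  by apply: lint_ge0.
by apply: le_trans (step _) _; rewrite ler_wpM2r // -natr1 lerD2r.
Qed.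

End AverageIntervals.

(** * One step of the construction *)

Section Step.
Context {R : realType}.
Implicit Types (f g rho : R -> R) (a b c x y : R) (Q : seq nat) (k q n m : nat).

Lemma cube_le_pow2 (eps A : R) : 0 < eps -> 0 < A -> exists m1 : nat,
  forall m, (m1 <= m)%N -> A * m%:R ^+ 3 <= (2 ^ m)%:R `^ eps.
Proof.
(* Half of eps absorbs m^3, at eps / 6 for each factor, and the other half absorbs the constant
   A. *)
move=> e0 A0; pose a := eps / 6; have a0 : 0 < a by rewrite divr_gt0.
pose X := A * (2 / a) ^+ 3 * 4 / eps.
exists (Num.truncn X).+1 => m hm.
have Xm : X <= m%:R.
  by apply: ltW; apply: lt_le_trans (truncnS_gt X) _; rewrite ler_nat.
pose M : R := (2 ^ m)%:R; have M1 : 1 <= M by rewrite ler1n expn_gt0.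
have /andP[l1 _] := @ln2_bounds R.
have lM : ln M = m%:R * ln 2 by rewrite /M natrX lnXn // mulr_natl.
have m0 : (0 : R) <= m%:R by [].
have h1 : m%:R <= 2 / a * M `^ a.
  have := ln_le_powR a0 M1; rewrite lM ler_pdivlMr // => h.
  rewrite mulrAC ler_pdivlMr //.
  have : m%:R * a * (1 / 2) <= m%:R * a * ln 2 by rewrite ler_wpM2l // mulr_ge0 // ltW.
  lra.
have h2 : A * (2 / a) ^+ 3 <= M `^ (eps / 2).
  have := @ln_le_powR R (eps / 2) M ltac:(lra) M1.
  rewrite lM ler_pdivlMr; last by lra.
  have : m%:R * (eps / 2) * (1 / 2) <= m%:R * (eps / 2) * ln 2.
    by rewrite ler_wpM2l // mulr_ge0 // ltW // divr_gt0.
  by move: Xm; rewrite /X ler_pdivrMr //; set Y := A * _ => Y1 Y2; lra.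
have h3 : m%:R ^+ 3 <= (2 / a) ^+ 3 * M `^ (eps / 2).
  have -> : M `^ (eps / 2) = (M `^ a) ^+ 3.
    by rewrite -powR_mulrn ?powR_ge0 // -powRrM; congr powR; rewrite /a; field.
  by rewrite -exprMn; apply: lerXn2r; rewrite ?nnegrE //; apply: le_trans h1.
have -> : M `^ eps = M `^ (eps / 2) * M `^ (eps / 2).
  by rewrite -powRD_gt0; [congr powR; field | lra].
apply: (@le_trans _ _ (A * ((2 / a) ^+ 3 * M `^ (eps / 2)))).
  by rewrite ler_wpM2l // ltW.
by rewrite mulrA ler_wpM2r ?powR_ge0.
Qed.

(* The decay of [tr rho] makes its convolution with the coefficients of a wave converge. *)
Definition density a0 rho : Prop :=
  [/\ forall x, 0 <= rho x,
      exists K, forall x y, `|rho x - rho y| <= K * `|x - y|,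
      forall x, rho x != 0 -> a0 <= x <= 1 / 2 &
      exists C, forall xi p, `|tr rho xi p| <= C * (jap xi)^-1 ^+ 2].

Definition frostman (s C : R) rho : Prop :=
  forall a b, a <= b -> lint `]a, b] rho <= C * (b - a) `^ s.

Lemma density_test_fun a0 rho : 0 < a0 -> density a0 rho -> test_fun rho.
Proof.
move=> a00 [_ [K hK] sr _]; split; first exact: lip_continuous hK.
by move=> x /sr; lra.
Qed.

(** The Lipschitz constant also bounds the density, which vanishes at 0 and lives in the unit
    interval. *)
Lemma density_bound a0 rho : 0 < a0 -> density a0 rho -> exists K : R,
  [/\ 0 <= K, forall x y, `|rho x - rho y| <= K * `|x - y| & forall x, rho x <= K].
Proof.
move=> a00 [r0 [K hK] sr _].
have K0 : 0 <= K by have := le_trans (normr_ge0 _) (hK 1 0); rewrite subr0 normr1 mulr1.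
exists K; split => // x; have [->//|h] := eqVneq (rho x) 0.
have z : rho 0 = 0 by apply/eqP/negPn/negP => /sr; lra.
have := hK x 0; rewrite z !subr0 ger0_norm // => h2; apply: le_trans h2 _.
by have := sr x h; move=> /andP[x0 x1]; rewrite ler_piMr // ger0_norm; lra.
Qed.

Lemma density_mul_avgw a0 rho Q k : 0 < a0 -> density a0 rho -> (2 <= k)%N -> Q != [::] ->
  {in Q, forall q, prime q} -> density a0 (fun x => rho x * avgw Q k x).
Proof.
move=> a00 hr k2 Q0 pQ; have tr0 := density_test_fun a00 hr.
have [B [B0 hB rB]] := density_bound a00 hr.
have [r0 _ sr [C hC]] := hr.
have [K K0 hK] := @avgw_lip R Q k k2.
have C0 : 0 <= C.
  have := le_trans (normr_ge0 _) (hC 0 0); rewrite pmulr_lge0 // exprn_gt0 // invr_gt0.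
  exact: jap_gt0.
split.
- by move=> x; rewrite mulr_ge0 // avgw_ge0.
- exists (B * k%:R + B * K) => x y.
  have -> : rho x * avgw Q k x - rho y * avgw Q k y =
    (rho x - rho y) * avgw Q k x + rho y * (avgw Q k x - avgw Q k y) by ring.
  apply: le_trans (ler_normD _ _) _; rewrite [leRHS]mulrDl; apply: lerD.
    rewrite normrM (ger0_norm (avgw_ge0 _ _ _)) [B * _ * _]mulrAC; apply: ler_pM => //.
      exact: avgw_ge0.
    exact: avgw_le.
  by rewrite normrM (ger0_norm (r0 y)) -mulrA; apply: ler_pM.
- by move=> x h; apply: sr; apply: contraNneq h => ->; rewrite mul0r.
have [E E0 hE] : exists2 E : R, 0 <= E & forall xi N, \sum_(q <- Q) \sum_(i < N) wcoef k i *
    ((jap (xi + i.+1%:R * q%:R))^-1 ^+ 2 + (jap (xi - i.+1%:R * q%:R))^-1 ^+ 2) <=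
    E * (jap xi)^-1 ^+ 2.
  elim: (Q) pQ => [|q s IH] pQ.
    by exists 0 => // xi N; rewrite big_nil mul0r.
  have [E E0 hE] := IH (fun (x : nat) h => pQ x (mem_behead (s := q :: s) h)).
  have [E' E'0 hE'] := @sum_wcoef_jap_le R k q (prime_gt0 (pQ q (mem_head _ _))).
  exists (E' + E); first by rewrite addr_ge0 // ltW.
  by move=> xi N; rewrite big_cons mulrDl; apply: lerD.
exists (C + (size Q)%:R^-1 * (C * E)) => xi p.
pose D t := C * (jap t)^-1 ^+ 2.
have := @tr_avgw_sub_le R rho Q k xi p ((size Q)%:R^-1 * (C * E) * (jap xi)^-1 ^+ 2) D
  tr0 r0 Q0 k2 hC.
have h : forall N : nat, (size Q)%:R^-1 * (\sum_(q <- Q) \sum_(i < N) wcoef k i *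
     (D (xi + i.+1%:R * q%:R) + D (xi - i.+1%:R * q%:R))) <=
  (size Q)%:R^-1 * (C * E) * (jap xi)^-1 ^+ 2.
  move=> N; rewrite -[leRHS]mulrA ler_wpM2l ?invr_ge0 // -[leRHS]mulrA.
  apply: le_trans (ler_wpM2l C0 (hE xi N)).
  rewrite mulr_sumr; apply: ler_sum => q _; rewrite mulr_sumr; apply: ler_sum => i _.
  by rewrite /D -mulrDr mulrCA.
move=> /(_ h) h1; have h2 := hC xi p.
rewrite mulrDl; move: h1 h2; rewrite !ler_norml; lra.
Qed.

Lemma powRV (u t : R) : 0 < u -> u^-1 `^ t = (u `^ t)^-1.
Proof. by move=> u0; rewrite -powR_inv1 ?(ltW u0) // -powRrM mulN1r powRN. Qed.

Lemma powR_le_self (c t : R) : 1 <= c -> 0 <= t <= 1 -> c `^ t <= c.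
Proof.
by move=> c1 /andP[_ t1]; rewrite -[leRHS]powRr1 ?ler_powR //; apply: le_trans c1.
Qed.

Lemma min_le_powR (u v s : R) : 0 < u -> 0 < v -> 0 <= s <= 1 ->
  Num.min u v <= u `^ (1 - s) * v `^ s.
Proof.
move=> u0 v0 /andP[s0 s1].
have key (z t : R) : 0 < z -> z = z `^ (1 - t) * z `^ t.
  by move=> z0; rewrite -powRD_gt0 // subrK powRr1 // ltW.
have [uv|uv] := leP u v.
  rewrite {1}(key u s u0) ler_wpM2l ?powR_ge0 //.
  by apply: ge0_ler_powR; rewrite ?nnegrE ?(ltW u0) ?(ltW v0).
rewrite {1}(key v s v0) ler_wpM2r ?powR_ge0 //.
by apply: ge0_ler_powR; rewrite ?nnegrE ?(ltW u0) ?(ltW v0) //; lra.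
Qed.

Lemma clamp_frostman rho s C : 0 < s -> 0 <= C -> (forall x, rho x != 0 -> 0 < x <= 1) ->
  (forall a b, 0 <= a -> a < b -> b <= 1 -> lint `]a, b] rho <= C * (b - a) `^ s) ->
  frostman s C rho.
Proof.
move=> s0 C0 sr h a b ab; rewrite (lint_clamp _ _ sr).
have ca := clamp_itv a; have cb := clamp_itv b; have cab := clamp_le ab.
have cd := clampB ab.
have [e|ne] := eqVneq (clamp a) (clamp b).
  by rewrite e set_itvoc0 /lint Rintegral_set0 mulr_ge0 ?powR_ge0.
have lt : clamp a < clamp b by rewrite lt_neqAle ne cab.
apply: le_trans (h _ _ _ lt _) _; try lra.
rewrite ler_wpM2l //; apply: ge0_ler_powR; rewrite ?nnegrE ?subr_ge0 //; exact: ltW.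
Qed.

(** The conditions serve in turn to make the teeth narrower than the separation of fractions, to
    push the primes above m0 and the numerators above 0, to treat long and intermediate intervals,
    to treat short intervals, and to make the transform error small. *)
Lemma step_params (alpha s a0 K delta A : R) (m0 : nat) :
  0 < alpha -> s < 1 -> s * (2 + alpha) < 2 -> 0 < a0 -> 0 < delta -> 0 <= K ->
  exists m : nat, [/\ (16 <= m)%N, 8 * m%:R ^+ 3 <= (2 ^ m)%:R `^ alpha,
    (4 * (m0%:R + 1) + 2 / a0) * m%:R ^+ 3 <= (2 ^ m)%:R :> R,
    (300 * K + 1) / delta * m%:R ^+ 3 <= (2 ^ m)%:R `^ (1 - s) &
    (48 * K + 1) / delta * m%:R ^+ 3 <= (2 ^ m)%:R `^ (2 - s * (2 + alpha)) /\
    A / m%:R <= delta].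
Proof.
move=> alpha0 s1 s2 a00 d0 K0.
have [n1 H1] := @cube_le_pow2 alpha 8 alpha0 ltac:(lra).
have B2 : 0 < 4 * (m0%:R + 1) + 2 / a0.
  by apply: ltr_wpDr; [rewrite divr_ge0 // ltW | rewrite mulr_gt0 // ltr_wpDl].
have [n2 H2] := @cube_le_pow2 1 _ ltr01 B2.
have [n3 H3] := @cube_le_pow2 (1 - s) ((300 * K + 1) / delta) ltac:(lra)
  ltac:(by apply: divr_gt0; lra).
have [n4 H4] := @cube_le_pow2 (2 - s * (2 + alpha)) ((48 * K + 1) / delta) ltac:(lra)
  ltac:(by apply: divr_gt0; lra).
set n5 := (Num.truncn (A / delta)).+1.
have [m [m16 [h1 h2] [h3 h4] h5]] : exists m, [/\ (16 <= m)%N, (n1 <= m)%N /\ (n2 <= m)%N,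
    (n3 <= m)%N /\ (n4 <= m)%N & (n5 <= m)%N].
  exists (16 + n1 + n2 + n3 + n4 + n5)%N; split; [|split|split|]; clear; lia.
exists m; split => //; [exact: H1| |exact: H3|split; first exact: H4].
  by rewrite -[leRHS]powRr1; [exact: H2 | exact: ler0n].
have mp : (0 : R) < m%:R by rewrite ltr0n; apply: leq_trans m16.
rewrite ler_pdivrMr // -ler_pdivrMl // mulrC; apply: ltW.
by apply: lt_le_trans (truncnS_gt _) _; rewrite ler_nat.
Qed.

(** Replacing M by the lower end y = M / (4m) of the window costs at most 4m in M^(1 - s), one of
    the three factors m in the hypothesis. *)
Lemma step_scale (s K delta M mR : R) : 0 < s < 1 -> 0 <= K -> 0 < delta -> 16 <= mR ->
  1 <= M -> 1 <= M / (4 * mR) -> (300 * K + 1) / delta * mR ^+ 3 <= M `^ (1 - s) ->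
  [/\ 300 * K * mR ^+ 2 <= delta * (4 * (M / (4 * mR)) `^ (1 - s)),
      4 * K / (M / (4 * mR)) <= delta * (M / (4 * mR))^-1 `^ s &
      (M / (4 * mR))^-1 `^ s <= 1].
Proof.
move=> /andP[s0 s1] K0 d0 mR16 M1; set y := M / (4 * mR) => y1 H3.
have y0 : 0 < y by lra.
have ys : 300 * K * mR ^+ 2 <= delta * (4 * y `^ (1 - s)).
  have : M `^ (1 - s) <= 4 * mR * y `^ (1 - s).
    have -> : M `^ (1 - s) = (4 * mR) `^ (1 - s) * y `^ (1 - s).
      by rewrite -powRM ?(ltW y0) //; [congr powR; rewrite /y; field; lra | lra].
    rewrite ler_wpM2r ?powR_ge0 // -[leRHS]powRr1; last by lra.
    by rewrite ler_powR //; lra.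
  move=> h; have := le_trans H3 h.
  rewrite mulrAC ler_pdivrMr // => h2.
  have h3 : (300 * K + 1) * mR ^+ 2 * mR <= delta * (4 * y `^ (1 - s)) * mR.
    rewrite -mulrA -exprSr; apply: le_trans h2 _.
    by rewrite le_eqVlt; apply/orP; left; apply/eqP; ring.
  rewrite ler_pM2r in h3; last by lra.
  by apply: le_trans h3; rewrite [leRHS]mulrDl mul1r lerDl sqr_ge0.
have yv : y `^ (1 - s) / y = (y^-1) `^ s.
  by rewrite -powR_inv1 ?(ltW y0) // -powRrM mulN1r -powRD_gt0 //; congr powR; ring.
split => //; last by rewrite -(powRr0 y^-1) ger_powR ?invr_gt0 ?y0 ?invf_le1 //; lra.
rewrite -yv mulrA ler_wpM2r ?invr_ge0 ?(ltW y0) //.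
have h1 : 256 <= mR ^+ 2.
  by move: mR16; clear; nra.
have : K * 256 <= K * mR ^+ 2 by rewrite ler_wpM2l.
move: ys K0; have -> : delta * (4 * y `^ (1 - s)) = 4 * (delta * y `^ (1 - s)) by ring.
have -> : 300 * K * mR ^+ 2 = 300 * (K * mR ^+ 2) by ring.
move: (K * mR ^+ 2) (delta * y `^ (1 - s)) => u v; clear; lra.
Qed.

(** The tooth radius and the displacement of x each contribute at most 1/k to the error in q x,
    whence the condition 2 M^(1 + alpha) <= k. Allowing a displacement is needed because the closed
    support of the limit is only approached by the supports of the densities. *)
Lemma avgw_supp_near (alpha M : R) k Q (x x' : R) : 0 < alpha -> 1 <= M -> (2 <= k)%N ->
  2 * M `^ (1 + alpha) <= k%:R -> {in Q, forall q, prime q /\ q%:R <= M} ->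
  `|x - x'| <= (k%:R * M)^-1 -> avgw Q k x' != 0 ->
  exists (q : nat) (r : int), q \in Q /\
    `|x - r%:~R / q%:R| <= q%:R `^ (- (2 + alpha)).
Proof.
move=> alpha0 M1 k2 k2R hQ xx nz.
have M0 : 0 < M by lra.
have Ma : 0 < M `^ (1 + alpha) by rewrite powR_gt0.
have kp : (0 : R) < k%:R by lra.
have [q qQ wq] : exists2 q, q \in Q & wave k (q%:R * x') != 0.
  have /hasP[q qQ h] : has (fun q => wave k (q%:R * x') != 0) Q.
    apply: contraNT nz => /hasPn h; rewrite /avgw big_seq big1 ?mulr0 ?eqxx //.
    by move=> q /h /negPn/eqP.
  by exists q.
have [pq qM] := hQ q qQ; have qp : (0 : R) < q%:R by rewrite ltr0n prime_gt0.
have [r hd] := distZ_ex (q%:R * x'); exists q, r; split => //.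
have -> : x - r%:~R / q%:R = ((q%:R * x' - r%:~R) + q%:R * (x - x')) / q%:R.
  by field; rewrite gt_eqF.
rewrite normrM normfV (ger0_norm (ltW qp)) ler_pdivrMr //.
have -> : q%:R `^ (- (2 + alpha)) * q%:R = q%:R `^ (- (1 + alpha)) :> R.
  by rewrite -[X in _ * X](powRr1 (ltW qp)) -powRD_gt0 //; congr powR; ring.
apply: (@le_trans _ _ (2 / k%:R)).
  apply: le_trans (ler_normD _ _) _.
  have w1 := wave_supp wq; rewrite hd in w1.
  have h1 : `|q%:R * x' - r%:~R| <= k%:R^-1 by rewrite -[leRHS]mulr1 ler_pdivlMl // ltW.
  have h2 : `|q%:R * (x - x')| <= k%:R^-1.
    rewrite normrM (ger0_norm (ltW qp)).
    apply: (@le_trans _ _ (M * (k%:R * M)^-1)).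
      by apply: ler_pM => //; exact: ltW.
    by rewrite le_eqVlt; apply/orP; left; apply/eqP; field; rewrite !gt_eqF.
  by move: h1 h2; clear; lra.
apply: (@le_trans _ _ (M `^ (- (1 + alpha)))).
  by rewrite powRN ler_pdivrMr // ler_pdivlMl // mulrC.
rewrite !powRN lef_pV2 ?posrE ?powR_gt0 //.
by apply: ge0_ler_powR; rewrite ?nnegrE ?(ltW qp) ?(ltW M0) //; lra.
Qed.

(* Three ranges of lengths: for [b - a >= 1/y] closeness of the distribution functions
   suffices; for [b - a <= 1/(2M^2)] the interval meets only one tooth of each wave, which is
   [lint_avgw_short]; in between the interval is split into pieces of length [1/(2M^2)]. *)
Lemma frostman_avgw (alpha s a0 delta K C M mR : R) rho k Q :
  0 < alpha -> 0 < s < 1 -> 0 < a0 -> density a0 rho -> 0 < delta ->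
  0 <= K -> (forall x, rho x <= K) -> 16 <= mR -> 1 <= M -> 1 <= M / (4 * mR) ->
  (2 <= k)%N -> 2 * M `^ (1 + alpha) <= k%:R -> k%:R <= 3 * M `^ (1 + alpha) ->
  8 * mR ^+ 3 <= M `^ alpha -> 2 / a0 <= M ->
  (300 * K + 1) / delta * mR ^+ 3 <= M `^ (1 - s) ->
  (48 * K + 1) / delta * mR ^+ 3 <= M `^ (2 - s * (2 + alpha)) ->
  uniq Q -> {in Q, forall q, [/\ prime q, M / (4 * mR) <= q%:R & q%:R <= M]} ->
  M / (4 * mR) <= (size Q)%:R ->
  (forall a b, a <= b -> `|lint `]a, b] (fun x => rho x * avgw Q k x) - lint `]a, b] rho|
    <= 4 * K / (M / (4 * mR))) ->
  0 <= C -> frostman s C rho -> frostman s (C + delta) (fun x => rho x * avgw Q k x).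
Proof.
move=> alpha0 s01 a00 hr d0 K0 rB mR16 M1; move: (s01) => /andP[s0 s1].
set y := M / (4 * mR) => y1 k2 k2R k3R H1 H2 H3 H4 uQ hQ' ysQ cdf C0 fr.
have [ys cdf_delta ys1] := step_scale s01 K0 d0 mR16 M1 y1 H3.
rewrite -/y in ys cdf_delta ys1.
have y0 : 0 < y by lra.
have M0 : 0 < M by lra.
have tr0 := density_test_fun a00 hr.
have [r0 _ sr _] := hr.
have Q0 : Q != [::].
  by apply: contraTneq ysQ => ->; rewrite -ltNge; apply: lt_le_trans y1.
have pQ : {in Q, forall q, prime q} by move=> q /hQ'[].
have hr' := density_mul_avgw a00 hr k2 Q0 pQ.
have tr' := density_test_fun a00 hr'.
have kp : (0 : R) < k%:R by rewrite ltr0n; apply: leq_trans k2.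
have M2 : 0 < M ^+ 2 by rewrite exprn_gt0.
have ky0 : 0 < k%:R * y by exact: mulr_gt0.
(* A tooth has radius at most 1 / (k y); here M^alpha beats the power of m lost in y. *)
have ky : 2 / (k%:R * y) <= (2 * M ^+ 2)^-1.
  have Ma : M `^ (1 + alpha) = M * M `^ alpha.
    by rewrite powRD_gt0 // powRr1 // ltW.
  rewrite ler_pdivrMr // ler_pdivlMl ?mulr_gt0 //.
  apply: (@le_trans _ _ (2 * M `^ (1 + alpha) * y)); last by rewrite ler_wpM2r // ltW.
  rewrite Ma /y [leRHS]mulrA ler_pdivlMr; last by lra.
  have -> : 2 * (M * M `^ alpha) * M = 2 * M ^+ 2 * M `^ alpha by ring.
  have -> : 2 * M ^+ 2 * 2 * (4 * mR) = 2 * M ^+ 2 * (8 * mR) by ring.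
  apply: ler_wpM2l; first by rewrite mulr_ge0 // ltW.
  apply: le_trans (_ : _ <= 8 * mR ^+ 3) H1.
  rewrite ler_wpM2l // [leRHS]exprS ler_peMr //; first by lra.
  by rewrite exprn_ege1 //; lra.
have ka0 : 1 / (k%:R * y) < a0.
  have e : 1 / (k%:R * y) = 2 / (k%:R * y) / 2 by field; rewrite !gt_eqF.
  have h2 : (2 * M ^+ 2)^-1 <= a0.
    rewrite -[a0]invrK lef_pV2 ?posrE ?invr_gt0 ?mulr_gt0 //.
    have : M * 1 <= M * M by rewrite ler_wpM2l // ltW.
    have : 0 < a0^-1 by rewrite invr_gt0.
    by rewrite expr2 => vp MM; move: (M * M) (a0^-1) M0 MM H2 vp; clear; move=> u v; lra.
  rewrite e ltr_pdivrMr //; move: ky h2 a00; clear; set u := 2 / _; set v := _^-1; lra.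
have short c d : c <= d -> d - c <= (2 * M ^+ 2)^-1 ->
    lint `]c, d] (fun x => rho x * avgw Q k x) <= K / y * Num.min y^-1 (k%:R * (d - c)).
  move=> cd hcd; exact: (lint_avgw_short tr0 r0 rB sr k2 uQ y0 a00 M1 hQ' ysQ ky ka0).
have Kyp : 0 <= K / y by rewrite divr_ge0 // ltW.
apply: clamp_frostman => //; first by rewrite addr_ge0 // ltW.
  move=> x h; have : rho x != 0 by apply: contraNneq h => ->; rewrite mul0r.
  by move=> /sr; move: a00; clear; lra.
move=> a b a_0 ab b1; set l := b - a.
have l0 : 0 < l by rewrite subr_gt0.
have l1 : l <= 1 by move: a_0 b1; rewrite /l; clear; lra.
have ls0 : 0 < l `^ s by rewrite powR_gt0.
have iy : 0 < y^-1 by rewrite invr_gt0.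
rewrite mulrDl.
have Cl : 0 <= C * l `^ s by rewrite mulr_ge0 // ltW.
have [ly|ly] := leP y^-1 l.
  have := cdf a b (ltW ab); have := fr a b (ltW ab); rewrite -/l ler_norml.
  have : delta * (y^-1) `^ s <= delta * l `^ s.
    rewrite ler_wpM2l ?(ltW d0) //.
    by apply: ge0_ler_powR; rewrite ?nnegrE ?(ltW s0) ?(ltW iy) ?(ltW l0).
  by move: cdf_delta; clear; lra.
apply: le_trans (_ : _ <= delta * l `^ s) _; last by rewrite lerDr.
have [lM|lM] := leP l (2 * M ^+ 2)^-1.
  apply: le_trans (short a b (ltW ab) lM) _; rewrite -/l.
  have kl0 : 0 < k%:R * l by rewrite mulr_gt0.
  have s01' : 0 <= s <= 1 by rewrite !ltW.
  have := min_le_powR iy kl0 s01'.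
  have h1 : (y^-1) `^ (1 - s) <= 4 * mR * M `^ (s - 1).
    have -> : y^-1 = 4 * mR * M^-1 by rewrite /y invfM invrK mulrC.
    rewrite powRM ?invr_ge0 ?(ltW M0) //; last by move: mR16; clear; lra.
    apply: ler_pM; rewrite ?powR_ge0 //.
      by apply: powR_le_self; [move: mR16; clear; lra | rewrite subr_ge0 gerDl oppr_le0 !ltW].
    by rewrite -powR_inv1 ?(ltW M0) // -powRrM mulN1r opprB.
  have h2 : (k%:R * l) `^ s <= 3 * M `^ ((1 + alpha) * s) * l `^ s.
    rewrite powRM ?(ltW l0) // ler_wpM2r ?(ltW ls0) //.
    apply: (@le_trans _ _ ((3 * M `^ (1 + alpha)) `^ s)).
      by apply: ge0_ler_powR; rewrite ?nnegrE ?mulr_ge0 ?powR_ge0 ?(ltW s0) // ltW.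
    rewrite powRM ?powR_ge0 // -powRrM ler_wpM2r ?powR_ge0 //.
    by apply: powR_le_self => //; clear; lra.
  have h3 := ler_pM (powR_ge0 _ _) (powR_ge0 _ _) h1 h2.
  move=> /le_trans /(_ h3) h4.
  apply: le_trans (ler_wpM2l Kyp h4) _.
  have -> : K / y * (4 * mR * M `^ (s - 1) * (3 * M `^ ((1 + alpha) * s) * l `^ s)) =
      48 * K * mR ^+ 2 * (M `^ (s - 1) * M `^ ((1 + alpha) * s) / M) * l `^ s.
    by rewrite /y; field; rewrite !gt_eqF //; lra.
  rewrite ler_wpM2r ?(ltW ls0) //.
  (* The exponents add up to s (2 + alpha) - 2, negative by assumption; this is the place where the
     Frostman exponent must stay below 2 / (2 + alpha). *)
  have -> : M `^ (s - 1) * M `^ ((1 + alpha) * s) / M = (M `^ (2 - s * (2 + alpha)))^-1.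
    rewrite -powRN -[in X in _ / X](powRr1 (ltW M0)) -powRN -!powRD_gt0 //.
    by congr powR; ring.
  have Me : 0 < M `^ (2 - s * (2 + alpha)) by rewrite powR_gt0.
  rewrite ler_pdivrMr //; move: H4; rewrite mulrAC ler_pdivrMr // [leRHS]mulrC => h5.
  apply: le_trans h5; have K48 : 0 <= 48 * K by rewrite mulr_ge0.
  apply: ler_pM => //; [exact: sqr_ge0 | by rewrite lerDl |].
  by rewrite [leRHS]exprSr ler_peMr ?sqr_ge0 //; move: mR16; clear; lra.
(* At intermediate lengths l the number of pieces is at most 2 l / h, which gives a mass linear in
   l; since l < 1 / y, the surplus power l^(1 - s) supplies the small factor. *)
pose h := (2 * M ^+ 2)^-1.
have h0 : 0 < h by rewrite invr_gt0 mulr_gt0.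
have r'0 x : 0 <= rho x * avgw Q k x by case: hr'.
have hc c : lint `]c, c + h] (fun x => rho x * avgw Q k x) <= K / y * y^-1.
  have ch : c + h - c = h by rewrite addrC addKr.
  apply: le_trans (short c (c + h) _ _) _; rewrite ?lerDl ?ch ?(ltW h0) //.
  by rewrite ler_wpM2l // ge_min lexx.
apply: le_trans (lint_split tr' r'0 h0 hc (ltW ab)) _; rewrite -/l.
have lh : 1 <= l / h by rewrite ler_pdivlMr // mul1r ltW.
have -> : K / y * y^-1 = K * 16 * mR ^+ 2 / M ^+ 2.
  by rewrite /y; field; rewrite !gt_eqF //; lra.
have -> : l `^ s = l / l `^ (1 - s).
  by rewrite -[X in X / _](powRr1 (ltW l0)) -powRN -powRD_gt0 //; congr powR; ring.
have Km : 0 <= 64 * K * mR ^+ 2 by apply: mulr_ge0; [apply: mulr_ge0 | exact: sqr_ge0].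
apply: (@le_trans _ _ (64 * K * mR ^+ 2 * l)).
  apply: (@le_trans _ _ (2 * (l / h) * (K * 16 * mR ^+ 2 / M ^+ 2))).
    rewrite ler_wpM2r; [by []| |by move: lh; clear; lra].
    by apply: divr_ge0; [apply: mulr_ge0; [apply: mulr_ge0 | exact: sqr_ge0] | exact: ltW].
  by rewrite le_eqVlt; apply/orP; left; apply/eqP; rewrite /h; field; rewrite gt_eqF.
rewrite [leRHS]mulrA ler_pdivlMr ?powR_gt0 //.
have yp : 0 < y `^ (1 - s) by rewrite powR_gt0.
have hl : l `^ (1 - s) <= (y `^ (1 - s))^-1.
  by rewrite -powRV //; apply: ge0_ler_powR; rewrite ?nnegrE; [rewrite subr_ge0| | |]; exact: ltW.
rewrite mulrAC; apply: ler_wpM2r; first exact: ltW.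
apply: (@le_trans _ _ (64 * K * mR ^+ 2 / y `^ (1 - s))); first by rewrite ler_wpM2l.
rewrite ler_pdivrMr //; move: ys Km; have -> : 300 * K * mR ^+ 2 = 300 * (K * mR ^+ 2) by ring.
have -> : 64 * K * mR ^+ 2 = 64 * (K * mR ^+ 2) by ring.
have -> : delta * (4 * y `^ (1 - s)) = 4 * (delta * y `^ (1 - s)) by ring.
by move: (K * mR ^+ 2) (delta * _); clear; move=> u v; lra.
Qed.

(** The constants K and Cr of the given density are fixed before the scale m, so however bad they
    are the errors become as small as wanted. The last clause holds on a whole neighbourhood of the
    new support so that it passes to the limit. *)
Lemma density_step (alpha s : R) a0 rho (delta : R) (m0 : nat) :
  0 < alpha -> 0 < s -> s * (2 + alpha) < 2 -> 0 < a0 -> density a0 rho -> 0 < delta ->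
  exists rho', [/\ density a0 rho', forall x, rho' x != 0 -> rho x != 0,
    forall xi p, `|tr rho' xi p - tr rho xi p| <= delta * gauge (1 / (2 + alpha)) xi,
    (forall a b, a <= b -> `|lint `]a, b] rho' - lint `]a, b] rho| <= delta) /\
    (forall C, 0 <= C -> frostman s C rho -> frostman s (C + delta) rho') &
    exists2 h : R, 0 < h & forall x x', `|x - x'| <= h -> rho' x' != 0 ->
      exists (q : nat) (r : int), [/\ (m0 <= q)%N, (0 < q)%N &
        `|x - r%:~R / q%:R| <= q%:R `^ (- (2 + alpha))]].
Proof.
move=> alpha0 s0 s2 a00 hr d0; pose tau : R := 1 / (2 + alpha).
have t0 : 0 < tau by apply: divr_gt0; lra.
have t1 : tau < 1 / 2 by rewrite ltr_pdivrMr; lra.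
have ti : tau^-1 - 1 = 1 + alpha by rewrite /tau; field; lra.
have s1 : s < 1 by nra.
have [K [K0 rK rB]] := density_bound a00 hr.
have tr0 := density_test_fun a00 hr.
have [r0 _ sr [Cr hCr]] := hr.
have Cr0 : 0 <= Cr.
  have := le_trans (normr_ge0 _) (hCr 0 0); rewrite pmulr_lge0 // exprn_gt0 // invr_gt0.
  exact: jap_gt0.
have sr1 x : rho x != 0 -> 0 < x <= 1 by move=> /sr; lra.
have [C' C'0 hC'] := @sum_wcoef_gauge_le R tau 3 t0 t1 ltac:(lra).
have [m [m16 H1 H2 H3 [H4 H5]]] :=
  step_params (C' * Cr) m0 alpha0 s1 s2 a00 d0 K0.
pose M : R := (2 ^ m)%:R; pose mR : R := m%:R; rewrite -/M -/mR in H1 H2 H3 H4 H5.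
have mR16 : 16 <= mR by rewrite (ler_nat _ 16).
have M1 : 1 <= M by rewrite ler1n expn_gt0.
have M0 : 0 < M by lra.
have m0R : (0 : R) <= m0%:R by [].
have ia0 : 0 < 2 / a0 by rewrite divr_gt0.
have m3 : mR <= mR ^+ 3.
  by have : 1 <= mR ^+ 2; [rewrite exprn_ege1 //; lra | rewrite [_ ^+ 3]exprS; nra].
have m13 : 0 <= mR ^+ 3 by lra.
pose y := M / (4 * mR).
have y1 : m0%:R + 1 <= y.
  rewrite ler_pdivlMr; last by lra.
  by apply: le_trans H2; nra.
have y0 : 0 < y by lra.
have [Q [uQ hQ hs]] := @primes_window m (leq_trans (isT : 1 < 16)%N m16).
have Ma1 : 1 <= M `^ (1 + alpha) by rewrite -[leLHS](powRr0 M) ler_powR // addr_ge0 // ltW.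
(* The lower bound gives the approximation exponent in [avgw_supp_near]; the upper bound is the
   hypothesis of [sum_wcoef_gauge_le] with the constant 3. *)
have [k k2R k3R] : exists2 k : nat, 2 * M `^ (1 + alpha) <= k%:R & k%:R <= 3 * M `^ (1 + alpha).
  exists (Num.truncn (2 * M `^ (1 + alpha))).+1; first by apply: ltW; exact: truncnS_gt.
  rewrite -natr1.
  by have := @truncn_itv R (2 * M `^ (1 + alpha)) ltac:(lra); lra.
have k2 : (2 <= k)%N by rewrite -(ler_nat R); move: Ma1 k2R; clear; lra.
have hQ' : {in Q, forall q, [/\ prime q, y <= q%:R & q%:R <= M]}.
  move=> q /hQ[pq q1 q2]; split => //; last by rewrite ler_nat.
  rewrite ler_pdivrMr; last by lra.
  by rewrite -!natrM ler_nat mulnC.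
have ysQ : y <= (size Q)%:R.
  rewrite ler_pdivrMr; last by lra.
  by rewrite -!natrM ler_nat mulnC.
have Q0 : Q != [::] by apply: contraTneq ysQ => ->; rewrite -ltNge.
have pQ : {in Q, forall q, prime q} by move=> q /hQ[].
have cdf a b : a <= b -> `|lint `]a, b] (fun x => rho x * avgw Q k x) - lint `]a, b] rho|
    <= 4 * K / y.
  move=> ab; have -> : 4 * K / y = 2 * (K + K) / y by congr (_ / _); ring.
  by apply: (@cdf_avgw_le R rho K K) => // q /hQ'[].
have y1' : 1 <= y by lra.
have [_ cd ys] := step_scale (introT andP (conj s0 s1)) K0 d0 mR16 M1 y1' H3.
exists (fun x => rho x * avgw Q k x); split => //.
- exact: density_mul_avgw.
- by move=> x; apply: contraNneq => ->; rewrite mul0r.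
- move=> xi p; apply: le_trans (_ : _ <= C' / mR * Cr * gauge tau xi) _; last first.
    by apply: ler_wpM2r; [rewrite ltW // gauge_gt0 | rewrite mulrAC].
  apply: (@tr_avgw_sub_le R rho Q k xi p _ (fun t => Cr * (jap t)^-1 ^+ 2)) => // N.
  have := hC' m k Q xi N m16 (ltnW k2) _ uQ hQ hs; rewrite ti -/M => /(_ k3R) h.
  have := ler_wpM2l Cr0 h; rewrite -/mR.
  have -> : Cr * (C' / mR * gauge tau xi) = C' / mR * Cr * gauge tau xi by ring.
  apply: le_trans; rewrite mulrCA ler_wpM2l ?invr_ge0 // mulr_sumr le_eqVlt.
  apply/orP; left; apply/eqP; apply: eq_bigr => q _; rewrite mulr_sumr.
  by apply: eq_bigr => i _; rewrite -mulrDr mulrCA.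
- split; first by move=> a b ab; apply: le_trans (cdf a b ab) _; apply: le_trans cd _; nra.
  move=> C C0 fr; apply: (frostman_avgw alpha0 (introT andP (conj s0 s1)) a00 hr d0 K0 rB mR16 M1 y1' k2 k2R k3R) => //.
  apply: le_trans H2; rewrite -[leLHS]mulr1; apply: ler_pM => //; [exact: ltW|lra|].
  by rewrite exprn_ege1 //; lra.
- exists (k%:R * M)^-1.
    by rewrite invr_gt0 mulr_gt0 //; lra.
  move=> x x' xx; rewrite mulf_eq0 negb_or => /andP[_ nz].
  have hQM : {in Q, forall q, prime q /\ q%:R <= M} by move=> q /hQ'[].
  have [q [r [qQ h]]] := avgw_supp_near alpha0 M1 k2 k2R hQM xx nz.
  have [pq yq _] := hQ' q qQ; exists q, r; split => //; last exact: prime_gt0.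
  by rewrite -(ler_nat R); lra.
Qed.

End Step.

(** * The limit measure *)

Section Riemann.
Context {R : realType}.
Implicit Types (m : {measure set (measurableTypeR R) -> \bar R}) (rho u G : R -> R).

Lemma stieltjes_exists G : {homo G : x y / x <= y} -> continuous G ->
  exists nu : {measure set (measurableTypeR R) -> \bar R},
    forall a b : R, a <= b -> nu `]a, b]%classic = (G b - G a)%:E.
Proof.
move=> nd cG.
pose Gc : cumulative R R := HB.pack G (isCumulative.Build R _ R G nd (right_continuousW cG)).
exists (lebesgue_stieltjes_measure Gc) => a b ab.
rewrite /= /lebesgue_stieltjes_measure /measure_extension measurable_mu_extE/=; last exact: is_ocitv.
by rewrite wlength_itv_bnd.
Qed.

Lemma integrable_bounded_mul m (D : set R) (K : R) u rho : measurable (D : set (measurableTypeR R)) ->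
  m.-integrable D (EFin \o rho) -> continuous u -> (forall x, `|u x| <= K) ->
  m.-integrable D (EFin \o (fun x => u x * rho x)).
Proof.
move=> mD ir cu uK.
have K0 : 0 <= K := le_trans (normr_ge0 _) (uK 0).
have mr : measurable_fun (D : set (measurableTypeR R)) rho.
  by apply/measurable_EFinP; exact: measurable_int ir.
have mu : measurable_fun (D : set (measurableTypeR R)) u.
  by apply: measurable_funTS; exact: continuous_measurable_fun.
apply: (@le_integrable _ _ _ m D mD _ (EFin \o (fun x => K * rho x))).
- by apply/measurable_EFinP; exact: measurable_funM.
- by move=> x _ /=; rewrite lee_fin !normrM (ger0_norm K0) ler_wpM2r.
- have -> : EFin \o (fun x => K * rho x) = (fun x => K%:E * (EFin \o rho) x)%E.
    by apply/funext => x.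
  exact: integrableZl.
Qed.

Lemma Rintegral_oitvU m a b c f : a <= b -> b <= c ->
  m.-integrable (`]a, c]%classic : set (measurableTypeR R)) (EFin \o f) ->
  \int[m]_(x in `]a, c]) f x = \int[m]_(x in `]a, b]) f x + \int[m]_(x in `]b, c]) f x.
Proof.
move=> ab bc fi.
have e : `]a, c]%classic = `]a, b]%classic `|` `]b, c]%classic :> set R.
  by rewrite -itv_bndbnd_setU.
rewrite e Rintegral_setU //; first by rewrite -e.
apply/disj_setPS => x [] /=; rewrite !in_itv /= => /andP[_ h] /andP[h' _].
by move: (lt_le_trans h' h); rewrite ltxx.
Qed.

(** Replaces weak convergence of measures: integrals against two measures are compared through the
    same finite sum, which involves only the masses of grid cells, that is, distribution
    functions. *)
Lemma riemann_sum_le m rho u (L : R) (n : nat) :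
  m.-integrable (`]0, 1]%classic : set (measurableTypeR R)) (EFin \o rho) ->
  (forall x, 0 <= rho x) -> (forall x, `|u x| <= 1) ->
  (forall x y, `|u x - u y| <= L * `|x - y|) -> (0 < n)%N ->
  `|\int[m]_(x in `]0, 1]) (u x * rho x) - \sum_(i < n) u (i%:R / n%:R) *
     \int[m]_(x in `](i%:R / n%:R), (i.+1%:R / n%:R)]) rho x| <=
  L / n%:R * \int[m]_(x in `]0, 1]) rho x.
Proof.
move=> ir r0 u1 uL n0; have cu : continuous u by exact: lip_continuous uL.
have np : (0 : R) < n%:R by rewrite ltr0n.
have n00 : (n%:R : R) != 0 by rewrite gt_eqF.
have L0 : 0 <= L by have := le_trans (normr_ge0 _) (uL 1 0); rewrite subr0 normr1 mulr1.
have iS (a b : R) : 0 <= a -> b <= 1 ->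
    m.-integrable (`]a, b]%classic : set (measurableTypeR R)) (EFin \o rho).
  move=> a0 b1; apply: integrableS ir => //.
  by apply: subset_itv; rewrite bnd_simp.
suff h k : (k <= n)%N -> `|\int[m]_(x in `]0, (k%:R / n%:R)]) (u x * rho x) -
     \sum_(i < k) u (i%:R / n%:R) *
     \int[m]_(x in `](i%:R / n%:R), (i.+1%:R / n%:R)]) rho x| <=
  L / n%:R * \int[m]_(x in `]0, (k%:R / n%:R)]) rho x.
  by have := h n (leqnn _); rewrite divff.
elim: k => [|k IH] kn.
  by rewrite big_ord0 mul0r set_itvoc0 !Rintegral_set0 subrr normr0 mulr0.
have a0 : 0 <= k%:R / n%:R :> R by rewrite divr_ge0.
have ab : k%:R / n%:R <= k.+1%:R / n%:R :> R by rewrite ler_wpM2r ?invr_ge0 // ler_nat.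
have b1 : k.+1%:R / n%:R <= 1 :> R by rewrite ler_pdivrMr // mul1r ler_nat.
set a := k%:R / n%:R in a0 ab *; set b := k.+1%:R / n%:R in ab b1 *.
have iu (c d : R) : 0 <= c -> d <= 1 ->
    m.-integrable (`]c, d]%classic : set (measurableTypeR R)) (EFin \o (fun x => u x * rho x)).
  by move=> c0 d1; apply: integrable_bounded_mul (iS _ _ c0 d1) cu u1.
rewrite big_ord_recr /= (Rintegral_oitvU a0 ab (iu _ _ _ _)) //.
rewrite (Rintegral_oitvU a0 ab (iS _ _ _ _)) // -/a -/b.
have {}IH := IH (ltnW kn); rewrite -/a in IH.
set S := \sum_(i < k) _ in IH *.
rewrite [in leRHS]mulrDr.
set I1 := (X in `|X + _ - _|); set I2 := (X in `|_ + X - _|).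
have -> : I1 + I2 - (S + u a * \int[m]_(x in `]a, b]) rho x) =
    (I1 - S) + (I2 - u a * \int[m]_(x in `]a, b]) rho x) by ring.
apply: le_trans (ler_normD _ _) _; apply: lerD => //.
have mab : measurable (`]a, b]%classic : set (measurableTypeR R)) by exact: measurable_itv.
have ir' := iS a b a0 b1; have iu' := iu a b a0 b1.
have ica : m.-integrable (`]a, b]%classic : set (measurableTypeR R)) (EFin \o (fun x => u a * rho x)).
  by apply: integrable_bounded_mul ir' _ (fun=> u1 a) => // x; exact: cvg_cst.
rewrite /I2 -RintegralZl // -RintegralB //.
have iD : m.-integrable (`]a, b]%classic : set (measurableTypeR R))
    (EFin \o (fun x => u x * rho x - u a * rho x)).
  exact: (integrableB mab iu' ica).
apply: le_trans (le_normr_Rintegral mab iD) _.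
rewrite -RintegralZl //; apply: le_Rintegral => //.
- exact: (integrable_abse iD).
- by apply: (@integrable_bounded_mul m _ `|L / n%:R| (fun=> L / n%:R)) => // x; exact: cvg_cst.
move=> x /=; rewrite in_itv /= => /andP[ax xb].
rewrite -mulrBl normrM (ger0_norm (r0 x)) ler_wpM2r //.
apply: le_trans (uL _ _) _; rewrite ler_wpM2l // ger0_norm ?subr_ge0 ?(ltW ax) //.
rewrite lerBlDr; apply: le_trans xb _; rewrite /a /b -[k.+1%:R]natr1 mulrDl mul1r addrC.
exact: lexx.
Qed.

End Riemann.

(** * Limit of the successive densities *)

Section Limit.
Context {R : realType}.
Implicit Types (nu : {measure set (measurableTypeR R) -> \bar R}) (f g rho G : R -> R).

(** The limit is the supremum of the lower bounds F N x - e N; every F M x + e M is above all of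
    them. *)
Lemma uniform_limit (T : Type) (F : nat -> T -> R) (e : nat -> R) :
  (forall N M x, (N <= M)%N -> `|F M x - F N x| <= e N) ->
  exists G : T -> R, forall N x, `|F N x - G x| <= e N.
Proof.
move=> h; pose A x : set R := range (fun N => F N x - e N).
have ub N x : ubound (A x) (F N x + e N).
  move=> _ [M _ <-]; have e0 K : 0 <= e K.
    by have := h K K x (leqnn _); apply: le_trans.
  have [NM|/ltnW MN] := leqP N M.
    by have := h N M x NM; have := e0 M; rewrite ler_norml; lra.
  by have := h M N x MN; have := e0 N; rewrite ler_norml; lra.
have A0 x : A x !=set0 by exists (F 0 x - e 0); exists 0.
exists (fun x => sup (A x)) => N x; rewrite ler_distlC; apply/andP; split.
  by apply: sup_upper_bound; [split => //; exists (F 0 x + e 0); exact: ub | exists N].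
by apply: ge_sup => //; exact: ub.
Qed.

Lemma exp_half_small (d eps : R) : 0 < eps -> exists N, d / 2 ^+ N <= eps.
Proof.
move=> e0; exists (Num.truncn (d / eps)).+1; set N := _.+1.
rewrite ler_pdivrMr ?exprn_gt0 // mulrC -ler_pdivrMr //.
apply: ltW; apply: lt_le_trans (truncnS_gt _) _.
by rewrite -natrX ler_nat; apply: ltnW; apply: ltn_expl.
Qed.

Lemma holder_continuous G (K s : R) : 0 < s ->
  (forall x y, x <= y -> `|G y - G x| <= K * (y - x) `^ s) -> continuous G.
Proof.
move=> s0 h x.
have K0 : 0 <= K.
  by have := le_trans (normr_ge0 _) (h 0 1 ler01); rewrite subr0 powR1 mulr1.
have {}h y : `|G x - G y| <= K * `|x - y| `^ s.
  have [xy|/ltW yx] := leP x y.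
    by rewrite distrC [`|x - y|]distrC (ger0_norm (_ : 0 <= y - x)) ?subr_ge0 //; exact: h.
  by rewrite (ger0_norm (_ : 0 <= x - y)) ?subr_ge0 //; exact: h.
apply/cvgrPdist_le => e e0.
have K1 : 0 < K + 1 by rewrite ltr_wpDl.
pose d := (e / (K + 1)) `^ s^-1.
have d0 : 0 < d by rewrite powR_gt0 // divr_gt0.
near=> y; apply: le_trans (h y) _.
have eK : 0 <= e / (K + 1) by rewrite divr_ge0 ?ltW.
have xyd : `|x - y| <= d.
  by near: y; apply: cvgr_dist_le; first exact: cvg_id.
have : `|x - y| `^ s <= d `^ s by apply: ge0_ler_powR; rewrite ?nnegrE ?powR_ge0 // ltW.
rewrite -powRrM mulVf ?gt_eqF // powRr1 // ler_pdivlMr // mulrDr mulr1 mulrC => h1.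
by apply: le_trans h1; rewrite lerDl powR_ge0.
Unshelve. all: by end_near.
Qed.

Lemma null_outside nu (c d : R) :
  (forall a b, a <= b -> b <= c \/ d <= a -> nu `]a, b]%classic = 0%E) ->
  nu (~` `]c, d]%classic) = 0%E.
Proof.
move=> h; apply: measure_negligible.
  by apply: measurableC; exact: measurable_itv.
have h' (a b : R) : b <= c \/ d <= a -> nu.-negligible (`]a, b]%classic).
  move=> hab; apply/negligibleP; first exact: measurable_itv.
  have [ab|/ltW ab] := leP a b; first exact: h.
  by rewrite set_itv_ge ?measure0 // bnd_simp -leNgt.
apply: (@negligibleS _ _ _ nu (\bigcup_n `](- n%:R), c]%classic `|` \bigcup_n `]d, (d + n%:R)]%classic)).
  rewrite -itvNybndEbigcup -itv_bndy_bigcup_BRight => x /=; rewrite !in_itv /=.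
  by move=> /negP; rewrite negb_and -leNgt -ltNge andbT => /orP.
by apply: negligibleU; apply: negligible_bigcup => k; apply: h'; [left|right].
Qed.

Lemma well_approximable_unbounded (alpha x : R) :
  (forall j, exists (q : nat) (r : int), [/\ (j <= q)%N, (0 < q)%N &
     `|x - r%:~R / q%:R| <= q%:R `^ (- (2 + alpha))]) -> well_approximable alpha x.
Proof.
move=> h /finite_seqP[S hS].
have [q [r [jq q0 hq]]] := h (\max_(p <- S) `|p.1|%N).+1.
have : approx_pairs alpha x (q%:Z, r).
  by split; rewrite /= ?normr_nat // eqz_nat -lt0n.
rewrite hS /= => hin.
have := @leq_bigmax_seq _ S xpredT (fun p : int * int => `|p.1|%N) _ hin isT.
by move=> /(leq_trans jq); rewrite ltnn.
Qed.

Definition cdf f (x : R) : R := lint `]0, (clamp x)]%classic f.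

Lemma cdfB f a b : test_fun f -> (forall x, f x != 0 -> 0 < x <= 1) -> a <= b ->
  lint `]a, b]%classic f = cdf f b - cdf f a.
Proof.
move=> tf sf ab; have /andP[a0 _] := clamp_itv a.
by rewrite (lint_clamp _ _ sf) /cdf (lint_itvU a0 (clamp_le ab) tf) addrAC subrr add0r.
Qed.

Lemma integrable_one nu (D : set R) : measurable (D : set (measurableTypeR R)) ->
  (nu D < +oo)%E -> nu.-integrable D (EFin \o (fun=> 1 : R)).
Proof.
move=> mD fD; apply/integrableP; split; first exact: measurable_cst.
by under eq_integral do rewrite /= normr1; rewrite integral_cst // mul1e.
Qed.

Definition mtr nu (xi p : R) : R := \int[nu]_x cs (x * xi + p).

Lemma step_sequence (alpha s a0 delta : R) g :
  0 < alpha -> 0 < s -> s * (2 + alpha) < 2 -> 0 < a0 -> density a0 g -> 0 < delta ->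
  exists rho : nat -> R -> R, rho 0 = g /\ forall j,
  [/\ density a0 (rho j), forall x, rho j.+1 x != 0 -> rho j x != 0,
    forall xi p, `|tr (rho j.+1) xi p - tr (rho j) xi p| <=
      delta / 2 ^+ j.+1 * gauge (1 / (2 + alpha)) xi,
    (forall a b, a <= b ->
      `|lint `]a, b] (rho j.+1) - lint `]a, b] (rho j)| <= delta / 2 ^+ j.+1) /\
    (forall C, 0 <= C -> frostman s C (rho j) -> frostman s (C + delta / 2 ^+ j.+1) (rho j.+1)) &
    exists2 h : R, 0 < h & forall x x', `|x - x'| <= h -> rho j.+1 x' != 0 ->
      exists (q : nat) (r : int), [/\ (j <= q)%N, (0 < q)%N &
        `|x - r%:~R / q%:R| <= q%:R `^ (- (2 + alpha))]].
Proof.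
move=> alpha0 s0 s2 a00 hg delta0.
(* The hypothesis on p.2 stands under the existential so that [choice] yields a total function. The
   index p.1 sets the tolerance of the step and the lower bound on its denominators. *)
have ex (p : nat * (R -> R)) : exists rho', density a0 p.2 ->
  [/\ density a0 rho', forall x, rho' x != 0 -> p.2 x != 0,
    forall xi t, `|tr rho' xi t - tr p.2 xi t| <=
      delta / 2 ^+ p.1.+1 * gauge (1 / (2 + alpha)) xi,
    (forall a b, a <= b ->
      `|lint `]a, b] rho' - lint `]a, b] p.2| <= delta / 2 ^+ p.1.+1) /\
    (forall C, 0 <= C -> frostman s C p.2 -> frostman s (C + delta / 2 ^+ p.1.+1) rho') &
    exists2 h : R, 0 < h & forall x x', `|x - x'| <= h -> rho' x' != 0 ->
      exists (q : nat) (r : int), [/\ (p.1 <= q)%N, (0 < q)%N &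
        `|x - r%:~R / q%:R| <= q%:R `^ (- (2 + alpha))]].
  have [hp|np] := pselect (density a0 p.2); last by exists p.2.
  have dp : 0 < delta / 2 ^+ p.1.+1 by rewrite divr_gt0 // exprn_gt0.
  by have [rho' h] := density_step p.1 alpha0 s0 s2 a00 hp dp; exists rho'.
have [F hF] := choice ex.
pose rho := fix rho n := if n is m.+1 then F (m, rho m) else g.
have hd j : density a0 (rho j).
  by elim: j => //= j IH; case: (hF (j, rho j) IH).
exists rho; split => // j; have [_ h1 h2 h3 h4] := hF (j, rho j) (hd j).
by split.
Qed.

(** Summable steps make the distribution functions converge uniformly. The Frostman bound passes to
    the limit and makes it continuous, as [stieltjes_exists] requires; the nested supports then
    locate the measure. *)
Lemma limit_measure (alpha s a0 delta C : R) g :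
  0 < alpha -> 0 < s -> s * (2 + alpha) < 2 -> 0 < a0 -> density a0 g -> 0 < delta ->
  0 <= C -> frostman s C g ->
  exists nu : {measure set (measurableTypeR R) -> \bar R},
  [/\ forall xi p, `|mtr nu xi p - tr g xi p| <= delta * gauge (1 / (2 + alpha)) xi,
    (nu setT < +oo)%E,
    forall a b, a <= b -> (nu `]a, b]%classic <= ((C + delta) * (b - a) `^ s)%:E)%E,
    msupport nu `<=` well_approximable alpha &
    forall c d, (forall x, g x != 0 -> c < x <= d) -> nu (~` `]c, d]%classic) = 0%E].
Proof.
move=> alpha0 s0 s2 a00 hg delta0 C0 fr.
have [rho [rho0 hrho]] := step_sequence alpha0 s0 s2 a00 hg delta0.
pose D j := delta / 2 ^+ j : R.
have D0 j : 0 < D j by rewrite divr_gt0 // exprn_gt0.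
have DS j : D j - D j.+1 = D j.+1.
  by rewrite /D exprS; field; rewrite expf_neq0.
have hd j : density a0 (rho j) by have [] := hrho j.
have tf j : test_fun (rho j) by exact: density_test_fun (hd j).
have r0 j x : 0 <= rho j x by have [] := hd j.
have sf j x : rho j x != 0 -> 0 < x <= 1.
  by have [_ _ h _] := hd j; move=> /h; move: a00; clear; lra.
have mono N M x : (N <= M)%N -> rho M x != 0 -> rho N x != 0.
  elim: M => [|M IH]; first by rewrite leqn0 => /eqP->.
  rewrite leq_eqVlt => /predU1P[->//|]; rewrite ltnS => NM h; apply: IH => //.
  by have [_ h1 _ _ _] := hrho M; exact: h1.
have cau N M a b : (N <= M)%N -> a <= b ->
    `|lint `]a, b] (rho M) - lint `]a, b] (rho N)| <= D N - D M.
  move=> NM ab; elim: M NM => [|M IH].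
    by rewrite leqn0 => /eqP->; rewrite !subrr normr0.
  rewrite leq_eqVlt => /predU1P[->|]; first by rewrite !subrr normr0.
  rewrite ltnS => NM; have := IH NM.
  have [_ _ _ [h _] _] := hrho M; have := h a b ab; rewrite -/(D M.+1); have := DS M.
  by rewrite !ler_norml; clear; lra.
have frN N : frostman s (C + (D 0 - D N)) (rho N).
  elim: N => [|N IH]; first by rewrite subrr addr0 rho0.
  have [_ _ _ [_ h] _] := hrho N.
  have DN : D N <= D 0.
    by rewrite /D expr0 ler_wpM2l ?(ltW delta0) // invr1 invf_le1 ?exprn_gt0 // exprn_ege1 // ler1n.
  have -> : C + (D 0 - D N.+1) = C + (D 0 - D N) + D N.+1 by have := DS N; clear; lra.
  by apply: h => //; rewrite addr_ge0 // subr_ge0.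
have DE : D 0 = delta by rewrite /D expr0 divr1.
have {}frN N a b : a <= b -> lint `]a, b] (rho N) <= (C + delta) * (b - a) `^ s.
  move=> ab; apply: le_trans (frN N a b ab) _; rewrite ler_wpM2r ?powR_ge0 //.
  by rewrite lerD2l DE gerDl oppr_le0 ltW.
have trN N xi p : `|tr (rho N) xi p - tr g xi p| <= (D 0 - D N) * gauge (1 / (2 + alpha)) xi.
  elim: N => [|N IH]; first by rewrite rho0 !subrr normr0 mul0r.
  have [_ _ h _ _] := hrho N; have := h xi p; rewrite -/(D N.+1).
  have -> : D 0 - D N.+1 = D 0 - D N + D N.+1 by have := DS N; clear; lra.
  rewrite [_ * gauge _ _ in X in _ -> X]mulrDl; move: IH; rewrite !ler_norml; clear; lra.
have [G hG] : exists G : R -> R, forall N x, `|cdf (rho N) x - G x| <= D N.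
  apply: uniform_limit => N M x NM; rewrite /cdf.
  have /andP[c0 _] := clamp_itv x.
  by apply: le_trans (cau N M _ _ NM c0) _; rewrite gerDl oppr_le0 ltW.
have cdfE N a b : a <= b -> lint `]a, b] (rho N) = cdf (rho N) b - cdf (rho N) a.
  by move=> ab; apply: cdfB => //; exact: sf.
have close N a b : a <= b -> `|lint `]a, b] (rho N) - (G b - G a)| <= 2 * D N.
  move=> /cdfE ->; have := hG N a; have := hG N b; rewrite !ler_norml; clear; lra.
have small e : 0 < e -> exists N, 2 * D N <= e.
  move=> e0; have [N hN] := @exp_half_small (2 * delta) e e0.
  by exists N; rewrite /D mulrA.
have G0 a b : a <= b -> 0 <= G b - G a.
  move=> ab; apply/ler_addgt0Pr => e /small[N hN].
  have := close N a b ab; have := @lint_ge0 R `]a, b]%classic (rho N) (fun x _ => r0 N x).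
  by move: hN; rewrite ler_norml; clear; lra.
have GH a b : a <= b -> G b - G a <= (C + delta) * (b - a) `^ s.
  move=> ab; apply/ler_addgt0Pr => e /small[N hN].
  by have := close N a b ab; have := frN N a b ab; move: hN; rewrite ler_norml; clear; lra.
have ndG : {homo G : x y / x <= y} by move=> x y xy; rewrite -subr_ge0 G0.
have cG : continuous G.
  apply: (@holder_continuous G (C + delta) s s0) => x y xy.
  by rewrite ger0_norm ?G0 //; exact: GH.
have [nu nuE] := stieltjes_exists ndG cG.
(* The supports decrease, so an interval on which one [rho N] vanishes carries no mass for any later
   density, hence none in the limit. *)
have van N a b : a <= b -> (forall x, a < x <= b -> rho N x = 0) -> nu `]a, b]%classic = 0%E.
  move=> ab z; rewrite nuE //; congr EFin; apply/eqP; rewrite eq_le G0 // andbT.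
  apply/ler_addgt0Pr => e /small[M hM].
  have zM : lint `]a, b] (rho (maxn N M)) = 0.
    transitivity (lint `]a, b] (fun=> 0 : R)); last first.
      by rewrite /lint Rintegral_cst ?mul0r //; exact: measurable_itv.
    apply: eq_lint => x; rewrite /= in_itv /= => /z zx.
    by apply/eqP/negPn/negP => /(mono _ _ _ (leq_maxl N M)); rewrite zx eqxx.
  have := close (maxn N M) a b ab; rewrite zM.
  have : D (maxn N M) <= D M.
    rewrite /D ler_wpM2l ?(ltW delta0) // lef_pV2 ?posrE ?exprn_gt0 //.
    by rewrite ler_eXn2l ?leq_maxr // ltr1n.
  by move: hM; rewrite ler_norml; clear; lra.
have van' c d : (forall x, g x != 0 -> c < x <= d) -> nu (~` `]c, d]%classic) = 0%E.
  move=> h; apply: null_outside => a b ab hab; apply: (van 0) => // x /andP[ax xb].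
  rewrite rho0; apply/eqP/negPn/negP => /h/andP[cx xd].
  case: hab => [bc|da].
    by have := lt_le_trans cx (le_trans xb bc); rewrite ltxx.
  by have := lt_le_trans ax (le_trans xd da); rewrite ltxx.
have m01 : measurable (`]0, 1]%classic : set (measurableTypeR R)) by exact: measurable_itv.
have nu01 : nu (~` `]0, 1]%classic) = 0%E by apply: van' => x; rewrite -rho0; exact: sf.
have nuT : nu setT = nu `]0, 1]%classic.
  have e := measureU nu (measurableC m01) m01 (setICl _); rewrite setvU in e.
  by rewrite e; apply: etrans (congr1 (fun t => (t + _)%E) nu01) _; rewrite add0e.
have fin : (nu setT < +oo)%E by rewrite nuT nuE // ltry.
exists nu; split => //.
- move=> xi p; apply/ler_addgt0Pr => e e0.
  have trN' N : `|mtr nu xi p - tr (rho N) xi p| <= e ->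
      `|mtr nu xi p - tr g xi p| <= delta * gauge (1 / (2 + alpha)) xi + e.
    have := trN N xi p; rewrite mulrBl DE.
    have : 0 <= D N * gauge (1 / (2 + alpha)) xi by rewrite mulr_ge0 // ltW // gauge_gt0.
    by rewrite !ler_norml; clear; lra.
  pose u x := cs (x * xi + p); pose L := 8 * `|xi| : R.
  have L0 : 0 <= L by rewrite mulr_ge0.
  have uL x y : `|u x - u y| <= L * `|x - y|.
    apply: le_trans (lipschitz_cs _ _) _.
    by rewrite /L opprD addrACA subrr addr0 -mulrBl normrM [`|x - y| * _]mulrC mulrA.
  have u1 x : `|u x| <= 1 by exact: norm_cs.
  (* The error e is divided into a quarter for each of the two Riemann sums and a half for the
     difference of the cell masses. *)
  pose n := (Num.truncn (4 * L * (C + delta) / e)).+1.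
  have nL : L / n%:R * (C + delta) <= e / 4.
    have h : 4 * L * (C + delta) / e <= n%:R by apply: ltW; exact: truncnS_gt.
    rewrite ler_pdivrMr // in h; rewrite mulrAC ler_pdivrMr //.
    have -> : e / 4 * n%:R = n%:R * e / 4 by ring.
    by rewrite ler_pdivlMr // mulrC mulrA.
  have n0 : (0 < n)%N by [].
  have np : (0 : R) < n%:R by rewrite ltr0n.
  clearbody n.
  have [N hN] := small (e / (2 * n%:R)) ltac:(by rewrite divr_gt0 // mulr_gt0).
  apply: (trN' N).
  have cu : continuous u by exact: continuous_cs_affine.
  have i1 (E : set R) : measurable (E : set (measurableTypeR R)) ->
      nu.-integrable E (EFin \o (fun=> 1 : R)).
    move=> mE; apply: integrable_one => //; apply: le_lt_trans fin.
    by apply: le_measure; rewrite ?inE.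
  have -> : mtr nu xi p = \int[nu]_(x in `]0, 1]) (u x * 1).
    have iu : nu.-integrable setT (EFin \o (fun x => u x * 1)).
      exact: integrable_bounded_mul (i1 _ measurableT) cu u1.
    rewrite /Rintegral; congr fine.
    have := negligible_integral (measurableC m01) measurableT iu nu01.
    rewrite setTD setCK => <-; apply: eq_integral => x _ /=; by rewrite mulr1.
  have -> : tr (rho N) xi p = \int[@lebesgue_measure R]_(x in `]0, 1]) (u x * rho N x).
    rewrite /tr (@lint_setT R `]0, 1]%classic); last first.
      move=> x nx; have [->|/sf h] := eqVneq (rho N x) 0; first by rewrite mul0r.
      by case: nx; rewrite /= in_itv.
    by apply: eq_lint => x _; rewrite mulrC.
  have m1 : \int[nu]_(x in `]0, 1]) 1 <= C + delta.
    rewrite Rintegral_cst // mul1r nuE // /=.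
    by have := GH 0 1 ler01; rewrite subr0 powR1 mulr1.
  have m2 : \int[@lebesgue_measure R]_(x in `]0, 1]) rho N x <= C + delta.
    by have := frN N 0 1 ler01; rewrite subr0 powR1 mulr1.
  have h1 := riemann_sum_le (i1 _ m01) (fun=> ler01) u1 uL n0.
  have h2 := riemann_sum_le (test_fun_integrable m01 (tf N)) (r0 N) u1 uL n0.
  have {}h1 := le_trans h1 (le_trans (ler_wpM2l (divr_ge0 L0 (ltW np)) m1) nL).
  have {}h2 := le_trans h2 (le_trans (ler_wpM2l (divr_ge0 L0 (ltW np)) m2) nL).
  set S1 := \sum_(i < n) _ in h1; set S2 := \sum_(i < n) _ in h2.
  have h3 : `|S1 - S2| <= e / 2.
    rewrite /S1 /S2 -sumrB; apply: le_trans (ler_norm_sum _ _ _) _.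
    apply: (@le_trans _ _ (\sum_(i < n) e / (2 * n%:R))); last first.
      rewrite sumr_const card_ord -mulr_natr le_eqVlt; apply/orP; left; apply/eqP.
      by field; rewrite gt_eqF.
    apply: ler_sum => i _; apply: le_trans hN.
    have ab : i%:R / n%:R <= i.+1%:R / n%:R :> R by rewrite ler_wpM2r ?invr_ge0 // ler_nat.
    rewrite -mulrBr normrM; apply: le_trans (ler_wpM2r (normr_ge0 _) (u1 _)) _; rewrite mul1r.
    rewrite Rintegral_cst // mul1r nuE //=.
    by rewrite distrC; exact: close.
  by move: h1 h2 h3; rewrite !ler_norml; clear; lra.
- by move=> a b ab; rewrite nuE // lee_fin; exact: GH.
move=> x xs; apply: well_approximable_unbounded => j.
have [_ _ _ _ [h h0 hh]] := hrho j.
(* If no point of the support of [rho j.+1] were within h of x, a neighbourhood of x would be null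
   by [van], contradicting that x is in the support. *)
have [[x' [xx nz]]|nex] := pselect (exists x', `|x - x'| <= h /\ rho j.+1 x' != 0).
  exact: hh xx nz.
have z : nu `](x - h), (x + h)]%classic = 0%E.
  apply: (van j.+1); first by rewrite lerD2l; move: h0; clear; lra.
  move=> y /andP[y1 y2]; apply/eqP/negPn/negP => nz; apply: nex; exists y; split => //.
  by rewrite ler_distlC; move: y1 y2; clear; lra.
have op : open (`](x - h), (x + h)[%classic : set R) by exact: itv_open.
have := xs _ op; rewrite /= in_itv /= => /(_ ltac:(move: h0; clear; lra)).
have : (nu `](x - h)%R, (x + h)%R[%classic <= nu `](x - h)%R, (x + h)%R]%classic)%E.
  apply: le_measure; rewrite ?inE; try exact: measurable_itv.
  by apply: subset_itv; rewrite bnd_simp.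
by rewrite z => /lt_le_trans h1 /h1; rewrite ltxx.
Qed.

End Limit.

(** * Combs of bumps at fractions [r / Q] *)

Section Comb.
Context {R : realType}.
Implicit Types (k w x xi p a b : R) (Q N : nat).

(** The numerators run from N + 1 to 2N: the comb stays away from 0, and combs of different scales
    can be placed on disjoint intervals. *)
Definition node Q N r : R := (N + r).+1%:R / Q%:R.

Definition comb k Q N w x : R := k / (Q%:R * N%:R) * \sum_(r < N) bump (node Q N r) w x.

Lemma node_itv Q N r : (0 < N)%N -> (6 * N <= Q)%N -> (r < N)%N ->
  (N%:R + 1) / Q%:R <= node Q N r <= 2 * N%:R / Q%:R.
Proof.
move=> N0 NQ rN; rewrite /node natr1 -natrM !ler_wpM2r ?invr_ge0 // ler_nat; lia.
Qed.

Lemma node01 Q N r : (0 < N)%N -> (6 * N <= Q)%N -> (r < N)%N -> 0 <= node Q N r <= 1.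
Proof.
move=> N0 NQ rN; rewrite /node divr_ge0 //= ler_pdivrMr; last by rewrite ltr0n; lia.
by rewrite mul1r ler_nat; lia.
Qed.

Lemma comb_ge0 k Q N w x : 0 <= k -> 0 < w -> 0 <= comb k Q N w x.
Proof.
move=> k0 w0; rewrite mulr_ge0 ?divr_ge0 ?mulr_ge0 // sumr_ge0 // => r _.
exact: bump_ge0.
Qed.

Lemma comb_supp k Q N w x : 0 < w -> comb k Q N w x != 0 ->
  exists2 r, (r < N)%N & `|x - node Q N r| < w.
Proof.
move=> w0 nz; have [r h] : exists r : 'I_N, bump (node Q N r) w x != 0.
  apply/existsP; apply: contraNT nz => /existsPn h; rewrite /comb big1 ?mulr0 //.
  by move=> r _; apply/eqP/negPn; exact: h.
by exists r => //; exact: bump_supp h.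
Qed.

Lemma comb_supp_itv k Q N w x : (0 < N)%N -> (6 * N <= Q)%N -> 0 < w -> w * Q%:R <= 1 ->
  comb k Q N w x != 0 -> N%:R / Q%:R < x <= 3 * N%:R / Q%:R.
Proof.
move=> N0 NQ w0 wQ /(comb_supp w0)[r rN]; have /andP[h1 h2] := node_itv N0 NQ rN.
have Q0 : (0 : R) < Q%:R by rewrite ltr0n; lia.
have N1 : (1 : R) <= N%:R by rewrite ler1n.
have e : N%:R / Q%:R + Q%:R^-1 = (N%:R + 1) / Q%:R :> R by rewrite mulrDl mul1r.
move: wQ h1 h2; rewrite -ler_pdivlMr // mul1r -e.
have : Q%:R^-1 <= N%:R / Q%:R :> R by rewrite ler_peMl ?invr_ge0.
rewrite -[2 * _ / _]mulrA -[3 * _ / _]mulrA.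
by move: (node Q N r) (N%:R / Q%:R : R) (Q%:R^-1 : R); clear => c u v; rewrite ltr_norml; lra.
Qed.

Lemma test_fun_comb_bump Q N w r : (0 < N)%N -> (6 * N <= Q)%N -> 0 < w -> w <= 1 ->
  (r < N)%N -> test_fun (bump (node Q N r) w).
Proof. by move=> N0 NQ w0 w1 rN; apply: test_fun_bump => //; exact: node01. Qed.

Lemma tr_comb k Q N w xi p : (0 < N)%N -> (6 * N <= Q)%N -> 0 < w -> w <= 1 ->
  tr (comb k Q N w) xi p = k / (Q%:R * N%:R) * \sum_(r < N) tr (bump (node Q N r) w) xi p.
Proof.
move=> N0 NQ w0 w1; have h r : (r < N)%N -> test_fun (bump (node Q N r) w).
  exact: test_fun_comb_bump.
rewrite -(tr_sum (F := fun r => bump (node Q N r) w)) //.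
by rewrite trZ //; exact: (test_fun_sum (F := fun r => bump (node Q N r) w)).
Qed.

Lemma norm_tr_comb_le k Q N w xi p (K : R) : (0 < N)%N -> (6 * N <= Q)%N -> 0 < w -> w <= 1 ->
  0 <= k -> (forall a, 0 <= a <= 1 -> `|tr (bump a w) xi p| <= K) ->
  `|tr (comb k Q N w) xi p| <= k / Q%:R * K.
Proof.
move=> N0 NQ w0 w1 k0 h; rewrite tr_comb // normrM ger0_norm ?divr_ge0 ?mulr_ge0 //.
have Q0 : (Q%:R : R) != 0 by rewrite pnatr_eq0; lia.
have N0' : (N%:R : R) != 0 by rewrite pnatr_eq0; lia.
apply: (@le_trans _ _ (k / (Q%:R * N%:R) * \sum_(r < N) K)).
  rewrite ler_wpM2l ?divr_ge0 ?mulr_ge0 //; apply: le_trans (ler_norm_sum _ _ _) _.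
  by apply: ler_sum => r _; apply: h; exact: node01.
rewrite sumr_const card_ord -mulr_natr le_eqVlt; apply/orP; left; apply/eqP.
by field; rewrite Q0 N0'.
Qed.

Lemma density_comb k Q N w : (0 < N)%N -> (6 * N <= Q)%N -> 0 < w -> w * Q%:R <= 1 -> 0 <= k ->
  density (N%:R / Q%:R) (comb k Q N w).
Proof.
move=> N0 NQ w0 wQ k0.
have Q1 : (1 : R) <= Q%:R by rewrite ler1n; lia.
have w1 : w <= 1 by apply: le_trans wQ; rewrite ler_peMr // ltW.
split.
- by move=> x; exact: comb_ge0.
- exists (k / (Q%:R * N%:R) * (N%:R * w^-1 ^+ 2)) => x y.
  rewrite -mulrBr normrM ger0_norm ?divr_ge0 ?mulr_ge0 // -[leRHS]mulrA.
  rewrite ler_wpM2l ?divr_ge0 ?mulr_ge0 // -sumrB; apply: le_trans (ler_norm_sum _ _ _) _.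
  have -> : N%:R * w^-1 ^+ 2 * `|x - y| = \sum_(r < N) (w^-1 ^+ 2 * `|x - y|).
    by rewrite sumr_const card_ord -[RHS]mulr_natl mulrA.
  by apply: ler_sum => r _; exact: bump_lip.
- move=> x /(comb_supp_itv N0 NQ w0 wQ)/andP[h1 h2]; rewrite (ltW h1) /=.
  apply: le_trans h2 _; rewrite ler_pdivrMr ?ltr0n; last by lia.
  by rewrite mul1r -[leRHS]mulrC ler_pdivlMr // -!natrM ler_nat; lia.
exists (k / Q%:R * (4 * w^-1 ^+ 2)) => xi p; rewrite -[leRHS]mulrA.
have i1 : 1 <= w^-1 by rewrite invf_ge1.
have i2 : 1 <= w^-1 ^+ 2 by rewrite exprn_ege1.
apply: norm_tr_comb_le => // a a01.
have j0 := @jap_gt0 R xi; have j1 := @jap_ge1 R xi.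
have [x1|x1] := leP `|xi| 1.
  apply: le_trans (tr_bump_le1 _ _ w0 w1 a01) _.
  have h : 1 <= 4 * (jap xi)^-1 ^+ 2.
    rewrite exprVn ler_pdivlMr ?exprn_gt0 // mul1r.
    by have : jap xi <= 2 by [rewrite /jap; lra]; move: j0; clear; nra.
  apply: le_trans h _; apply: ler_wpM2r; first by rewrite exprn_ge0 // invr_ge0 ltW.
  by rewrite ler_peMr.
have xi0 : xi != 0 by rewrite -normr_gt0; apply: lt_trans x1.
apply: le_trans (tr_bump_le _ w0 w1 a01 xi0) _.
rewrite invfM exprMn -mulrA [leRHS]mulrCA ler_wpM2l ?sqr_ge0 //.
rewrite !exprVn -[xi ^+ 2]real_normK ?num_real // ler_pdivlMr ?exprn_gt0 //.
rewrite mulrC ler_pdivrMr ?exprn_gt0 ?normr_gt0 //.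
by move: x1; rewrite /jap; clear; nra.
Qed.

(** No cancellation between the teeth is used. The total mass k / Q is k w^tau, with w the bump
    width and tau = 1 / (2 + alpha), so the trivial bound suffices up to frequency 1 / w; beyond it
    the quadratic decay of a single bump takes over. *)
Lemma tr_comb_le_gauge (alpha k : R) Q N xi p : 0 < alpha -> (0 < N)%N -> (6 * N <= Q)%N ->
  0 <= k -> `|tr (comb k Q N (Q%:R `^ (- (2 + alpha)))) xi p| <=
    2 * k * gauge (1 / (2 + alpha)) xi.
Proof.
move=> alpha0 N0 NQ k0; set w := Q%:R `^ _; pose tau : R := 1 / (2 + alpha).
have Q1 : (1 : R) <= Q%:R by rewrite ler1n; lia.
have Q0 : (0 : R) < Q%:R by apply: lt_le_trans Q1.
have w0 : 0 < w by rewrite powR_gt0.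
have w1 : w <= 1 by rewrite /w -[leRHS](powRr0 Q%:R) ler_powR //; lra.
have t0 : 0 < tau by apply: divr_gt0; lra.
have t1 : tau <= 1 by rewrite ler_pdivrMr; lra.
apply: le_trans (_ : 2 * k * jap xi `^ (- tau) <= _); last first.
  by rewrite ler_wpM2l ?mulr_ge0 // jap_powRN_le_gauge.
have -> : 2 * k * jap xi `^ (- tau) = k / Q%:R * (2 * Q%:R * jap xi `^ (- tau)).
  by field; rewrite gt_eqF.
apply: norm_tr_comb_le => // a a01.
have j0 := @jap_gt0 R xi; have j1 := @jap_ge1 R xi.
have two : 2 `^ tau <= 2 :> R by apply: powR_le_self; lra.
have wt : (w^-1) `^ tau = Q%:R.
  rewrite /w -powRN opprK -powRrM /tau mulrC mulfVK; last by lra.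
  by rewrite powRr1 // ltW.
have [x1|x1] := leP `|xi| w^-1.
  apply: le_trans (tr_bump_le1 _ _ w0 w1 a01) _.
  rewrite powRN ler_pdivlMr ?powR_gt0 // mul1r.
  apply: (@le_trans _ _ ((2 * w^-1) `^ tau)).
    have i1 : 1 <= w^-1 by rewrite invf_ge1.
    apply: ge0_ler_powR; rewrite ?nnegrE; [exact: ltW | exact: ltW | | ].
      by rewrite mulr_ge0 // (le_trans ler01).
    by move: x1 i1; rewrite /jap; clear; lra.
  by rewrite powRM ?invr_ge0 ?(ltW w0) // wt ler_wpM2r // ltW.
have xi0 : 0 < `|xi| by apply: lt_trans x1; rewrite invr_gt0.
have xin0 : xi != 0 by rewrite -normr_gt0.
have x2 : 1 <= w * `|xi| by rewrite -ler_pdivrMl // mulr1 ltW.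
apply: le_trans (tr_bump_le _ w0 w1 a01 xin0) _.
have -> : (w * xi)^-1 ^+ 2 = (w * `|xi|)^-1 ^+ 2.
  by rewrite !exprVn !exprMn real_normK ?num_real.
have h1 : (w * `|xi|)^-1 ^+ 2 <= (w * `|xi|)^-1 `^ tau.
  rewrite -powR_mulrn ?invr_ge0 ?(ltW w0) ?mulr_ge0 // ?(ltW w0) //.
  rewrite ger_powR ?invr_gt0 ?mulr_gt0 ?invf_le1 ?mulr_gt0 //; lra.
apply: le_trans h1 _; rewrite powRV ?mulr_gt0 // powRM ?(ltW w0) // invfM.
rewrite -powRV // wt [2 * _]mulrC -[leRHS]mulrA ler_wpM2l ?(ltW Q0) //.
have i1 : 1 <= w^-1 by rewrite invf_ge1.
rewrite powRN ler_pdivlMr ?powR_gt0 // mulrC ler_pdivrMr ?powR_gt0 //.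
apply: (@le_trans _ _ ((2 * `|xi|) `^ tau)).
  apply: ge0_ler_powR; rewrite ?nnegrE; [exact: ltW | exact: ltW | exact: mulr_ge0 | ].
  by move: x1 i1; rewrite /jap; clear; lra.
by rewrite powRM // ler_wpM2r ?powR_ge0.
Qed.

(** Each integer counted increases by one a truncation of the identity to the range from u to v + 1,
    so the count telescopes. *)
Lemma telescope_count_le N (u v : R) (m : nat) : u <= v + 1 ->
  \sum_(r < N) ((u < (m + r)%:R) && ((m + r)%:R < v))%:R <= v + 1 - u.
Proof.
move=> uv; pose c t : R := if t <= u then u else if t <= v + 1 then t else v + 1.
have mono (t t' : R) : t <= t' -> c t <= c t'.
  rewrite /c; move: uv; case: (leP t u); case: (leP t (v + 1)); case: (leP t' u); case: (leP t' (v + 1)); clear; lra.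
have cb (t : R) : u <= c t <= v + 1.
  by rewrite /c; move: uv; case: (leP t u); case: (leP t (v + 1)); clear; lra.
apply: (@le_trans _ _ (\sum_(r < N) (c (m + r).+1%:R - c (m + r)%:R))).
  apply: ler_sum => r _; set t := (m + r)%:R; rewrite -[_.+1%:R]natr1 -/t.
  have h := mono t (t + 1) ltac:(clear; lra).
  case: (ltP u t) => ut /=; last by rewrite subr_ge0.
  case: (ltP t v) => tv; last by rewrite subr_ge0.
  have -> : c t = t by rewrite /c leNgt ut /= ifT //; move: tv; clear; lra.
  have -> : c (t + 1) = t + 1.
    by rewrite /c ifF; [rewrite ifT // lerD2r ltW | apply/negP; move: ut; clear; lra].
  by rewrite addrC addKr.
have -> : \sum_(r < N) (c (m + r).+1%:R - c (m + r)%:R) = c (m + N)%:R - c m%:R.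
  elim: N => [|N IH]; first by rewrite big_ord0 addn0 subrr.
  by rewrite big_ord_recr /= IH addnS addrC addrA subrK.
by have := cb (m + N)%:R; have := cb m%:R; clear; lra.
Qed.

(** An interval of length l <= 1 / Q meets at most four teeth, each of mass k / (Q N), and the
    minimum of 1 and l / w is at most (l / w)^s with w^s = Q^-(2 + beta). A longer one meets at most
    the minimum of N and 4 Q l teeth, up to constants, and the two counts are interpolated at s. *)
Lemma frostman_comb (alpha beta k : R) Q N : 0 < alpha -> -1 < beta < 0 -> (0 < N)%N ->
  (6 * N <= Q)%N -> Q%:R `^ (1 + beta) <= 2 * N%:R -> 0 <= k ->
  frostman ((2 + beta) / (2 + alpha)) (8 * k) (comb k Q N (Q%:R `^ (- (2 + alpha)))).
Proof.
move=> alpha0 hb N0 NQ QN k0; set w := Q%:R `^ _; set s := _ / _ => a b ab.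
have Q1 : (1 : R) <= Q%:R by rewrite ler1n; lia.
have Q0 : (0 : R) < Q%:R by apply: lt_le_trans Q1.
have w0 : 0 < w by rewrite powR_gt0.
have w1 : w <= 1 by rewrite /w -[leRHS](powRr0 Q%:R) ler_powR //; lra.
have wQ : w * Q%:R <= 1.
  rewrite -[X in w * X](powRr1 (ltW Q0)) -powRD_gt0 // -[leRHS](powRr0 Q%:R) ler_powR //; lra.
have s0 : 0 < s by apply: divr_gt0; lra.
have s1 : s < 1 by rewrite ltr_pdivrMr; lra.
have Np : (0 : R) < N%:R by rewrite ltr0n.
have N1 : (1 : R) <= N%:R by rewrite ler1n.
have ws : w `^ s = (Q%:R `^ (2 + beta))^-1.
  by rewrite -powRN -powRrM /s; congr powR; field; lra.
have [->|ne] := eqVneq a b.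
  by rewrite set_itvoc0 /lint Rintegral_set0 !mulr_ge0 ?powR_ge0.
have l0 : 0 < b - a by rewrite subr_gt0 lt_neqAle ne.
set l := b - a in l0 *.
have tb r : (r < N)%N -> test_fun (bump (node Q N r) w).
  exact: test_fun_comb_bump.
rewrite /comb lintZ //; last exact: (test_fun_sum (F := fun r => bump (node Q N r) w)).
rewrite (lint_sum (F := fun r => bump (node Q N r) w)) //.
pose c := k / (Q%:R * N%:R); have c0 : 0 <= c by rewrite divr_ge0 ?mulr_ge0.
pose mn := Num.min 1 (w^-1 * l).
have mn0 : 0 <= mn by rewrite le_min ler01 mulr_ge0 ?invr_ge0 ?(ltW w0) ?(ltW l0).
pose u := Q%:R * (a - w) : R; pose v := Q%:R * (b + w) : R.
have cnt : \sum_(r < N) lint `]a, b] (bump (node Q N r) w) <= (Q%:R * l + 3) * mn.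
  apply: (@le_trans _ _ (\sum_(r < N) ((u < (N.+1 + r)%:R) && ((N.+1 + r)%:R < v))%:R * mn)).
    apply: ler_sum => r _; have := @lint_bump_itv_le R a b (node Q N r) w w0 w1 (node01 N0 NQ (ltn_ord r)) ab.
    have [h|nh _] := boolP ((u < (N.+1 + r)%:R) && ((N.+1 + r)%:R < v)); first by rewrite mul1r.
    rewrite mul0r (@eq_lint R _ _ (fun=> 0)) ?/lint ?Rintegral_cst ?mul0r //.
    move=> x /=; rewrite in_itv /= => /andP[ax xb]; apply/eqP/negPn/negP => /(bump_supp w0).
    rewrite ltr_norml => /andP[h1 h2]; move/negP: nh; apply.
    have e : (N.+1 + r)%:R = Q%:R * node Q N r.
      by rewrite /node addSn mulrC divfK // gt_eqF.
    by rewrite e /u /v !ltr_pM2l //; move: h1 h2 ax xb; clear; lra.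
  rewrite -mulr_suml ler_wpM2r //; apply: le_trans (telescope_count_le _ _ _) _.
    rewrite /u /v; apply: (@le_trans _ _ (Q%:R * (b + w))); last by rewrite lerDl.
    by rewrite ler_wpM2l ?(ltW Q0) //; move: l0 w0; rewrite /l; clear; lra.
  rewrite /u /v /l; have -> : Q%:R * (b + w) + 1 - Q%:R * (a - w) = Q%:R * (b - a) + 1 + 2 * (w * Q%:R).
    by ring.
  by move: wQ; clear; lra.
have cntN : \sum_(r < N) lint `]a, b] (bump (node Q N r) w) <= N%:R.
  apply: (@le_trans _ _ (\sum_(r < N) 1)); last by rewrite sumr_const card_ord.
  apply: ler_sum => r _.
  have := @lint_bump_itv_le R a b (node Q N r) w w0 w1 (node01 N0 NQ (ltn_ord r)) ab.
  by rewrite le_min => /andP[].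
rewrite -/c; have ls : 0 < l `^ s by rewrite powR_gt0.
have [lQ|lQ] := leP (Q%:R * l) 1.
  have mnl : mn <= (w^-1 * l) `^ s.
    have wl : 0 < w^-1 * l by rewrite mulr_gt0 ?invr_gt0.
    rewrite /mn; have := @min_le_powR R 1 (w^-1 * l) s ltr01 wl ltac:(by rewrite !ltW).
    by rewrite powR1 mul1r.
  rewrite powRM ?invr_ge0 ?(ltW w0) ?(ltW l0) // powRV // ws invrK in mnl.
  apply: le_trans (ler_wpM2l c0 (le_trans cnt (ler_wpM2r mn0 (_ : _ <= 4)))) _; first by move: lQ; clear; lra.
  apply: le_trans (ler_wpM2l c0 (ler_wpM2l _ mnl)) _ => //.
  have -> : Q%:R `^ (2 + beta) = Q%:R * Q%:R `^ (1 + beta).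
    by rewrite -{2}(powRr1 (ltW Q0)) -powRD_gt0 //; congr powR; ring.
  apply: (@le_trans _ _ (c * (4 * (Q%:R * (2 * N%:R) * l `^ s)))).
    by rewrite !ler_wpM2l // ler_wpM2r ?(ltW ls) // ler_wpM2l // ltW.
  by rewrite le_eqVlt; apply/orP; left; apply/eqP; rewrite /c; field; rewrite !gt_eqF.
have cnt4 : \sum_(r < N) lint `]a, b] (bump (node Q N r) w) <= 4 * Q%:R * l.
  apply: le_trans cnt _; apply: le_trans (_ : (Q%:R * l + 3) * 1 <= _).
    by rewrite ler_wpM2l ?ge_min ?lexx //; move: lQ; clear; lra.
  by move: lQ; rewrite -mulrA; clear; lra.
have Ql0 : 0 < 4 * Q%:R * l by rewrite !mulr_gt0.
have h := @min_le_powR R N%:R (4 * Q%:R * l) s Np Ql0 ltac:(by rewrite !ltW).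
have {}cnt : \sum_(r < N) lint `]a, b] (bump (node Q N r) w) <=
    N%:R `^ (1 - s) * (4 * Q%:R * l) `^ s.
  by apply: le_trans h; rewrite le_min cntN cnt4.
apply: le_trans (ler_wpM2l c0 cnt) _.
have h4 : 4 `^ s <= 4 :> R by apply: powR_le_self; [clear; lra | rewrite !ltW].
have hQ : Q%:R `^ s <= Q%:R :> R by apply: powR_le_self => //; rewrite !ltW.
have hN : N%:R `^ (1 - s) <= N%:R :> R by apply: powR_le_self => //; apply/andP; split; lra.
rewrite !powRM ?mulr_ge0 ?(ltW Q0) ?(ltW l0) //.
apply: (@le_trans _ _ (c * (N%:R * (4 * Q%:R * l `^ s)))).
  rewrite ler_wpM2l //; apply: ler_pM; rewrite ?powR_ge0 ?mulr_ge0 ?powR_ge0 //.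
  by rewrite ler_wpM2r ?powR_ge0 //; apply: ler_pM; rewrite ?powR_ge0.
apply: (@le_trans _ _ (4 * k * l `^ s)).
  by rewrite le_eqVlt; apply/orP; left; apply/eqP; rewrite /c; field; rewrite !gt_eqF.
by rewrite ler_wpM2r ?(ltW ls) // ler_wpM2r //; clear; lra.
Qed.

Lemma tr_bump0 a w : 0 < w -> w <= 1 -> 0 <= a <= 1 -> tr (bump a w) 0 0 = 1.
Proof.
move=> w0 w1 a01; rewrite -(lint_bump w0 w1 a01); apply: eq_lint => x _.
by rewrite mulr0 addr0 cs0 mulr1.
Qed.

(* Near the multiples of [Q] the oscillation [cs (x * xi)] is in phase at all teeth. *)
Lemma tr_comb_ge k Q N w xi (n : nat) (h : R) : (0 < N)%N -> (6 * N <= Q)%N -> 0 < w ->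
  w * Q%:R <= 1 -> 0 <= k -> n%:R * Q%:R * w <= 1 / 64 -> N%:R / Q%:R * h <= 1 / 64 ->
  `|xi - n%:R * Q%:R| <= h -> k / Q%:R / 2 <= tr (comb k Q N w) xi 0.
Proof.
move=> N0 NQ w0 wQ k0 hn hh hxi.
have Q1 : (1 : R) <= Q%:R by rewrite ler1n; lia.
have Q0 : (0 : R) < Q%:R by apply: lt_le_trans Q1.
have Np : (0 : R) < N%:R by rewrite ltr0n.
have w1 : w <= 1 by apply: le_trans wQ; rewrite ler_peMr // ltW.
have h0 : 0 <= h by apply: le_trans hxi.
rewrite tr_comb //.
apply: (@le_trans _ _ (k / (Q%:R * N%:R) * \sum_(r < N) (1 / 2))).
  rewrite sumr_const card_ord -[1 / 2 *+ N]mulr_natr le_eqVlt; apply/orP; left; apply/eqP.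
  by field; rewrite !gt_eqF.
rewrite ler_wpM2l ?divr_ge0 ?mulr_ge0 //; apply: ler_sum => r _.
have a01 := node01 N0 NQ (ltn_ord r); have tb := test_fun_bump w0 w1 a01.
have -> : 1 / 2 = tr (fun x => 1 / 2 * bump (node Q N r) w x) 0 0.
  by rewrite trZ // tr_bump0 // mulr1.
apply: le_lint => //; [by apply: test_fun_cs; exact: test_funZ | exact: test_fun_cs |].
move=> x _; rewrite mulr0 addr0 cs0 mulr1 mulrC addr0.
have [->|nz] := eqVneq (bump (node Q N r) w x) 0; first by rewrite !mul0r.
apply: ler_wpM2l; first exact: bump_ge0.
have xa := bump_supp w0 nz.
(* The phase x xi is y plus an integer. The two parts of y are at most 1/64 and 3/64, and the
   Lipschitz constant 8 of [cs] then leaves a cosine of at least 1/2. *)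
pose y := (x - node Q N r) * (n%:R * Q%:R) + x * (xi - n%:R * Q%:R).
have -> : x * xi = y + ((N + r).+1 * n)%:R.
  have e : node Q N r * Q%:R = (N + r).+1%:R by rewrite /node divfK // gt_eqF.
  by rewrite natrM -e /y; ring.
rewrite csDn; have := lipschitz_cs y 0; rewrite cs0 subr0.
suff h1 : `|y| <= 1 / 16 by rewrite ler_norml; move: h1; clear; lra.
have /andP[_ a2] := node_itv N0 NQ (ltn_ord r).
have xQ : `|x| <= 3 * (N%:R / Q%:R).
  have iQ : w <= N%:R / Q%:R.
    by rewrite ler_pdivlMr //; apply: le_trans wQ _; rewrite ler1n.
  move: xa iQ a2 a01; rewrite -[2 * _ / _]mulrA; move: (node Q N r) (N%:R / Q%:R : R).
  by clear => c u; rewrite ltr_norml ler_norml; lra.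
have e1 : `|(x - node Q N r) * (n%:R * Q%:R)| <= 1 / 64.
  rewrite normrM [X in _ * X]ger0_norm ?mulr_ge0 //.
  by apply: le_trans hn; rewrite mulrC ler_wpM2l ?mulr_ge0 // ltW.
have e2 : `|x * (xi - n%:R * Q%:R)| <= 3 * (1 / 64).
  rewrite normrM; apply: le_trans (ler_pM _ _ xQ hxi) _ => //.
  by rewrite -mulrA; apply: ler_wpM2l.
by apply: le_trans (ler_normD _ _) _; move: e1 e2; clear; lra.
Qed.

End Comb.

(** * Real Fourier transforms of measures *)

Section Measures.
Context {R : realType}.
Implicit Types (nu : {measure set (measurableTypeR R) -> \bar R}) (u : R -> R) (xi p : R).

Lemma sum_half_le (C : R) n : 0 <= C -> \sum_(i < n) C / 2 ^+ i <= 2 * C.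
Proof.
move=> C0; suff -> : \sum_(i < n) C / 2 ^+ i = 2 * C - 2 * C / 2 ^+ n.
  by rewrite gerBl divr_ge0 ?mulr_ge0 ?exprn_ge0.
elim: n => [|n IH]; first by rewrite big_ord0 expr0 divr1 subrr.
by rewrite big_ord_recr /= IH exprS; field; rewrite expf_neq0.
Qed.

Lemma nneseries_half_le (f : nat -> \bar R) (C : R) : 0 <= C -> (forall n, 0 <= f n)%E ->
  (forall n, f n <= (C / 2 ^+ n)%:E)%E -> (\sum_(0 <= n <oo) f n <= (2 * C)%:E)%E.
Proof.
move=> C0 f0 fC; apply: lime_le; first by apply: is_cvg_nneseries => n _ _; exact: f0.
apply: nearW => n; apply: le_trans (_ : (\sum_(0 <= i < n) (C / 2 ^+ i)%:E <= _)%E).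
  by apply: lee_sum => i _; exact: fC.
by rewrite big_mkord sumEFin lee_fin sum_half_le.
Qed.

Lemma integrable_cs nu xi p : (nu setT < +oo)%E ->
  nu.-integrable setT (EFin \o (fun x => cs (x * xi + p))).
Proof.
move=> fin.
have h := integrable_bounded_mul measurableT (integrable_one measurableT fin)
  (@continuous_cs_affine R xi p) (fun x => norm_cs _).
by apply: eq_integrable h => // x _ /=; rewrite mulr1.
Qed.

(** Adding 1 makes the integrand nonnegative, so that series and multiples of measures can be
    handled by monotone convergence before the mass is subtracted again. *)
Lemma mtrE nu xi p : (nu setT < +oo)%E ->
  (\int[nu]_x (1 + cs (x * xi + p))%:E = nu setT + (mtr nu xi p)%:E)%E.
Proof.
move=> fin; have i1 := integrable_one measurableT fin; have i2 := integrable_cs xi p fin.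
under eq_integral do rewrite EFinD.
rewrite (integralD measurableT i1 i2) integral_cst // mul1e; congr (_ + _)%E.
by rewrite /mtr /Rintegral fineK //; exact: integrable_fin_num.
Qed.

Lemma mtr_series_le (nu : {measure set (measurableTypeR R) -> \bar R} ^nat) xi p (C : R) : 0 <= C ->
  (forall n, nu n setT < +oo)%E -> (mseries nu 0 setT < +oo)%E ->
  (forall n, mtr (nu n) xi p <= C / 2 ^+ n) -> mtr (mseries nu 0) xi p <= 2 * C.
Proof.
move=> C0 fin finS h.
have c0 x : (0 <= (1 + cs (x * xi + p))%:E)%E.
  by rewrite lee_fin; have := norm_cs (x * xi + p); rewrite ler_norml; lra.
have mf : measurable_fun setT (fun x : measurableTypeR R => (1 + cs (x * xi + p))%:E).
  apply/measurable_EFinP; apply: continuous_measurable_fun => x.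
  by apply: cvgD; [exact: cvg_cst | exact: continuous_cs_affine].
have := mtrE xi p finS.
rewrite ge0_integral_measure_series //.
under eq_eseriesr do rewrite mtrE //.
move=> e; rewrite -lee_fin.
have fS : mseries nu 0 setT \is a fin_num by rewrite ge0_fin_numE.
rewrite -(@leeD2lE _ _ _ _ fS) -e.
apply: (@le_trans _ _ (\sum_(0 <= n <oo) (nu n setT + (C / 2 ^+ n)%:E))%E).
  apply: lee_nneseries => n _.
    by move=> _; rewrite -mtrE //; apply: integral_ge0 => x _; exact: c0.
  by rewrite leeD2l // lee_fin.
have p0 n : 0 <= C / 2 ^+ n by rewrite divr_ge0 ?exprn_ge0.
rewrite nneseriesD //; last by move=> n _; rewrite lee_fin.
by rewrite leeD2l // nneseries_half_le // => n; rewrite lee_fin.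
Qed.

Lemma csDhalf (t : R) : cs (t + 1 / 2) = - cs t.
Proof.
by rewrite /cs -cosDpi; congr cos; field.
Qed.

Lemma mtrDhalf nu xi p : (nu setT < +oo)%E -> mtr nu xi (p + 1 / 2) = - mtr nu xi p.
Proof.
move=> fin; rewrite /mtr -mulN1r -RintegralZl //; last exact: integrable_cs.
by apply: eq_Rintegral => x _; rewrite addrA csDhalf mulN1r.
Qed.

(** The one-sided bound [mtr_series_le] is enough, since shifting the phase by 1/2 changes the sign
    of the transform. *)
Lemma norm_mtr_series_le (nu : {measure set (measurableTypeR R) -> \bar R} ^nat) xi (C : R) :
  0 <= C -> (forall n, nu n setT < +oo)%E -> (mseries nu 0 setT < +oo)%E ->
  (forall n p, `|mtr (nu n) xi p| <= C / 2 ^+ n) ->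
  forall p, `|mtr (mseries nu 0) xi p| <= 2 * C.
Proof.
move=> C0 fin finS h p; rewrite ler_norml; apply/andP; split.
  rewrite lerNl -mtrDhalf //; apply: mtr_series_le => // n.
  by apply: le_trans (h n _); exact: ler_norm.
by apply: mtr_series_le => // n; apply: le_trans (h n _); exact: ler_norm.
Qed.

Lemma mtr_scale (c : R) nu nu' xi p : 0 <= c -> (nu setT < +oo)%E ->
  (forall A, measurable A -> nu' A = (c%:E * nu A)%E) -> mtr nu' xi p = c * mtr nu xi p.
Proof.
move=> c0 fin h.
have fin' : (nu' setT < +oo)%E by rewrite h // lte_mul_pinfty.
have e := mtrE xi p fin; have e' := mtrE xi p fin'.
have c1 x : (0 <= (1 + cs (x * xi + p))%:E)%E.
  by rewrite lee_fin; have := norm_cs (x * xi + p); rewrite ler_norml; lra.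
have mf : measurable_fun setT (fun x : measurableTypeR R => (1 + cs (x * xi + p))%:E).
  apply/measurable_EFinP; apply: continuous_measurable_fun => x.
  by apply: cvgD; [exact: cvg_cst | exact: continuous_cs_affine].
have i : (\int[nu']_x (1 + cs (x * xi + p))%:E = c%:E * \int[nu]_x (1 + cs (x * xi + p))%:E)%E.
  rewrite -(ge0_integral_mscale nu measurableT (NngNum c0) mf (fun x _ => c1 x)).
  by apply: eq_measure_integral => A mA _; rewrite h.
have f1 : nu setT \is a fin_num by rewrite ge0_fin_numE.
move: e'; rewrite i e h // muleDr // ?fin_num_adde_defl //.
by rewrite -(fineK f1) -!EFinM -!EFinD => -[] /addrI.
Qed.

Lemma mtr_conull nu (D : set R) xi p : measurable (D : set (measurableTypeR R)) ->
  (nu setT < +oo)%E -> nu (~` D) = 0%E -> mtr nu xi p = \int[nu]_(x in D) cs (x * xi + p).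
Proof.
move=> mD fin nD; rewrite /mtr /Rintegral; congr fine.
by have := negligible_integral (measurableC mD) measurableT (integrable_cs xi p fin) nD;
  rewrite setTD setCK.
Qed.

Lemma norm_mtr_le nu xi p : (nu setT < +oo)%E -> `|mtr nu xi p| <= mtr nu 0 0.
Proof.
move=> fin; apply: le_trans (le_normr_Rintegral measurableT (integrable_cs xi p fin)) _.
apply: le_Rintegral => //.
- exact: (integrable_abse (integrable_cs xi p fin)).
- exact: (integrable_cs 0 0 fin).
by move=> x _; rewrite mulr0 addr0 cs0 norm_cs.
Qed.

Lemma mtr_mass nu : (nu setT < +oo)%E -> (mtr nu 0 0)%:E = nu setT.
Proof.
move=> fin; rewrite -[RHS]mul1e -(@integral_cst _ _ _ nu setT measurableT 1).
rewrite -[RHS]fineK; last first.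
  exact: (integrable_fin_num measurableT (integrable_one measurableT fin)).
by congr EFin; apply: eq_Rintegral => x _; rewrite mulr0 addr0 cs0.
Qed.

Lemma mtr_lip nu xi xi' p : (nu setT < +oo)%E -> nu (~` `]0, 1]%classic) = 0%E ->
  `|mtr nu xi p - mtr nu xi' p| <= 8 * mtr nu 0 0 * `|xi - xi'|.
Proof.
move=> fin n01; have m01 : measurable (`]0, 1]%classic : set (measurableTypeR R)) by exact: measurable_itv.
have iS f : nu.-integrable setT (EFin \o f) -> nu.-integrable (`]0, 1]%classic : set (measurableTypeR R)) (EFin \o f).
  by apply: integrableS.
have i1 := iS _ (integrable_cs xi p fin); have i2 := iS _ (integrable_cs xi' p fin).
have i0 := iS _ (integrable_cs 0 0 fin).
rewrite !(mtr_conull _ _ m01 fin n01) -RintegralB //.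
have iD : nu.-integrable (`]0, 1]%classic : set (measurableTypeR R))
  (EFin \o (fun x => cs (x * xi + p) - cs (x * xi' + p))) := integrableB m01 i1 i2.
apply: le_trans (le_normr_Rintegral m01 iD) _.
rewrite mulrAC -RintegralZl //; apply: le_Rintegral => //.
- exact: (integrable_abse iD).
- exact: (integrableZl m01 _ i0).
move=> x; rewrite /= in_itv /= => /andP[x0 x1].
rewrite mulr0 addr0 cs0 mulr1; apply: le_trans (lipschitz_cs _ _) _.
rewrite ler_wpM2l // opprD addrACA subrr addr0 -mulrBr normrM (ger0_norm (ltW x0)).
by rewrite ler_piMl.
Qed.

Lemma fourier_absE nu xi : (nu setT < +oo)%E ->
  fourier_abs nu xi = Num.sqrt (mtr nu xi 0 ^+ 2 + mtr nu xi (1 / 4) ^+ 2).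
Proof.
move=> fin; rewrite /fourier_abs /fourier /cintegral /complex.ComplexField.Normc.normc /mtr.
congr (Num.sqrt (_ ^+ 2 + _ ^+ 2)); apply: eq_Rintegral => x _ /=.
  by rewrite /cs addr0 cosN mulrA.
by rewrite /cs sinN -cosDpihalf; congr cos; field.
Qed.

Lemma fourier_abs_le nu xi (B : R) : (nu setT < +oo)%E -> (forall p, `|mtr nu xi p| <= B) ->
  fourier_abs nu xi <= 2 * B.
Proof.
move=> fin h; rewrite fourier_absE //.
have B0 : 0 <= B := le_trans (normr_ge0 _) (h 0).
rewrite -[leRHS](ger0_norm (_ : 0 <= 2 * B)) ?mulr_ge0 // -sqrtr_sqr ler_wsqrtr //.
rewrite -[mtr nu xi 0 ^+ 2]real_normK ?num_real // -[mtr nu xi (1 / 4) ^+ 2]real_normK ?num_real //.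
have := h 0; have := h (1 / 4).
by move: (normr_ge0 (mtr nu xi 0)) (normr_ge0 (mtr nu xi (1 / 4))); clear -B0; nra.
Qed.

Lemma mtr_le_fourier_abs nu xi : (nu setT < +oo)%E -> mtr nu xi 0 <= fourier_abs nu xi.
Proof.
move=> fin; rewrite fourier_absE //; apply: le_trans (ler_norm _) _.
by rewrite -sqrtr_sqr ler_wsqrtr // lerDl sqr_ge0.
Qed.

Lemma continuous_fourier_abs nu : (nu setT < +oo)%E -> nu (~` `]0, 1]%classic) = 0%E ->
  continuous (fourier_abs nu).
Proof.
move=> fin n01; have -> : fourier_abs nu =
    (fun xi => Num.sqrt (mtr nu xi 0 ^+ 2 + mtr nu xi (1 / 4) ^+ 2)).
  by apply/funext => xi; exact: fourier_absE.
have c p : continuous (fun xi => mtr nu xi p).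
  by apply: lip_continuous => x y; exact: mtr_lip.
move=> x; apply: continuous_comp; last exact: sqrt_continuous.
by apply: cvgD; rewrite /=; [apply: cvgM; exact: c | apply: cvgM; exact: c].
Qed.

End Measures.

(** * Frostman measures and Lebesgue norms *)

Section Norms.
Context {R : realType}.
Implicit Types (nu : {measure set (measurableTypeR R) -> \bar R}) (F : R -> R).

Lemma frostman_null nu (C s a : R) : 0 <= C -> 0 < s ->
  (forall a b : R, a <= b -> (nu `]a, b]%classic <= (C * (b - a) `^ s)%:E)%E) -> nu [set a] = 0%E.
Proof.
move=> C0 s0 h; apply/eqP; rewrite eq_le measure_ge0 andbT.
apply/lee_addgt0Pr => e e0; rewrite add0e.
have C1 : 0 < C + 1 by rewrite ltr_wpDl.
pose d := (e / (C + 1)) `^ s^-1; have d0 : 0 < d by rewrite powR_gt0 // divr_gt0.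
apply: (@le_trans _ _ (nu `](a - d)%R, a]%classic)).
  apply: le_measure; rewrite ?inE; [exact: measurable_set1 | exact: measurable_itv |].
  by move=> x /= ->; rewrite in_itv /= lexx andbT gtrBl.
apply: le_trans (h _ _ _) _; first by rewrite gerBl ltW.
rewrite lee_fin subKr /d -powRrM mulVf ?gt_eqF // powRr1 ?divr_ge0 ?(ltW e0) ?(ltW C1) //.
by rewrite mulrA ler_pdivrMr // mulrC ler_wpM2l ?(ltW e0) // lerDl.
Qed.

Lemma frostman_interval nu (C s eps : R) : 0 <= C -> 0 < s -> nu setT = 1%E ->
  (forall a b : R, a <= b -> (nu `]a, b]%classic <= (C * (b - a) `^ s)%:E)%E) ->
  0 < eps -> eps <= s -> exists K : R, 0 < K /\ forall I : interval R,
    (nu [set` I] <= K%:E * (lebesgue_measure [set` I] `^ (s - eps)))%E.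
Proof.
(* The added 1 bounds the total mass, which is used for intervals longer than 1 and for unbounded
   ones, including the case eps = s where [+oo] to the power 0 is 1. *)
move=> C0 s0 n1 h e0 es; exists (C + 1); split; first by rewrite ltr_wpDl.
have C1 : (1 <= (C + 1)%:E)%E by rewrite lee_fin lerDr.
have mI (I : interval R) : measurable ([set` I] : set (measurableTypeR R)) by exact: measurable_itv.
have nI1 (I : interval R) : (nu [set` I] <= 1)%E.
  by rewrite -n1; apply: le_measure; rewrite ?inE; [exact: mI | exact: measurableT |].
have inf (I : interval R) : lebesgue_measure [set` I] = +oo%E ->
    (nu [set` I] <= (C + 1)%:E * (lebesgue_measure [set` I] `^ (s - eps)))%E.
  move=> ->; apply: le_trans (nI1 I) _; have [->|ne] := eqVneq (s - eps) 0.
    by rewrite poweRe0 mule1.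
  by rewrite poweRyr // gt0_muley ?leey // lte_fin ltr_wpDl.
have emp (I : interval R) : [set` I] = set0 ->
    (nu [set` I] <= (C + 1)%:E * (lebesgue_measure [set` I] `^ (s - eps)))%E.
  by move=> ->; rewrite measure0 mule_ge0 ?poweR_ge0 // lee_fin addr_ge0.
move=> I; have lI := lebesgue_measure_itv I; move: I lI => [[bl x|[]] [br y|[]]] /= lI.
- have [xy|yx] := leP x y; last first.
    apply: emp; rewrite -subset0 => t /= ht; have : t \in Interval (BSide bl x) (BSide br y) by [].
    case: (bl) (br) => -[]; rewrite in_itv /= => /andP[h1 h2]; move: h1 h2 yx; clear; lra.
  have lE : lebesgue_measure [set` Interval (BSide bl x) (BSide br y)] = (y - x)%:E.
    rewrite [LHS]lI lte_fin; case: ltP => // yx.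
    by have -> : y = x by [apply/eqP; rewrite eq_le yx xy]; rewrite subrr.
  rewrite lE poweR_EFin -EFinM.
  have hI : (nu [set` Interval (BSide bl x) (BSide br y)] <= (C * (y - x) `^ s)%:E)%E.
    apply: (@le_trans _ _ (nu `[x, y]%classic)).
      apply: le_measure; rewrite ?inE //.
      by apply: subset_itv; case: (bl) (br) => -[] //=; rewrite !bnd_simp.
    rewrite -(@setU1itv _ _ _ _ false) ?bnd_simp //.
    apply: le_trans (measureU2 nu (measurable_set1 x) (measurable_itv _)) _.
    rewrite -[leRHS]add0e; apply: leeD; last exact: h.
    by rewrite -(frostman_null x C0 s0 h).
  have [l1|l1] := leP (y - x) 1.
    apply: le_trans hI _; rewrite lee_fin; apply: ler_pM; rewrite ?powR_ge0 ?lerDl //.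
    have [->|l0] := eqVneq (y - x) 0; first by rewrite powR0 ?powR_ge0 ?gt_eqF.
    by rewrite ger_powR ?gerBl ?(ltW e0) // lt0r l0 subr_ge0 xy.
  apply: le_trans (nI1 _) _; rewrite lee_fin -[leLHS]mul1r; apply: ler_pM; rewrite ?lerDr //.
  by rewrite -[leLHS](powRr0 (y - x)) ler_powR ?subr_ge0 // ltW.
- by apply: emp; rewrite set_itv_ge // bnd_simp.
- by apply: inf; rewrite [LHS]lI ?ltry ?ltNyr.
- by apply: inf; rewrite [LHS]lI ?ltry ?ltNyr.
- by apply: emp; rewrite set_itv_ge // bnd_simp.
- by apply: inf; rewrite [LHS]lI ?ltry ?ltNyr.
- by apply: emp; rewrite set_itv_ge // bnd_simp.
- by apply: emp; rewrite set_itv_ge // bnd_simp.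
- by apply: emp; rewrite set_itv_ge // bnd_simp.
Qed.

Lemma measure_periodic_itvs (Q h : R) (K : nat) : 0 < h -> 2 * h < Q ->
  exists S : set R, [/\ measurable S, lebesgue_measure S = (K%:R * (2 * h))%:E &
    forall x, S x -> exists2 n : nat, (n < K)%N & `|x - n.+1%:R * Q| <= h].
Proof.
(* The induction also carries an upper bound of S, from which the next interval is disjoint because
   2h < Q. *)
move=> h0 hQ; suff [S [h1 h2 h3 _]] : exists S : set R, [/\ measurable S,
    lebesgue_measure S = (K%:R * (2 * h))%:E,
    forall x, S x -> exists2 n : nat, (n < K)%N & `|x - n.+1%:R * Q| <= h &
    forall x, S x -> x <= K%:R * Q + h] by exists S.
elim: K => [|K [S [mS lS hS bS]]].
  by exists set0; split => //; rewrite ?measure0 ?mul0r.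
pose I : set R := `](K.+1%:R * Q - h), (K.+1%:R * Q + h)]%classic.
have mI : measurable I by exact: measurable_itv.
have K1 : K.+1%:R = K%:R + 1 :> R by rewrite natr1.
exists (S `|` I); split.
- exact: measurableU.
- rewrite measureU //; last first.
    rewrite -subset0 => x [/bS h1]; rewrite /I /= in_itv /= K1 => /andP[h2 _].
    by move: h1 h2 hQ; clear; nra.
  apply: etrans (congr2 adde lS (lebesgue_measure_itv _)) _.
  rewrite /= lte_fin ifT; last by move: h0; clear; lra.
  by rewrite K1; congr EFin; ring.
- move=> x [/hS[n nK hn]|]; first by exists n => //; exact: ltnW.
  rewrite /I /= in_itv /= => /andP[h1 h2]; exists K => //.
  by rewrite ler_norml; move: h1 h2; clear; lra.
- move=> x [/bS h1|]; last by rewrite /I /= in_itv /= => /andP[_].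
  by rewrite K1; move: h1 h0 hQ; clear; nra.
Qed.

Lemma Lnorm_ge F (Q h c p : R) (K : nat) : continuous F -> 0 < h -> 2 * h < Q -> 0 <= c -> 1 <= p ->
  (forall (n : nat) xi, (n < K)%N -> `|xi - n.+1%:R * Q| <= h -> c <= F xi) ->
  ((c * (K%:R * (2 * h)) `^ p^-1)%:E <= 'N[@lebesgue_measure R]_(p%:E)[EFin \o F])%E.
Proof.
move=> cF h0 hQ c0 p1 hF; have [S [mS lS hS]] := measure_periodic_itvs K h0 hQ.
have p0 : 0 < p by lra.
have mF : measurable_fun setT (fun x : R => (`|(EFin \o F) x| `^ p)%E).
  have -> : (fun x : R => (`|(EFin \o F) x| `^ p)%E) = EFin \o (fun x => `|F x| `^ p).
    by apply/funext.
  apply/measurable_EFinP; apply: (measurableT_comp (measurable_powR _)) => //.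
  by apply: measurableT_comp => //; exact: continuous_measurable_fun.
have h1 : ((c `^ p * (K%:R * (2 * h)))%:E <= \int[@lebesgue_measure R]_x (`|(EFin \o F) x| `^ p))%E.
  apply: le_trans (_ : \int[@lebesgue_measure R]_(x in S) (`|(EFin \o F) x| `^ p) <= _)%E; last first.
    apply: ge0_subset_integral => //; by move=> x _; exact: poweR_ge0.
  rewrite EFinM -lS -(@integral_cst _ _ _ (@lebesgue_measure R) S mS).
  apply: ge0_le_integral => //.
  - by move=> x _; rewrite lee_fin powR_ge0.
  - exact: measurable_funTS.
  - move=> x /hS[n nK hn]; rewrite /= lee_fin.
    apply: ge0_ler_powR; rewrite ?nnegrE ?(ltW p0) //.
    by apply: le_trans (ler_norm _); exact: hF hn.
rewrite Lnorm.unlock; apply: le_trans (gt0_ler_poweR _ _ _ h1).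
- have Kh : 0 <= K%:R * (2 * h) by rewrite !mulr_ge0 // ltW.
  rewrite poweR_EFin lee_fin; set v := K%:R * _ in Kh *; rewrite (powRM _ _ Kh) ?powR_ge0 //.
  by rewrite -powRrM mulfV ?gt_eqF // powRr1.
- by rewrite invr_ge0 ltW.
- by rewrite in_itv /= leey andbT lee_fin mulr_ge0 ?powR_ge0 ?mulr_ge0 // ltW.
- have i0 : (0 <= \int[@lebesgue_measure R]_x (`|(EFin \o F) x| `^ p))%E.
    by apply: integral_ge0 => x _; exact: poweR_ge0.
  by rewrite in_itv /= leey andbT.
Qed.

Lemma Lnorm_indic nu (A : set R) (q : R) : measurable (A : set (measurableTypeR R)) -> 0 < q ->
  ('N[nu]_(q%:E)[EFin \o (\1_A : R -> R)] = nu A `^ q^-1)%E.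
Proof.
move=> mA q0; rewrite Lnorm.unlock; congr (_ `^ _)%E.
transitivity (\int[nu]_x (\1_A x)%:E)%E.
  apply: eq_integral => x _ /=; rewrite indicE; case: (_ \in _).
    by rewrite normr1 powR1.
  by rewrite normr0 powR0 // gt_eqF.
by rewrite integral_indic // setIT.
Qed.

End Norms.

(** * Assembling the blocks *)

Section Blocks.
Context {R : realType}.
Implicit Types (nu : {measure set (measurableTypeR R) -> \bar R}) (k : R) (Q N : nat).

Lemma gauge_bounded (tau : R) : 0 < tau -> exists2 C : R, 1 <= C & forall xi, gauge tau xi <= C.
Proof.
move=> t0; have [C C0 h] := gauge_le_powR tau t0; exists (1 + C); first by rewrite lerDl ltW.
by move=> xi; have := h xi; rewrite addNr powRr0 mulr1; lra.
Qed.

(** The constants leave room for passing from a comb to its limit: 3 = 2 + 1 and 9 = 8 + 1 add the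
    error delta <= k to the comb bounds, and the peak bound k / (2Q) loses k / (4Q). *)
Definition block (alpha beta k : R) Q N nu : Prop :=
  [/\ (nu setT < +oo)%E /\ nu (~` `](N%:R / Q%:R), (3 * N%:R / Q%:R)]%classic) = 0%E,
    forall xi p, `|mtr nu xi p| <= 3 * k * gauge (1 / (2 + alpha)) xi,
    forall a b : R, a <= b ->
      (nu `]a, b]%classic <= (9 * k * (b - a) `^ ((2 + beta) / (2 + alpha)))%:E)%E,
    msupport nu `<=` well_approximable alpha &
    mtr nu 0 0 <= 2 * (k / Q%:R) /\
    forall (n : nat) xi, n.+1%:R <= Q%:R `^ (1 + alpha) / 64 ->
      `|xi - n.+1%:R * Q%:R| <= Q%:R `^ (- beta) / 64 -> k / Q%:R / 4 <= mtr nu xi 0].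

Lemma block_exists (alpha beta k : R) Q N : 0 < alpha -> -1 < beta < 0 -> (0 < N)%N ->
  (6 * N <= Q)%N -> Q%:R `^ (1 + beta) <= 2 * N%:R -> N%:R <= Q%:R `^ (1 + beta) -> 0 < k ->
  exists nu, block alpha beta k Q N nu.
Proof.
move=> alpha0 hb N0 NQ QN NQ' k0; set w := Q%:R `^ (- (2 + alpha)) : R.
pose tau : R := 1 / (2 + alpha); have t0 : 0 < tau by apply: divr_gt0; lra.
have [G G1 hG] := gauge_bounded t0.
have Q1 : (1 : R) <= Q%:R by rewrite ler1n; lia.
have Q0 : (0 : R) < Q%:R by apply: lt_le_trans Q1.
have Np : (0 : R) < N%:R by rewrite ltr0n.
have w0 : 0 < w by rewrite powR_gt0.
have w1 : w <= 1 by rewrite /w -[leRHS](powRr0 Q%:R) ler_powR //; lra.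
have wE : w * Q%:R = (Q%:R `^ (1 + alpha))^-1.
  by rewrite -[X in w * X](powRr1 (ltW Q0)) -powRD_gt0 // -powRN; congr powR; ring.
have Qa : 1 <= Q%:R `^ (1 + alpha) by rewrite -[leLHS](powRr0 Q%:R) ler_powR //; lra.
have wQ : w * Q%:R <= 1 by rewrite wE invf_le1 // (lt_le_trans ltr01).
(* As [gauge] is at most G, the transform moves by at most k / (4Q) at every frequency. *)
pose delta := k / Q%:R / (4 * G).
have G0 : 0 < G by lra.
have kQ0 : 0 < k / Q%:R by rewrite divr_gt0.
have d0 : 0 < delta by rewrite divr_gt0 // mulr_gt0.
have kQ : k / Q%:R <= k by rewrite ler_pdivrMr // ler_peMr // ltW.
have dk : delta <= k.
  by rewrite ler_pdivrMr ?mulr_gt0 //; apply: le_trans kQ _; rewrite ler_peMr ?(ltW k0) //; lra.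
have dG xi : delta * gauge tau xi <= k / Q%:R / 4.
  apply: le_trans (ler_wpM2l (ltW d0) (hG xi)) _.
  by rewrite le_eqVlt; apply/orP; left; apply/eqP; rewrite /delta; field; rewrite !gt_eqF.
have s0 : 0 < (2 + beta) / (2 + alpha) by apply: divr_gt0; lra.
have s2 : (2 + beta) / (2 + alpha) * (2 + alpha) < 2 by rewrite divfK; lra.
have a00 : 0 < N%:R / Q%:R :> R by rewrite divr_gt0.
have hg := density_comb N0 NQ w0 wQ (ltW k0).
have fr := frostman_comb alpha0 hb N0 NQ QN (ltW k0).
have k8 : 0 <= 8 * k by rewrite mulr_ge0 // ltW.
have [nu [h1 h2 h3 h4 h5]] := limit_measure alpha0 s0 s2 a00 hg d0 k8 fr.
exists nu; split => //.
- by split => //; apply: h5 => x; exact: comb_supp_itv.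
- move=> xi p; have := h1 xi p; have := tr_comb_le_gauge xi p alpha0 N0 NQ (ltW k0).
  have : delta * gauge tau xi <= k * gauge tau xi by rewrite ler_wpM2r // ltW // gauge_gt0.
  rewrite -/w -/tau !ler_norml; clear; lra.
- move=> a b ab; apply: le_trans (h3 a b ab) _; rewrite lee_fin ler_wpM2r ?powR_ge0 //.
  by move: dk; clear; lra.
split.
  have := h1 0 0; have := dG 0; rewrite -/tau.
  have := @norm_tr_comb_le R k Q N w 0 0 1 N0 NQ w0 w1 (ltW k0) (fun a h => tr_bump_le1 _ _ w0 w1 h).
  by rewrite mulr1 !ler_norml; move: kQ0; clear; lra.
move=> n xi hn hxi; have := h1 xi 0; have := dG xi; rewrite -/tau.
have := @tr_comb_ge R k Q N w xi n.+1 _ N0 NQ w0 wQ (ltW k0) _ _ hxi.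
have e1 : n.+1%:R * Q%:R * w <= 1 / 64.
  rewrite -mulrA [_ * w]mulrC wE ler_pdivrMr ?(lt_le_trans ltr01) //.
  by apply: le_trans hn _; rewrite mulrC mul1r.
have e2 : N%:R / Q%:R * (Q%:R `^ (- beta) / 64) <= 1 / 64.
  rewrite mulrA ler_wpM2r ?invr_ge0 // mulrAC ler_pdivrMr // mul1r.
  apply: le_trans (ler_wpM2r (powR_ge0 _ _) NQ') _.
  by rewrite -powRD_gt0 // addrK powRr1 // ltW.
by move=> /(_ e1 e2); rewrite !ler_norml; clear; lra.
Qed.

Lemma block_parameters (beta : R) : -1 < beta < 0 -> exists Q N : nat -> nat,
  [/\ forall j, [/\ (0 < N j)%N, (6 * N j <= Q j)%N, (Q j)%:R `^ (1 + beta) <= 2 * (N j)%:R &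
        (N j)%:R <= (Q j)%:R `^ (1 + beta)],
    forall j, 3 * (N j.+1)%:R / (Q j.+1)%:R < (N j)%:R / (Q j)%:R :> R,
    forall j, (64 <= Q j)%N &
    forall (theta C : R), 0 < theta -> exists2 j, (0 < j)%N & C * 2 ^+ j <= (Q j)%:R `^ theta].
Proof.
move=> hb; have b0 : 0 < - beta by lra.
(* Exceeding 6^(-1 / beta) makes B^beta < 1/6, which gives both 6 N <= Q and the separation of
   consecutive blocks. *)
pose B := (64 + Num.truncn ((6 : R) `^ (- beta)^-1)).+1.
have B64 : (64 <= B)%N by rewrite /B; lia.
have BR : (6 : R) `^ (- beta)^-1 < B%:R.
  by apply: lt_le_trans (truncnS_gt _) _; rewrite ler_nat ltnS leq_addl.
have B6 : 6 < B%:R `^ (- beta).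
  have : ((6 : R) `^ (- beta)^-1) `^ (- beta) < B%:R `^ (- beta).
    by apply: gt0_ltr_powR; rewrite ?nnegrE ?powR_ge0.
  by rewrite -powRrM mulVf ?gt_eqF // powRr1.
have Bp : (0 : R) < B%:R by rewrite ltr0n; lia.
have B1 : (1 : R) <= B%:R by rewrite ler1n; lia.
clearbody B.
(* The quadratic exponent lets every positive power of Q j outgrow 2^j, while N j is the integer
   part of (Q j)^(1 + beta). *)
pose Q j := (B ^ (j.+1 ^ 2))%N; pose N j := Num.truncn ((Q j)%:R `^ (1 + beta)).
have QB j : (B <= Q j)%N by rewrite /Q -{1}(expn1 B) leq_pexp2l //; lia.
have QBR j : B%:R <= (Q j)%:R :> R by rewrite ler_nat.
have Qp j : (0 : R) < (Q j)%:R by apply: lt_le_trans (QBR j).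
have Q1 j : (1 : R) <= (Q j)%:R by apply: le_trans (QBR j).
have Q6 j : 6 * (Q j)%:R `^ beta < 1.
  have : B%:R `^ (- beta) <= (Q j)%:R `^ (- beta).
    by apply: ge0_ler_powR; rewrite ?nnegrE ?(ltW b0).
  move=> /(lt_le_trans B6); rewrite powRN -ltr_pdivlMr ?mul1r ?powR_gt0 //.
have Qb j : (Q j)%:R `^ (1 + beta) = (Q j)%:R * (Q j)%:R `^ beta.
  by rewrite powRD_gt0 // powRr1 // ltW.
have Q1b j : 1 <= (Q j)%:R `^ (1 + beta).
  by rewrite -[leLHS](powRr0 (Q j)%:R) ler_powR //; lra.
have Ni j : (N j)%:R <= (Q j)%:R `^ (1 + beta) < (N j)%:R + 1.
  by rewrite natr1; apply: truncn_itv; apply: le_trans (Q1b j).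
have N1 j : (0 < N j)%N.
  rewrite lt0n; apply/negP => /eqP e; have := Ni j; have := Q1b j; rewrite e; lra.
have N1R j : (1 : R) <= (N j)%:R by rewrite ler1n.
have QN j : (Q j)%:R `^ (1 + beta) <= 2 * (N j)%:R by have := Ni j; have := N1R j; lra.
exists Q, N; split.
- move=> j; split => //; last by have /andP[] := Ni j.
  rewrite -(ler_nat R) natrM; have /andP[h _] := Ni j.
  apply: (@le_trans _ _ (6 * (Q j)%:R `^ (1 + beta))); first by rewrite ler_wpM2l.
  by rewrite Qb mulrCA ler_piMr ?(ltW (Qp j)) // ltW.
- move=> j; apply: (@le_lt_trans _ _ (3 * (Q j.+1)%:R `^ beta)).
    rewrite ler_pdivrMr // -mulrA ler_wpM2l // [leRHS]mulrC -Qb.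
    by have /andP[] := Ni j.+1.
  apply: (@lt_le_trans _ _ ((Q j)%:R `^ beta / 2)); last first.
    rewrite ler_pdivrMr // mulrAC ler_pdivlMr // mulrC -Qb mulrC.
    by have := QN j; rewrite mulrC.
  have e : Q j.+1 = (Q j * B ^ (2 * j + 3))%N by rewrite /Q -expnD; congr expn; lia.
  have h : (Q j.+1)%:R `^ beta = (Q j)%:R `^ beta * (B ^ (2 * j + 3))%:R `^ beta.
    by rewrite e natrM powRM.
  rewrite h mulrCA ltr_pM2l ?powR_gt0 //.
  have : B%:R `^ (- beta) <= (B ^ (2 * j + 3))%:R `^ (- beta).
    apply: ge0_ler_powR; rewrite ?nnegrE ?(ltW b0) // ler_nat -{1}(expn1 B) leq_pexp2l //; lia.
  move=> /(lt_le_trans B6); rewrite powRN.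
  have Yp : 0 < (B ^ (2 * j + 3))%:R `^ beta :> R by rewrite powR_gt0 // ltr0n expn_gt0; lia.
  rewrite -ltr_pdivlMr ?mul1r // ; lra.
- by move=> j; exact: leq_trans (QB j).
move=> theta C th0.
(* C is at most 2^m, and j is large enough for theta (j + 1)^2 to exceed m + j. *)
pose m := (Num.truncn (`|C| / 1)).+1; pose j := (Num.truncn ((m%:R + 1) / theta)).+1.
have Cm : C <= 2 ^+ m.
  apply: le_trans (ler_norm _) _; rewrite -[`|C|]divr1; apply: ltW.
  apply: lt_le_trans (truncnS_gt _) _; rewrite -natrX ler_nat; exact: ltnW (ltn_expl _ _).
have jt : m%:R + 1 <= theta * j.+1%:R.
  rewrite mulrC -ler_pdivrMr //; apply: ltW; apply: lt_le_trans (truncnS_gt _) _.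
  by rewrite ler_nat.
exists j => //.
apply: (@le_trans _ _ (2 ^+ (m + j))).
  by rewrite exprD ler_wpM2r // exprn_ge0.
have -> : 2 ^+ (m + j) = 2 `^ (m + j)%:R :> R by rewrite powR_mulrn.
apply: (@le_trans _ _ (2 `^ (theta * (j.+1 ^ 2)%:R))).
  rewrite ler_powR ?ler1n // natrD natrX expr2 mulrA.
  apply: (@le_trans _ _ ((m%:R + 1) * j.+1%:R)); last by rewrite ler_wpM2r.
  rewrite mulrDl mul1r; apply: lerD; last by rewrite ler_nat.
  by rewrite ler_peMr // ler1n.
rewrite [theta * _]mulrC powRrM; apply: ge0_ler_powR; rewrite ?nnegrE ?powR_ge0 ?(ltW th0) //.
rewrite powR_mulrn // -natrX ler_nat /Q leq_exp2r // ?expn_gt0 //; lia.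
Qed.

End Blocks.

(** * Sums of blocks and the ratio of norms *)

Section Assembly.
Context {R : realType}.
Implicit Types (nu mu : {measure set (measurableTypeR R) -> \bar R}) (A J : set R).

Lemma open_measurableTypeR (U : set R) : open U -> measurable (U : set (measurableTypeR R)).
Proof. exact: open_measurable. Qed.

(** Only the first n measures charge U. If x were in none of their supports, intersecting U with
    finitely many null neighbourhoods would give a null neighbourhood for the whole series. *)
Lemma mseries_support (nu : {measure set (measurableTypeR R) -> \bar R} ^nat) mu (c : \bar R)
    (x : R) (U : set R) (n : nat) :
  (forall A, mu A = (c * mseries nu 0 A)%E) -> msupport mu x -> open U -> U x ->
  (forall j, (n <= j)%N -> nu j U = 0%E) -> exists j, msupport (nu j) x.
Proof.
move=> muE xs oU Ux hU; apply/not_existsP => nx.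
have [V [oV Vx hV]] : exists V : set R, [/\ open V, V x & forall j, (j < n)%N -> nu j V = 0%E].
  elim: {hU} n => [|n [V [oV Vx hV]]]; first by exists setT; split => //; exact: openT.
  have [W [oW Wx hW]] : exists W : set R, [/\ open W, W x & nu n W = 0%E].
    apply: contrapT => h; apply: (nx n) => W oW Wx; rewrite lt0e measure_ge0 andbT.
    by apply/negP => /eqP W0; apply: h; exists W.
  exists (V `&` W); split => //; [exact: openI | move=> j].
  rewrite ltnS leq_eqVlt => jn; apply/eqP; rewrite eq_le measure_ge0 andbT.
  have mV := open_measurableTypeR oV; have mW := open_measurableTypeR oW.
  case/predU1P: jn => [->|jn].
    rewrite -hW; apply: le_measure; rewrite ?inE //; exact: measurableI.
  rewrite -(hV j jn); apply: le_measure; rewrite ?inE //; exact: measurableI.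
have mV := open_measurableTypeR oV; have mU := open_measurableTypeR oU.
have z j : nu j (U `&` V) = 0%E.
  apply/eqP; rewrite eq_le measure_ge0 andbT; have [nj|jn] := leqP n j.
    by rewrite -(hU j nj); apply: le_measure; rewrite ?inE //; exact: measurableI.
  by rewrite -(hV j jn); apply: le_measure; rewrite ?inE //; exact: measurableI.
have := xs _ (openI oU oV) (conj Ux Vx); rewrite muE /mseries.
by rewrite eseries0 ?mule0 ?ltxx // => j _ _; exact: z.
Qed.

Lemma mseries_conull_single (nu : {measure set (measurableTypeR R) -> \bar R} ^nat)
    (J : nat -> set R) (k : nat) A : (forall j, measurable (J j : set (measurableTypeR R))) ->
  (forall j, nu j (~` J j) = 0%E) -> (forall j, j != k -> J k `&` J j = set0) ->
  measurable (A : set (measurableTypeR R)) -> mseries nu 0 (J k `&` A) = nu k A.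
Proof.
move=> mJ nJ dJ mA; have mJA : measurable (J k `&` A : set (measurableTypeR R)) by exact: measurableI.
rewrite /mseries (@nneseriesD1 _ _ k) //.
rewrite eseries0 ?adde0; last first.
  move=> j _ /= jk; apply/eqP; rewrite eq_le measure_ge0 andbT -(nJ j).
  apply: le_measure; rewrite ?inE //; first exact: measurableC.
  by move=> x [Jx _] Jjx; have : (J k `&` J j) x by []; rewrite dJ.
have z : nu k (A `\` J k) = 0%E.
  apply/eqP; rewrite eq_le measure_ge0 andbT -(nJ k); apply: le_measure; rewrite ?inE.
  - exact: measurableD.
  - exact: measurableC.
  - by move=> x [].
rewrite setIC; apply/esym; apply: etrans (measureDI (nu k) mA (mJ k)) _.
by apply: etrans (congr1 (fun t => (t + _)%E) z) _; rewrite add0e.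
Qed.

(** The intervals of the blocks shrink to 0, so 0 may belong to the closed support of their sum
    without belonging to that of any block. *)
Lemma well_approximable0 (alpha : R) : well_approximable alpha 0.
Proof.
apply: well_approximable_unbounded => j; exists j.+1, 0%R; split => //.
by rewrite mul0r subr0 normr0 powR_ge0.
Qed.

Lemma shrinking_itvs (a : nat -> R) : (forall j, 0 < a j) -> (forall j, 3 * a j.+1 < a j) ->
  (forall i j, (i < j)%N -> 3 * a j < a i) /\ forall x : R, 0 < x -> exists n, forall j, (n <= j)%N -> 3 * a j < x.
Proof.
move=> a0 ha; have dec i j : (i < j)%N -> 3 * a j < a i.
  elim: j => // j IH; rewrite ltnS leq_eqVlt => /predU1P[->|/IH h]; first exact: ha.
  by have := ha j; have := a0 j; move: h; clear; lra.
split=> // x x0; have hd n : a n <= a 0 / 2 ^+ n.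
  elim: n => [|n IH]; first by rewrite expr0 divr1.
  have -> : a 0 / 2 ^+ n.+1 = a 0 / 2 ^+ n / 2 by rewrite exprS; field; rewrite expf_neq0.
  by have := ha n; have := a0 n.+1; move: IH; clear; lra.
have [n hn] := @exp_half_small R (3 * a 0) (x / 2) ltac:(lra).
have an : 3 * a n < x.
  have := hd n; move: hn; rewrite -mulrA; move: x0; clear; lra.
exists n => j; rewrite leq_eqVlt => /predU1P[<-//|/dec h].
by have := a0 n; move: an h; clear; lra.
Qed.

(** The peaks have height of order k / Q on a set of measure of order Q^(1 + alpha - beta), and
    m^(1/q) is at most of order Q^(-1/q) because k <= 1. The constant 64 * 64 is 128 * 64 / 2. *)
Lemma ratio_lower_bound (alpha beta p q Z k Q m : R) (K : nat) :
  1 <= p -> 0 < Z -> 1 <= Q -> 0 < k <= 1 -> Q `^ (1 + alpha) / 128 <= K%:R ->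
  0 < q -> 0 < m -> m <= Z * (2 * (k / Q)) ->
  Z / 4 / (64 * 64) * (2 * Z) `^ (- q^-1) * (k * Q `^ ((1 + alpha - beta) / p - (1 - q^-1))) <=
  Z * (k / Q / 4) * (K%:R * (2 * (Q `^ (- beta) / 64))) `^ p^-1 / m `^ q^-1.
Proof.
move=> p1 Z0 Q1 /andP[k0 k1] hK q0 m0 hm.
have Q0 : 0 < Q by lra.
have p0 : 0 < p^-1 by rewrite invr_gt0; lra.
have iq0 : 0 < q^-1 by rewrite invr_gt0.
set a := 1 + alpha - beta.
have e : Q `^ a / (64 * 64) = Q `^ (1 + alpha) / 128 * (2 * (Q `^ (- beta) / 64)).
  by rewrite /a powRD_gt0 //; field.
have D1 : 1 <= 64 * 64 :> R by lra.
move: (64 * 64 : R) e D1 => D e D1; have D0 : 0 < D by lra.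
have h1 : Q `^ (a / p) / D <= (K%:R * (2 * (Q `^ (- beta) / 64))) `^ p^-1.
  apply: (@le_trans _ _ ((Q `^ a / D) `^ p^-1)).
    have -> : (Q `^ a / D) `^ p^-1 = Q `^ (a / p) * D^-1 `^ p^-1.
      by rewrite powRM ?powR_ge0 ?invr_ge0 ?(ltW D0) // -powRrM.
    apply: ler_wpM2l; first exact: powR_ge0.
    rewrite powRV // lef_pV2 ?posrE ?powR_gt0 //; apply: powR_le_self => //.
    by rewrite ltW //= invf_le1 //; lra.
  rewrite e; apply: ge0_ler_powR; rewrite ?nnegrE; first exact: ltW.
  - by rewrite !mulr_ge0 ?powR_ge0.
  - by rewrite !mulr_ge0 ?powR_ge0.
  - by rewrite ler_wpM2r // mulr_ge0 // divr_ge0 ?powR_ge0.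
have h2 : m `^ q^-1 <= (2 * Z) `^ q^-1 * Q `^ (- q^-1).
  have -> : Q `^ (- q^-1) = Q^-1 `^ q^-1 by rewrite powRV // powRN.
  rewrite -powRM ?invr_ge0 ?mulr_ge0 ?(ltW Q0) ?(ltW Z0) //.
  apply: ge0_ler_powR; rewrite ?nnegrE; [exact: ltW | exact: ltW | |].
    by rewrite mulr_ge0 ?invr_ge0 ?mulr_ge0 // ltW.
  apply: le_trans hm _; rewrite mulrA [Z * 2]mulrC ler_wpM2l ?mulr_ge0 ?(ltW Z0) //.
  by rewrite ler_piMl // invr_ge0 ltW.
have mq : 0 < m `^ q^-1 by rewrite powR_gt0.
rewrite ler_pdivlMr //.
have Z2 : 0 < (2 * Z) `^ q^-1 by rewrite powR_gt0 // mulr_gt0.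
set W := (K%:R * _) `^ _ in h1 *.
have c0 : 0 <= Z / 4 / D * (2 * Z) `^ (- q^-1) * (k * Q `^ (a / p - (1 - q^-1))).
  apply: mulr_ge0; last by rewrite mulr_ge0 ?powR_ge0 // ltW.
  by apply: mulr_ge0; rewrite ?powR_ge0 // !divr_ge0 // ltW.
apply: le_trans (ler_wpM2l c0 h2) _.
have e' : Z / 4 / D * (2 * Z) `^ (- q^-1) * (k * Q `^ (a / p - (1 - q^-1))) *
    ((2 * Z) `^ q^-1 * Q `^ (- q^-1)) = Z * (k / Q / 4) * (Q `^ (a / p) / D).
  have -> : Q `^ (a / p - (1 - q^-1)) = Q `^ (a / p) * Q^-1 * Q `^ q^-1.
    by rewrite -[Q^-1]powR_inv1 ?(ltW Q0) // -!powRD_gt0 //; congr powR; ring.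
  rewrite !powRN; have := powR_gt0 q^-1 Q0; move: Z2.
  move: (Q `^ q^-1) ((2 * Z) `^ q^-1) (Q `^ (a / p)) => u v t v0 u0.
  by field; rewrite !gt_eqF.
rewrite e'; apply: ler_wpM2l h1; apply: mulr_ge0; first exact: ltW.
by rewrite !divr_ge0 // ltW.
Qed.

End Assembly.

Theorem theorem1p8 (R : realType) (alpha beta : R)
    (halpha : 0 < alpha) (hbeta : -1 < beta < 0) :
  exists mu : probability (measurableTypeR R) R,
    [/\ (* (i) *)
        msupport mu `<=` [set` `[- (1 / 2), 1 / 2]] `&` well_approximable alpha,
        (* (ii): for eps > (2+beta)/(2+alpha) the bound is false, as
           |I|^(negative exponent) -> 0 while mu I = 1 for long I *)
        forall eps : R, 0 < eps -> eps <= (2 + beta) / (2 + alpha) ->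
          exists C : R, 0 < C /\
            forall I : interval R,
              (mu [set` I] <=
                 C%:E * lebesgue_measure [set` I]
                          `^ ((2 + beta) / (2 + alpha) - eps))%E,
        (* (iii) *)
        forall eps : R, 0 < eps ->
          exists C : R, 0 < C /\
            forall xi : R,
              fourier_abs mu xi <= C * (1 + `|xi|) `^ (- (1 / (2 + alpha)) + eps)
      & (* (iv) *)
        exists (f : nat -> R -> R)
               (mf : forall k, measurable_fun setT
                                 (f k : measurableTypeR R -> R))
               (f0 : forall k x, 0 <= f k x),
          (* the quotients below are well defined *)
          (forall (k : nat) (q : R), 1 < q ->
             (0 < 'N[mu]_(q%:E)[EFin \o f k] < +oo)%E) /\
          (forall q p : R, 1 < q -> 1 <= p ->
             p < q / (q - 1) * (1 + alpha - beta) ->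
             ereal_sup
               [set ('N[lebesgue_measure]_(p%:E)
                        [EFin \o fourier_abs (mdensity mu (mf k) (f0 k))]
                     / 'N[mu]_(q%:E)[EFin \o f k])%E
                 | k in [set k : nat | (1 <= k)%N]] = +oo%E)].
Proof.
have [Q [N [hQN hsep Q64 hgrow]]] := block_parameters hbeta.
(* Geometric weights make the masses, the transform bounds and the Frostman constants summable; the
   loss of 2^j is recovered by [hgrow]. *)
pose k j := (2 ^+ j)^-1 : R.
have k0 j : 0 < k j by rewrite invr_gt0 exprn_gt0.
have [nu hnu] : exists nu : {measure set (measurableTypeR R) -> \bar R} ^nat,
    forall j, block alpha beta (k j) (Q j) (N j) (nu j).
  have [nu hnu] := choice (fun j => let: And4 h1 h2 h3 h4 := hQN j in
    block_exists halpha hbeta h1 h2 h3 h4 (k0 j)).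
  by exists nu.
have k1 j : k j <= 1 by rewrite invf_le1 ?exprn_gt0 // exprn_ege1 // ler1n.
have Q1 j : (1 : R) <= (Q j)%:R by rewrite ler1n; exact: leq_trans (Q64 j).
have Q0 j : (0 : R) < (Q j)%:R by apply: lt_le_trans (Q1 j).
pose a j := (N j)%:R / (Q j)%:R : R.
have a0 j : 0 < a j by have [h _ _ _] := hQN j; apply: divr_gt0; rewrite ?Q0 // ltr0n.
have a3 j : 3 * (N j)%:R / (Q j)%:R = 3 * a j by rewrite /a mulrA.
have a6 j : 6 * a j <= 1.
  by have [_ h _ _] := hQN j; rewrite /a mulrA ler_pdivrMr // mul1r -natrM ler_nat.
have [adec asmall] := shrinking_itvs a0 (fun j => etrans (congr1 (fun t => t < a j) (esym (a3 j.+1))) (hsep j)).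
pose J j : set R := `](a j), (3 * a j)]%classic.
have mJ j : measurable (J j : set (measurableTypeR R)) by exact: measurable_itv.
have fin j : (nu j setT < +oo)%E by have [[]] := hnu j.
have nJ j : nu j (~` J j) = 0%E by have [[_ h] _ _ _ _] := hnu j; rewrite /J -a3.
have n0 j (A : set R) : measurable (A : set (measurableTypeR R)) -> A `<=` ~` J j -> nu j A = 0%E.
  move=> mA AJ; apply/eqP; rewrite eq_le measure_ge0 andbT -(nJ j).
  by apply: le_measure; rewrite ?inE //; exact: measurableC.
have dJ i j : j != i -> J i `&` J j = set0.
  rewrite -subset0 neq_ltn => ij x []; rewrite /J /= !in_itv /=.
  by case/orP: ij => /adec; clear; lra.
pose sigma : {measure set (measurableTypeR R) -> \bar R} := mseries nu 0.
have single j (A : set R) : measurable (A : set (measurableTypeR R)) -> sigma (J j `&` A) = nu j A.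
  by move=> mA; apply: mseries_conull_single => // i; exact: dJ.
have mass j : nu j setT = (mtr (nu j) 0 0)%:E by rewrite mtr_mass.
have mass_le j : mtr (nu j) 0 0 <= 2 * (k j / (Q j)%:R) by have [_ _ _ _ []] := hnu j.
have low j (n : nat) xi : n.+1%:R <= (Q j)%:R `^ (1 + alpha) / 64 ->
      `|xi - n.+1%:R * (Q j)%:R| <= (Q j)%:R `^ (- beta) / 64 ->
      k j / (Q j)%:R / 4 <= mtr (nu j) xi 0.
  by have [_ _ _ _ [_ h]] := hnu j; exact: h.
have Qa j : 1 <= (Q j)%:R `^ (1 + alpha) / 64.
  rewrite ler_pdivlMr // mul1r; apply: (@le_trans _ _ (Q j)%:R); first by rewrite (ler_nat _ 64).
  by rewrite -[leLHS]powRr1 ?(ltW (Q0 j)) // ler_powR // lerDl ltW.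
(* The mass dominates the transform at the first peak, xi = Q j, where [low] makes it positive. *)
have mass_gt0 j : 0 < mtr (nu j) 0 0.
  apply: lt_le_trans (norm_mtr_le (Q j)%:R 0 (fin j)); apply: lt_le_trans (ler_norm _).
  apply: lt_le_trans (low j 0%N (Q j)%:R (Qa j) _); first by rewrite !divr_gt0.
  by rewrite mul1r subrr normr0 divr_ge0 ?powR_ge0.
have sigma_le : (sigma setT <= 4%:E)%E.
  have -> : 4 = 2 * 2 :> R by ring.
  apply: nneseries_half_le => // n; rewrite mass lee_fin; apply: le_trans (mass_le n) _.
  by rewrite ler_wpM2l // ler_pdivrMr // ler_peMr // ltW.
have finS : (sigma setT < +oo)%E by apply: le_lt_trans sigma_le _; exact: ltry.
have sigma_gt0 : (0 < sigma setT)%E.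
  have h : (sigma (J 0%N `&` setT) <= sigma setT)%E.
    by apply: le_measure; rewrite ?inE // setIT.
  by apply: lt_le_trans h; rewrite single // mass lte_fin.
pose Z := (fine (sigma setT))^-1.
have Z0 : 0 < Z by rewrite invr_gt0 fine_gt0 // sigma_gt0 finS.
(* The Dirac mass is only the default value of [mnormalize] for a zero or infinite total mass, both
   excluded in [muE]. *)
pose mu : probability (measurableTypeR R) R :=
  mnormalize sigma (@dirac _ (measurableTypeR R) (0 : R) R).
have muE (A : set (measurableTypeR R)) : mu A = (Z%:E * sigma A)%E.
  rewrite /mu /= /mnormalize /= ifF; first by rewrite muleC.
  by apply/negP => /orP[]/eqP h; have {}h : sigma setT = _ := h; move: sigma_gt0 finS; rewrite h ltxx.
exists mu; split.
- move=> x xs.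
  have x01 : 0 <= x <= 1 / 2.
    apply: contrapT => nx; pose U := ~` `[0, 1 / 2]%classic : set R.
    have oU : open U by rewrite openC; exact: itv_closed.
    have Ux : U x by rewrite /U /= in_itv.
    have z : mu U = 0%E.
      rewrite muE /sigma /= /mseries eseries0 ?mule0 // => j _ _; apply: n0.
        by apply: measurableC; exact: measurable_itv.
      move=> y Uy Jy; apply: Uy; move: Jy (a6 j) (a0 j); rewrite /J /= !in_itv /=; clear; lra.
    by have pU : (0 < mu U)%E := xs U oU Ux; rewrite z ltxx in pU.
  split; first by rewrite /= in_itv /=; move: x01; clear; lra.
  have [->|x0] := eqVneq x 0; first exact: well_approximable0.
  (* To the right of x / 2 there are only finitely many blocks, so x lies in the support of one of
     them. *)
  have xp : 0 < x / 2 by rewrite divr_gt0 // lt0r x0; case/andP: x01.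
  have [n hn] := asmall _ xp.
  have [|||j sj] := @mseries_support R nu mu Z%:E x `](x / 2), +oo[%classic n muE xs.
  + exact: rray_open.
  + by rewrite /= in_itv /= andbT; move: xp; clear; lra.
  + move=> j nj; apply: n0; first exact: measurable_itv.
    by move=> y; rewrite /J /= !in_itv /= andbT; have := hn j nj; clear; lra.
  by have [_ _ _ h _] := hnu j; exact: h sj.
- move=> eps e0 es; have s0 : 0 < (2 + beta) / (2 + alpha) by apply: divr_gt0; lra.
  have C0 : 0 <= Z * 18 by rewrite mulr_ge0 // ltW.
  apply: (frostman_interval C0 s0 _ _ e0 es); first exact: probability_setT.
  move=> b c bc; apply: (@le_trans _ _ (Z%:E * sigma `]b, c]%classic)%E); first by rewrite -muE.
  rewrite -mulrA EFinM; apply: lee_wpmul2l; first by rewrite lee_fin ltW.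
  have -> : 18 * (c - b) `^ ((2 + beta) / (2 + alpha)) = 2 * (9 * (c - b) `^ ((2 + beta) / (2 + alpha))).
    by ring.
  apply: nneseries_half_le; first by rewrite mulr_ge0 ?powR_ge0.
    by move=> n; exact: measure_ge0.
  move=> n; have [_ _ h _ _] := hnu n; apply: le_trans (h b c bc) _.
  by rewrite lee_fin mulrAC.
- move=> eps e0; have [C C0 hC] := gauge_le_powR (1 / (2 + alpha)) e0.
  (* The outer 2 passes from real phases to the modulus, the inner 2 sums the weights 2^-j, and 3
     comes from [block]. *)
  exists (2 * (Z * (2 * (3 * C)))); split; first by rewrite !mulr_gt0.
  move=> xi; have finmu : (mu setT < +oo)%E by rewrite probability_setT ltry.
  have -> : 2 * (Z * (2 * (3 * C))) * (1 + `|xi|) `^ (- (1 / (2 + alpha)) + eps) =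
      2 * (Z * (2 * (3 * (C * jap xi `^ (- (1 / (2 + alpha)) + eps))))) by rewrite /jap; ring.
  apply: fourier_abs_le => // p.
  rewrite (mtr_scale xi p (ltW Z0) finS (fun A _ => muE A)) normrM (gtr0_norm Z0).
  apply: ler_wpM2l; first exact: ltW.
  apply: norm_mtr_series_le => //.
    by rewrite mulr_ge0 // mulr_ge0 ?powR_ge0 // ltW.
  move=> n p'; have [_ h _ _ _] := hnu n; apply: le_trans (h xi p') _.
  rewrite mulrAC; apply: ler_wpM2r; first by rewrite invr_ge0 exprn_ge0.
  by apply: ler_wpM2l.
pose f j : R -> R := \1_(J j).
have mf j : measurable_fun setT (f j : measurableTypeR R -> R) by exact: measurable_indic.
have f0 j x : 0 <= f j x by rewrite /f indicE.
have muJ j : mu (J j) = (Z * mtr (nu j) 0 0)%:E.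
  by rewrite muE -[J j]setIT single // mass EFinM.
have NJ j (q : R) : 0 < q ->
    'N[mu]_(q%:E)[EFin \o f j]%E = ((Z * mtr (nu j) 0 0) `^ q^-1)%:E.
  move=> q0; apply: etrans (Lnorm_indic _ (mJ j) q0) _.
  by rewrite -poweR_EFin; congr (_ `^ _)%E; exact: muJ.
have m0 j : 0 < Z * mtr (nu j) 0 0 by rewrite mulr_gt0.
exists f, mf, f0; split.
  by move=> j q q1; rewrite NJ ?(lt_trans ltr01 q1) // lte_fin powR_gt0 ?ltry.
move=> q p q1 p1 hp; have q0 : 0 < q by apply: lt_trans q1.
have p0 : 0 < p by apply: lt_le_trans p1.
(* The net exponent of Q in the ratio of norms; it is positive exactly when p is below the
   threshold. *)
pose theta := (1 + alpha - beta) / p - (1 - q^-1).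
have theta0 : 0 < theta.
  rewrite /theta subr_gt0 ltr_pdivlMr //.
  have -> : (1 - q^-1) * p = p * (q - 1) / q by field; rewrite gt_eqF.
  by rewrite ltr_pdivrMr // -ltr_pdivlMr ?subr_gt0 // -mulrA mulrC.
pose D := Z / 4 / (64 * 64) * (2 * Z) `^ (- q^-1).
have D0 : 0 < D by rewrite mulr_gt0 // ?powR_gt0 ?mulr_gt0 // !divr_gt0 // mulr_gt0.
(* An unbounded family suffices: block j gives a ratio of at least D 2^-j (Q j)^theta, and [hgrow]
   makes this exceed M. *)
apply/eqyP => M M0; have [j j1 hj] := hgrow theta (M / D) theta0.
apply: le_trans (_ : ('N[lebesgue_measure]_(p%:E)
    [EFin \o fourier_abs (mdensity mu (mf j) (f0 j))] / 'N[mu]_(q%:E)[EFin \o f j] <= _)%E); last first.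
  by apply: ereal_sup_ubound; exists j.
pose rho : {measure set (measurableTypeR R) -> \bar R} := mdensity mu (mf j) (f0 j).
have rhoE (A : set (measurableTypeR R)) : measurable A -> rho A = (Z%:E * nu j A)%E.
  move=> mA; rewrite -(single j A mA) -muE.
  exact: (@integral_indic _ _ _ mu A mA (J j) (mJ j)).
have finr : (rho setT < +oo)%E by rewrite rhoE // mass -EFinM ltry.
have nr : rho (~` `]0, 1]%classic) = 0%E.
  have m01 : measurable (~` `]0, 1]%classic : set (measurableTypeR R)).
    by apply: measurableC; exact: measurable_itv.
  rewrite rhoE // n0 ?mule0 // => y Uy Jy; apply: Uy; move: Jy (a6 j) (a0 j).
  by rewrite /J /= !in_itv /=; clear; lra.
pose h : R := (Q j)%:R `^ (- beta) / 64.
have h0 : 0 < h by rewrite divr_gt0 // powR_gt0.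
have hQ : 2 * h < (Q j)%:R.
  have : (Q j)%:R `^ (- beta) <= (Q j)%:R :> R.
    by apply: powR_le_self => //; move: hbeta; clear; lra.
  by rewrite /h; have := Q0 j; clear; lra.
pose K := Num.truncn ((Q j)%:R `^ (1 + alpha) / 64).
have hK : K%:R <= (Q j)%:R `^ (1 + alpha) / 64 < K%:R + 1.
  by rewrite natr1; apply: truncn_itv; apply: le_trans (Qa j).
have hK2 : (Q j)%:R `^ (1 + alpha) / 128 <= K%:R.
  have K1 : (1 : R) <= K%:R by rewrite ler1n lt0n; apply/eqP => e; move: hK (Qa j); rewrite e; clear; lra.
  by move: hK K1; clear; lra.
have c0 : 0 <= Z * (k j / (Q j)%:R / 4) by rewrite mulr_ge0 ?divr_ge0 // ltW.
have hF (n : nat) xi : (n < K)%N -> `|xi - n.+1%:R * (Q j)%:R| <= h ->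
    Z * (k j / (Q j)%:R / 4) <= fourier_abs rho xi.
  move=> nK hxi; apply: le_trans (mtr_le_fourier_abs xi finr).
  rewrite (mtr_scale xi 0 (ltW Z0) (fin j) rhoE) ler_wpM2l ?(ltW Z0) //.
  apply: low hxi; have /andP[hK1 _] := hK; apply: le_trans hK1; by rewrite ler_nat.
have lower := Lnorm_ge (continuous_fourier_abs finr nr) h0 hQ c0 p1 hF.
rewrite NJ // inver gt_eqF ?powR_gt0 //.
apply: le_trans (lee_wpmul2r _ lower); last by rewrite lee_fin invr_ge0 powR_ge0.
rewrite -EFinM lee_fin.
have mle : Z * mtr (nu j) 0 0 <= Z * (2 * (k j / (Q j)%:R)) by rewrite ler_wpM2l ?(ltW Z0).
have kk : 0 < k j <= 1 by rewrite k0 k1.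
have := @ratio_lower_bound R alpha beta p q Z (k j) (Q j)%:R _ K p1 Z0 (Q1 j) kk hK2 q0 (m0 j) mle.
apply: le_trans; rewrite -/theta -/D.
rewrite mulrCA; move: hj; rewrite mulrAC ler_pdivrMr // => hj.
rewrite /k ler_pdivlMl ?exprn_gt0 //.
by rewrite mulrC; apply: le_trans hj _; rewrite mulrC.
Qed.
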